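(* For every even positive integer $d$, the three types of isotropic 2-attractors in $\mathbb{R}^d$, namely a parallelepiped, a direct product of $d/2$ dragons, and a direct product of $d/2$ bears, are all homeomorphic to each other, but no two of these three types are bi-Lipschitz equivalent.
   Context: An integer $d\times d$ matrix $M$ is called expanding if all its (complex) eigenvalues have modulus strictly greater than $1$. Let $M$ be an integer expanding $d\times d$ matrix with $|\det M|=2$ and let $D=\{\boldsymbol d_0,\boldsymbol d_1\}\subset\mathbb{Z}^d$ with $\boldsymbol d_1-\boldsymbol d_0\notin M\mathbb{Z}^d$. The 2-attractor generated by $M$ and $D$ is the compact set $G(M,D)=\{\sum_{j=1}^{\infty}M^{-j}\boldsymbol a_j : \boldsymbol a_j\in D \text{ for all } j\}\subset\mathbb{R}^d$. A 2-attractor is isotropic if it is generated by a matrix $M$ that is diagonalizable over $\mathbb{C}$ with all eigenvalues of the same modulus. Two subsets of $\mathbb{R}^d$ are affinely similar if one is the image of the other under an invertible affine map of $\mathbb{R}^d$. A parallelepiped is a set affinely similar to $[0,1]^d$. A dragon is a subset of $\mathbb{R}^2$ affinely similar to a 2-attractor $G(M,D)\subset\mathbb{R}^2$ where $M$ has characteristic polynomial $z^2-2z+2$ or $z^2+2z+2$; a bear is a subset of $\mathbb{R}^2$ affinely similar to a 2-attractor $G(M,D)\subset\mathbb{R}^2$ where $M$ has characteristic polynomial $z^2-z+2$ or $z^2+z+2$ (in each case the set is unique up to affine similarity). Each type is considered up to affine similarity: a direct product of $k$ dragons (bears) is a set affinely similar to $K_1\times\cdots\times K_k\subset(\mathbb{R}^2)^k=\mathbb{R}^{2k}$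 where each $K_i$ is a dragon (respectively, each $K_i$ is a bear). Two compact sets $G_1,G_2\subset\mathbb{R}^d$ are bi-Lipschitz equivalent if there is a bi-Lipschitz homeomorphism $f:\mathbb{R}^d\to\mathbb{R}^d$ with $f(G_1)=G_2$, where bi-Lipschitz means that there is a constant $C>0$ such that $C^{-1}|\boldsymbol x_1-\boldsymbol x_2|\le|f(\boldsymbol x_1)-f(\boldsymbol x_2)|\le C|\boldsymbol x_1-\boldsymbol x_2|$ for all $\boldsymbol x_1,\boldsymbol x_2\in\mathbb{R}^d$. *)

(* Defs.v *)
From HB Require Import structures.
From mathcomp Require Import all_boot all_order all_algebra.
From mathcomp Require Import complex.
From mathcomp Require Import all_classical all_reals all_analysis.

Set Implicit Arguments.
Unset Strict Implicit.
Unset Printing Implicit Defensive.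

Import Order.TTheory GRing.Theory Num.Theory.
Import numFieldNormedType.Exports.

Local Open Scope classical_set_scope.
Local Open Scope ring_scope.

(** R^d is ['cV[R]_d], with its product topology. The library
    norm on matrices is the sup norm, hence this definition. *)
Definition euclid (R : realType) (d : nat) (x : 'cV[R]_d) : R :=
  Num.sqrt (\sum_i x i 0 ^+ 2).

Definition int_to_real (R : realType) (m n : nat) (M : 'M[int]_(m, n)) :
    'M[R]_(m, n) :=
  map_mx intr M.

Definition int_to_complex (R : realType) (m n : nat) (M : 'M[int]_(m, n)) :
    'M[complex R]_(m, n) :=
  map_mx intr M.

(** [eigenvalue] refers to row vectors; a matrix and its transpose have the
    same eigenvalues. *)
Definition expanding (R : realType) (d : nat) (M : 'M[int]_d) : Prop :=
  forall z : complex R, eigenvalue (int_to_complex R M) z -> 1 < `|z|.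

(** [M] and the digits [d0], [d1] generate a 2-attractor. *)
Definition generates (R : realType) (d : nat) (M : 'M[int]_d)
    (d0 d1 : 'cV[int]_d) : Prop :=
  [/\ expanding R M,
      `|\det M| = 2 &
      ~ exists v : 'cV[int]_d, d1 - d0 = M *m v].

(** The series starts at [j = 0], hence the exponent [j.+1]. *)
Definition attractor (R : realType) (d : nat) (M : 'M[int]_d)
    (D : set 'cV[int]_d) : set 'cV[R]_d :=
  [set x | exists a : nat -> 'cV[int]_d,
    (forall j, D (a j)) /\
    series (fun j => invmx (int_to_real R M) ^+ j.+1 *m int_to_real R (a j))
      @ \oo --> x].

Arguments attractor R {d} M D _.

Definition isotropic_2attractor (R : realType) (d : nat)
    (G : set 'cV[R]_d) : Prop :=
  exists (M : 'M[int]_d) (d0 d1 : 'cV[int]_d),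
    [/\ generates R M d0 d1,
        G = attractor R M [set d0; d1],
        diagonalizable (int_to_complex R M) &
        forall z w : complex R,
          eigenvalue (int_to_complex R M) z ->
          eigenvalue (int_to_complex R M) w -> `|z| = `|w|].

Definition affinely_similar (R : realType) (d : nat)
    (A B : set 'cV[R]_d) : Prop :=
  exists (L : 'M[R]_d) (b : 'cV[R]_d),
    L \in unitmx /\ B = (fun x => L *m x + b) @` A.

Definition parallelepiped (R : realType) (d : nat) (P : set 'cV[R]_d) : Prop :=
  affinely_similar [set x : 'cV[R]_d | forall i, 0 <= x i 0 <= 1] P.

Definition dragon (R : realType) (K : set 'cV[R]_2) : Prop :=
  exists (M : 'M[int]_2) (d0 d1 : 'cV[int]_2),
    [/\ generates R M d0 d1,
        char_poly M = 'X^2 - 2%:P * 'X + 2%:P \/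
        char_poly M = 'X^2 + 2%:P * 'X + 2%:P &
        affinely_similar (attractor R M [set d0; d1]) K].

Definition bear (R : realType) (K : set 'cV[R]_2) : Prop :=
  exists (M : 'M[int]_2) (d0 d1 : 'cV[int]_2),
    [/\ generates R M d0 d1,
        char_poly M = 'X^2 - 'X + 2%:P \/
        char_poly M = 'X^2 + 'X + 2%:P &
        affinely_similar (attractor R M [set d0; d1]) K].

Lemma block_index_subproof (d : nat) (i : 'I_d./2) (j : 'I_2) :
  (i.*2 + j < d)%N.
Proof.
have di : (i.*2.+2 <= d)%N.
  by rewrite -doubleS -[leqRHS]odd_double_half (leq_trans _ (leq_addl _ _))// leq_double.
by apply: leq_trans di; rewrite -addnS -[i.*2.+2]addn2 leq_add2l ltn_ord.
Qed.

(** For even [d], the identification of R^d with (R^2)^(d/2): the [i]-th block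
    of [x] consists of its coordinates [2i] and [2i+1]. *)
Definition block (R : realType) (d : nat) (x : 'cV[R]_d) (i : 'I_d./2) :
    'cV[R]_2 :=
  \col_j x (Ordinal (block_index_subproof i j)) 0.

(** Meaningful for even [d] only (otherwise the last coordinate is free). *)
Definition planar_product (R : realType) (d : nat)
    (K : 'I_d./2 -> set 'cV[R]_2) : set 'cV[R]_d :=
  [set x | forall i, K i (block x i)].

Definition product_of_dragons (R : realType) (d : nat)
    (A : set 'cV[R]_d) : Prop :=
  exists K : 'I_d./2 -> set 'cV[R]_2,
    (forall i, dragon (K i)) /\ affinely_similar (planar_product K) A.

Definition product_of_bears (R : realType) (d : nat)
    (A : set 'cV[R]_d) : Prop :=
  exists K : 'I_d./2 -> set 'cV[R]_2,
    (forall i, bear (K i)) /\ affinely_similar (planar_product K) A.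

(** Homeomorphy of [A] and [B] as topological subspaces. *)
Definition homeomorphic (R : realType) (d : nat) (A B : set 'cV[R]_d) : Prop :=
  exists f g : 'cV[R]_d -> 'cV[R]_d,
    [/\ f @` A `<=` B /\ g @` B `<=` A,
        {in A, cancel f g} /\ {in B, cancel g f},
        {within A, continuous f} &
        {within B, continuous g}].

Definition homeomorphism (R : realType) (d : nat) (f : 'cV[R]_d -> 'cV[R]_d) :
    Prop :=
  continuous f /\
  exists g : 'cV[R]_d -> 'cV[R]_d, [/\ cancel f g, cancel g f & continuous g].

Definition bilipschitz (R : realType) (d : nat) (f : 'cV[R]_d -> 'cV[R]_d) :
    Prop :=
  exists2 C : R, 0 < C &
    forall x1 x2 : 'cV[R]_d,
      C^-1 * euclid (x1 - x2) <= euclid (f x1 - f x2) <= C * euclid (x1 - x2).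

Definition bilipschitz_equivalent (R : realType) (d : nat)
    (G1 G2 : set 'cV[R]_d) : Prop :=
  exists f : 'cV[R]_d -> 'cV[R]_d,
    [/\ homeomorphism f, bilipschitz f & f @` G1 = G2].

(** Affine similarity class of an isotropic 2-attractor. *)
Definition isotropic_type (R : realType) (d : nat) (A : set 'cV[R]_d) : Prop :=
  exists2 G : set 'cV[R]_d, isotropic_2attractor G & affinely_similar G A.

(* Main.v *)
(** The companion matrices of X^2 - tX + n with (t, n) = (0, -2), (1, 2), (2, 2) generate a square, a
    bear and a dragon. In dimension d = 2k, let M permute k planar blocks cyclically and apply the
    companion matrix to one of them; then M^(2k) = t M^k - n, so M is diagonalizable with all
    eigenvalues of modulus 2^(1/d), and its attractor is a k-th power of the planar one.

    Homeomorphy: points are coded by infinite binary words. A bear or a dragon meets exactly six of its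
    translates by the lattice Z[M], and so does a suitable hexagon carrying two piecewise affine
    contractions which glue along its sides according to the same neighbour graph. Hence the codings of
    the tile and of the hexagon identify the same pairs of words, which makes the tile homeomorphic to
    the hexagon, hence to the square; splitting a word into k subwords extends this to the products.

    Bi-Lipschitz inequivalence: a bi-Lipschitz homeomorphism of the space preserves the exponential
    growth rate in m of the number of sets of diameter about 2^-m needed to cover the topological
    boundary. The boundary of a tile is the union of its intersections with its neighbours, whose pieces
    are counted by walks in the neighbour graph. The growth rates are 2^(d-2) times 2 for the cube,
    l^2 = 2.31... with l^3 = l + 2 for bears and l^2 = 2.87... with l^3 = l^2 + 2 for dragons. *)

Require Import Defs.
From HB Require Import structures.
From mathcomp Require Import all_boot all_order all_algebra.
From mathcomp Require Import perm separable.
From mathcomp Require Import complex.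
From mathcomp Require Import all_classical all_reals all_analysis.
From mathcomp Require Import ring lra zify.

Set Implicit Arguments.
Unset Strict Implicit.
Unset Printing Implicit Defensive.

Import Order.TTheory GRing.Theory Num.Theory.
Import numFieldNormedType.Exports.

Local Open Scope classical_set_scope.
Local Open Scope ring_scope.

(** * Codings by infinite words *)

(** No homeomorphism between a tile and its hexagon is written down: the argument compares only the
    fibres of the two codings, and these are governed by integer vectors. The lattice vector
    separating two pieces evolves by [nxt] and has to stay in a finite set. For the tile this is an
    exact computation, because the inverse companion matrix is a similarity for [qnorm]; for the
    hexagon it is a finite list of affine identities along the sides and along the chord that
    separates the two pieces. The digits are -1/2 and 1/2, which makes the tile, the hexagon and the
    graph symmetric about 0 and reduces the list to five transitions in each case.

    The growth rates are only estimated. As 2 < 1.52^2 and 1.53^2 < 1.69^2, rational weights on the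
    neighbour graph are enough. The cube has the slowest growth and the dragons the fastest, so
    covers are always carried by a Lipschitz map towards the faster growing boundary: this takes
    upper bounds for the cube and the bears, lower bounds for the bears and the dragons. *)

Section QuadraticNorm.
Context {R : realType}.
Implicit Types (al be : R) (x y z : R * R).

(* With [al = t / 2] and [be = n - t ^ 2 / 4] this is the norm form x1^2 + t x1 x2 + n x2^2, for
   which the companion matrix of X^2 - tX + n is a similarity. *)
Definition qnorm al be (x : R * R) : R :=
  Num.sqrt ((x.1 + al * x.2) ^+ 2 + be * x.2 ^+ 2).

Variables (al be : R).
Hypothesis be_gt0 : 0 < be.
Local Notation N := (qnorm al be).

Let sq_ge0 x : 0 <= (x.1 + al * x.2) ^+ 2 + be * x.2 ^+ 2.
Proof. by rewrite addr_ge0 ?sqr_ge0// mulr_ge0 ?sqr_ge0// ltW. Qed.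

Lemma qnorm_ge0 x : 0 <= N x. Proof. exact: sqrtr_ge0. Qed.

Lemma qnorm_sqr x : N x ^+ 2 = (x.1 + al * x.2) ^+ 2 + be * x.2 ^+ 2.
Proof. by rewrite sqr_sqrtr. Qed.

Lemma qnormD x y : N (x + y) <= N x + N y.
Proof.
have N0 := qnorm_ge0; have NE := qnorm_sqr.
rewrite -(ler_pXn2r (ltn0Sn 1)) ?nnegrE ?addr_ge0//.
rewrite sqrrD !NE /=.
set a := x.1 + al * x.2; set c := y.1 + al * y.2.
have -> : x.1 + y.1 + al * (x.2 + y.2) = a + c by rewrite /a /c; ring.
have : a * c + be * (x.2 * y.2) <= N x * N y.
  apply: le_trans (ler_norm _) _.
  rewrite -(ler_pXn2r (ltn0Sn 1)) ?nnegrE ?normr_ge0 ?mulr_ge0//.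
  rewrite real_normK ?num_real// exprMn !NE -/a -/c.
  (* Lagrange's identity: the defect in the Cauchy-Schwarz inequality is [be] times a square. *)
  rewrite -subr_ge0 (_ : _ - _ = be * (a * y.2 - c * x.2) ^+ 2); last by ring.
  by rewrite mulr_ge0 ?sqr_ge0// ltW.
move=> h; lra.
Qed.

Lemma qnormZ (l : R) x : N (l * x.1, l * x.2) = `|l| * N x.
Proof.
rewrite /qnorm /= -(@sqrtr_sqr _ l) -sqrtrM ?sqr_ge0//; congr Num.sqrt; ring.
Qed.

Lemma qnormN x : N (- x) = N x.
Proof. by rewrite /qnorm /=; congr Num.sqrt; ring. Qed.

Lemma qnorm_distC x y : N (x - y) = N (y - x).
Proof. by rewrite -qnormN opprB. Qed.

Lemma qnorm_triangle z x y : N (x - y) <= N (x - z) + N (z - y).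
Proof. by have := qnormD (x - z) (z - y); rewrite addrA subrK. Qed.

Lemma qnorm0 : N 0 = 0.
Proof. by rewrite /qnorm /= !mulr0 addr0 expr0n/= mulr0 addr0 sqrtr0. Qed.

Definition qnorm_cst : R := (1 + `|al|) / Num.min 1 (Num.sqrt be).

Lemma qnorm_cst_gt0 : 0 < qnorm_cst.
Proof.
rewrite divr_gt0 ?ltr_wpDr ?normr_ge0// lt_min ltr01 /= sqrtr_gt0//.
Qed.

Lemma qnorm_coord x : `|x.1| <= qnorm_cst * N x /\ `|x.2| <= qnorm_cst * N x.
Proof.
set m := Num.min 1 (Num.sqrt be).
have m0 : 0 < m by rewrite lt_min ltr01 /= sqrtr_gt0.
have Nge u : u ^+ 2 <= N x ^+ 2 -> `|u| <= N x.
  move=> h; rewrite -(ler_pXn2r (ltn0Sn 1)) ?nnegrE ?normr_ge0 ?qnorm_ge0//.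
  by rewrite real_normK ?num_real.
have h1 : `|x.1 + al * x.2| <= N x.
  by apply: Nge; rewrite qnorm_sqr lerDl mulr_ge0 ?sqr_ge0// ltW.
have h2 : Num.sqrt be * `|x.2| <= N x.
  rewrite -[Num.sqrt be]ger0_norm ?sqrtr_ge0// -normrM.
  apply: Nge; rewrite qnorm_sqr exprMn sqr_sqrtr ?(ltW be_gt0)//.
  by have := sqr_ge0 (x.1 + al * x.2) => h; lra.
have h3 : m * `|x.2| <= N x.
  by apply: le_trans h2; rewrite ler_wpM2r// ge_min lexx orbT.
have m1 : m <= 1 by rewrite ge_min lexx.
rewrite /qnorm_cst -/m mulrAC !ler_pdivlMr//; split.
  have -> : x.1 = (x.1 + al * x.2) - al * x.2 by ring.
  have /le_trans := ler_normB (x.1 + al * x.2) (al * x.2); rewrite normrM.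
  have e1 : `|x.1 + al * x.2| * m <= N x.
    by apply: le_trans h1; rewrite ler_piMr.
  have e2 : `|al| * (m * `|x.2|) <= `|al| * N x by rewrite ler_wpM2l.
  move=> hh; apply: (@le_trans _ _ ((`|x.1 + al * x.2| + `|al| * `|x.2|) * m)).
    by rewrite ler_pM2r//; exact: (hh _ (lexx _)).
  by rewrite !mulrDl mul1r -mulrA [`|x.2| * m]mulrC; apply: lerD.
by rewrite mulrC (le_trans h3)// mulrDl mul1r lerDl mulr_ge0// qnorm_ge0.
Qed.

Lemma qnorm_le x : N x <= (1 + `|al| + Num.sqrt be) * Num.max `|x.1| `|x.2|.
Proof.
set m := Num.max _ _.
have m0 : 0 <= m by rewrite le_max normr_ge0.
have m1 : `|x.1| <= m by rewrite le_max lexx.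
have m2 : `|x.2| <= m by rewrite le_max lexx orbT.
have s0 := sqrtr_ge0 be.
rewrite -(ler_pXn2r (ltn0Sn 1)) ?nnegrE ?qnorm_ge0//; last first.
  by rewrite mulr_ge0// !addr_ge0.
rewrite qnorm_sqr -[in be * _](@sqr_sqrtr _ be) ?(ltW be_gt0)// -exprMn.
set a := x.1 + _; set b := _ * x.2.
have ha : `|a| <= (1 + `|al|) * m.
  apply: le_trans (ler_normD _ _) _; rewrite mulrDl mul1r normrM.
  by apply: lerD => //; rewrite ler_wpM2l.
have hb : `|b| <= Num.sqrt be * m.
  by rewrite normrM (ger0_norm s0) ler_wpM2l.
rewrite -(@real_normK _ a) ?num_real// -(@real_normK _ b) ?num_real//.
rewrite mulrDl; move: ((1 + `|al|) * m) (Num.sqrt be * m) ha hb => A B ha hb.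
have A0 : 0 <= A by rewrite (le_trans _ ha).
have B0 : 0 <= B by rewrite (le_trans _ hb).
have i1 : `|a| ^+ 2 <= A ^+ 2 by rewrite ler_pXn2r ?nnegrE.
have i2 : `|b| ^+ 2 <= B ^+ 2 by rewrite ler_pXn2r ?nnegrE.
have := mulr_ge0 A0 B0; rewrite sqrrD => h; lra.
Qed.

Lemma qnorm_eq0 x : N x = 0 -> x = 0.
Proof.
move=> h; have [] := qnorm_coord x; rewrite h mulr0 !normr_le0 => /eqP e1 /eqP e2.
by rewrite [x]surjective_pairing e1 e2.
Qed.

End QuadraticNorm.

(** * Coding the points of an iterated function system *)

Section IFS.
Context {R : realType}.
Variables (al be rho diam : R).
Hypotheses (be_gt0 : 0 < be) (rho_ge0 : 0 <= rho) (rho_lt1 : rho < 1).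
Local Notation N := (qnorm al be).

Lemma geometric_small (c e : R) : 0 < e -> exists n, c * rho ^+ n < e.
Proof.
move=> e0.
have /cvgrPdist_lt/(_ e e0) [n _ /(_ n (leqnn n))] : (fun n => c * rho ^+ n) @ \oo --> c * 0.
  by apply: cvgMr; apply: cvg_expr; rewrite ger0_norm.
by rewrite mulr0 sub0r normrN => /(le_lt_trans (ler_norm _)); exists n.
Qed.

(** Equalities of coded points are obtained this way: their distance is bounded at every level of
    the iteration. *)
Lemma le_geometric (a c : R) : (forall n, a <= c * rho ^+ n) -> a <= 0.
Proof.
move=> h; rewrite leNgt; apply/negP => /(geometric_small c)[n].
by rewrite ltNge h.
Qed.

Lemma geometric_cauchy (u : nat -> R) (c : R) :
  (forall n m, `|u n - u (n + m)%N| <= c * rho ^+ n) ->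
  exists l, forall n, `|u n - l| <= c * rho ^+ n.
Proof.
move=> h.
have cu : cvgn u.
  apply/cauchy_cvgP/cauchyP => e e0.
  have [n hn] := geometric_small c e0.
  exists (u n); exists n => //= k /= nk.
  rewrite /ball /= -(subnKC nk); exact: le_lt_trans (h _ _) hn.
have shu n : (fun m => u (n + m)%N) @ \oo --> limn u.
  by apply: cvg_comp cu; exact: cvg_addnl.
exists (limn u) => n; rewrite -subr_ge0.
have -> : c * rho ^+ n - `|u n - limn u| = limn (fun m => c * rho ^+ n - `|u n - u (n + m)%N|).
  apply/esym/cvg_lim => //; apply: cvgB; first exact: cvg_cst.
  by apply: cvg_norm; apply: cvgB => //; exact: cvg_cst.
apply: limr_ge; last by apply: nearW => m; rewrite subr_ge0.
apply: is_cvgB; first exact: is_cvg_cst.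
apply/cvg_ex; exists `|u n - limn u|.
by apply: cvg_norm; apply: cvgB => //; exact: cvg_cst.
Qed.

Variables (h : bool -> R * R -> R * R) (Q : set (R * R)) (x0 : R * R).
Hypotheses (Qx0 : Q x0) (hQ : forall b x, Q x -> Q (h b x)).
Hypothesis diamQ : forall x y, Q x -> Q y -> N (x - y) <= diam.
Hypothesis h_lip : forall b x y, Q x -> Q y ->
  N (h b x - h b y) <= rho * N (x - y).
Hypothesis Q_closed : forall x, (forall e, 0 < e -> exists2 y, Q y & N (x - y) <= e) -> Q x.

Definition wtail (u : nat -> bool) : nat -> bool := fun n => u n.+1.

Fixpoint act n (u : nat -> bool) (x : R * R) : R * R :=
  if n is m.+1 then h (u 0%N) (act m (wtail u) x) else x.

Lemma actQ n u x : Q x -> Q (act n u x).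
Proof. by elim: n u => //= n IH u Qx; apply/hQ/IH. Qed.

Lemma act_lip n u x y : Q x -> Q y ->
  N (act n u x - act n u y) <= rho ^+ n * N (x - y).
Proof.
move=> Qx Qy; elim: n u => [|n IH] u /=; first by rewrite mul1r.
apply: le_trans (h_lip _ (actQ _ _ Qx) (actQ _ _ Qy)) _.
by rewrite exprS -mulrA ler_wpM2l.
Qed.

Lemma act_diam n u x y : Q x -> Q y ->
  N (act n u x - act n u y) <= diam * rho ^+ n.
Proof.
move=> Qx Qy; apply: le_trans (act_lip _ _ Qx Qy) _.
by rewrite mulrC ler_wpM2r ?exprn_ge0// diamQ.
Qed.

Lemma act_add n m u x : act (n + m) u x = act n u (act m (fun i => u (n + i)%N) x).
Proof. by elim: n u => //= n IH u; rewrite IH. Qed.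

Lemma eq_act n u v x : (forall i, (i < n)%N -> u i = v i) -> act n u x = act n v x.
Proof.
elim: n u v => //= n IH u v uv; rewrite uv//; congr h; apply: IH => i ni.
exact: uv.
Qed.

Lemma ifs_lim u : exists x, forall n, N (act n u x0 - x) <= qnorm_cst al be * diam *
   (1 + `|al| + Num.sqrt be) * rho ^+ n.
Proof.
set c := qnorm_cst al be.
have hh n m : N (act n u x0 - act (n + m) u x0) <= diam * rho ^+ n.
  by rewrite act_add; apply: act_diam => //; apply: actQ.
have c0 : 0 < c by apply: qnorm_cst_gt0.
have [l1 hl1] : exists l, forall n, `|(act n u x0).1 - l| <= (c * diam) * rho ^+ n.
  apply: geometric_cauchy => n m.
  have [+ _] := qnorm_coord al be_gt0 (act n u x0 - act (n + m) u x0).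
  by move=> /le_trans; apply; rewrite -mulrA ler_pM2l.
have [l2 hl2] : exists l, forall n, `|(act n u x0).2 - l| <= (c * diam) * rho ^+ n.
  apply: geometric_cauchy => n m.
  have [_ +] := qnorm_coord al be_gt0 (act n u x0 - act (n + m) u x0).
  by move=> /le_trans; apply; rewrite -mulrA ler_pM2l.
exists (l1, l2) => n.
apply: le_trans (qnorm_le _ be_gt0 _) _.
rewrite [leRHS]mulrAC [leRHS]mulrC ler_wpM2l ?addr_ge0 ?sqrtr_ge0 ?normr_ge0//.
by rewrite ge_max; apply/andP; split; [exact: hl1|exact: hl2].
Qed.

Definition addr_pt (u : nat -> bool) : R * R := projT1 (cid (ifs_lim u)).

Lemma addr_pt_lim u n : N (act n u x0 - addr_pt u) <=
  qnorm_cst al be * diam * (1 + `|al| + Num.sqrt be) * rho ^+ n.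
Proof. by rewrite /addr_pt; case: cid. Qed.

Lemma addr_ptQ u : Q (addr_pt u).
Proof.
apply: Q_closed => e e0.
have [n hn] := geometric_small (qnorm_cst al be * diam * (1 + `|al| + Num.sqrt be)) e0.
exists (act n u x0); first exact: actQ.
by rewrite qnorm_distC (le_trans (addr_pt_lim u n))// ltW.
Qed.

Lemma addr_pt_uniq u x c : (forall n, N (act n u x0 - x) <= c * rho ^+ n) ->
  addr_pt u = x.
Proof.
move=> hx; apply/subr0_eq/(qnorm_eq0 (al := al) be_gt0)/eqP.
rewrite eq_le qnorm_ge0 andbT.
apply: (@le_geometric _ (qnorm_cst al be * diam * (1 + `|al| + Num.sqrt be) + c)) => n.
rewrite mulrDl; apply: le_trans (qnorm_triangle _ be_gt0 (act n u x0) _ _) _.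
by rewrite lerD// qnorm_distC addr_pt_lim.
Qed.

Lemma addr_ptS u : addr_pt u = h (u 0%N) (addr_pt (wtail u)).
Proof.
have Qs := addr_ptQ (wtail u).
apply: (@addr_pt_uniq _ _ (Num.max diam (qnorm_cst al be * diam * (1 + `|al| + Num.sqrt be)))).
case => [|n] /=.
  by rewrite mulr1 le_max diamQ//; apply: hQ.
apply: le_trans (h_lip _ (actQ _ _ Qx0) Qs) _.
rewrite exprS mulrCA ler_wpM2l//; apply: le_trans (addr_pt_lim _ n) _.
by rewrite ler_wpM2r ?exprn_ge0// le_max lexx orbT.
Qed.

Lemma addr_pt_act n u : addr_pt u = act n u (addr_pt (fun i => u (n + i)%N)).
Proof.
elim: n u => [|n IH] u //=.
by rewrite addr_ptS IH.
Qed.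

Lemma addr_pt_prefix n u x : Q x -> N (addr_pt u - act n u x) <= diam * rho ^+ n.
Proof. by move=> Qx; rewrite (addr_pt_act n); apply: act_diam => //; apply: addr_ptQ. Qed.

Lemma addr_pt_surj : (forall x, Q x -> exists b, exists2 y, Q y & x = h b y) ->
  forall x, Q x -> exists u, addr_pt u = x.
Proof.
move=> hsurj x Qx.
have /choice[f hf] : forall x, exists by_ : bool * (R * R), Q x -> Q by_.2 /\ x = h by_.1 by_.2.
  move=> z; have [/hsurj[b [y Qy zE]]|nQ] := pselect (Q z); last by exists (true, x).
  by exists (b, y).
(* Run the system backwards: follow chosen preimages of [x] and record which map was undone at each
   step. *)
pose orb n := iter n (fun z => (f z).2) x.
pose u n := (f (orb n)).1.
have Qorb n : Q (orb n).
  elim: n => [|n IH] //=; exact: (hf _ IH).1.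
have key n m : orb m = act n (fun i => u (m + i)%N) (orb (m + n)%N).
  elim: n m => [|n IH] m /=; first by rewrite addn0.
  rewrite addn0 {1}(hf _ (Qorb m)).2; congr h.
  have := IH m.+1; rewrite addSnnS /= => ->.
  by apply: eq_act => i _; rewrite /wtail addSnnS.
exists u; apply: (@addr_pt_uniq _ _ diam) => n.
have -> : x = act n u (orb n) by exact: (key n 0%N).
exact: act_diam.
Qed.

End IFS.

(** * Neighbour vectors and plane models *)

Section Model.
Context {R : realType}.
Implicit Types (x y z : R * R) (s : int * int).

Definition pos (a : R) : R := if 0 <= a then a else 0.

Lemma posP a : (0 <= a /\ pos a = a) \/ (a <= 0 /\ pos a = 0).
Proof. by rewrite /pos; case: (leP 0 a) => [|/ltW]; [left|right]. Qed.

Lemma pos_id a : 0 <= a -> pos a = a. Proof. by rewrite /pos => ->. Qed.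

Lemma pos_0 a : a <= 0 -> pos a = 0.
Proof. by rewrite /pos; case: (ltgtP 0 a) => // <-. Qed.

Definition lat s : R * R := (s.1%:~R, s.2%:~R).

Lemma latN s : lat (- s) = - lat s.
Proof. by rewrite /lat /= !rmorphN. Qed.

Lemma lat0 : lat 0 = 0.
Proof. by rewrite /lat /= mulr0z. Qed.

(** Centred digits: with -1/2 and 1/2 instead of 0 and 1 the two contractions of the tile are
    conjugate under x -> -x. *)
Definition digit (b : bool) : R * R := (if b then 1/2 else -1/2, 0).

(** Let C be the companion matrix and d_i, d_j the digits. Then C^-1 (x + d_i) = C^-1 (y + d_j) + s
    means x = y + C s + d_j - d_i; the new vector C s + d_j - d_i is [nxt]. *)
Definition nxt (t n : int) s (i j : bool) : int * int :=
  (- n * s.2 + (j%:Z - i%:Z), s.1 + t * s.2).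

Lemma nxtN t n s i j : nxt t n (- s) (~~ i) (~~ j) = - nxt t n s i j.
Proof. by rewrite /nxt; case: i j => [] [] /=; congr pair; rewrite /= ?mulrN; lia. Qed.

Lemma nxt_swap t n s i j : nxt t n (- s) j i = - nxt t n s i j.
Proof. by rewrite /nxt; case: i j => [] [] /=; congr pair; rewrite /= ?mulrN; lia. Qed.

Definition pm (p : R * R -> R * R) (b : bool) x := if b then p x else - p (- x).

Lemma pmN p b x : pm p (~~ b) (- x) = - pm p b x.
Proof. by case: b; rewrite /pm/= ?opprK. Qed.

(* The plane model of a self-affine tile: [Q] is a hexagon with one pair of sides for each pair of
   neighbours [s], [- s] in [S], and [pm p] plays the part of the two contractions of the tile. *)
Record model (t n : int) (S : seq (int * int)) (Q : set (R * R))
    (p : R * R -> R * R) : Prop := Model {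
  modelQN : forall x, Q x -> Q (- x);
  modelSN : forall s, s \in S -> - s \in S;
  modelS0 : 0 \in S;
  model_half : forall s, s \in S -> exists2 x, Q x & Q (x - lat s);
  model_centre : Q 0;
  model_sep : forall s, s \in S -> s != 0 -> ~ Q (lat s);
  model_stable : forall x, Q x -> Q (p x);
  model_onto : forall x, Q x -> exists b, exists2 y, Q y & x = pm p b y;
  model_glue : forall x y i j, Q x -> Q y -> pm p i x = pm p j y ->
    x + digit i = y + digit j;
  model_edge : forall s x, s \in S -> s != 0 -> Q x -> Q (x - lat s) ->
    exists i j y, [/\ nxt t n s i j \in S, Q y, Q (y - lat (nxt t n s i j)) & x = pm p i y];
  model_back : forall s x i j, s \in S -> nxt t n s i j \in S ->
    Q x -> Q (x - lat (nxt t n s i j)) -> pm p i x = pm p j (x - lat (nxt t n s i j)) + lat s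
}.

(** Converse of [model_back]. For s = 0 it is [model_glue]. Otherwise the common point lies on a
    side of the hexagon, [model_edge] writes it as the image of some z, and [model_glue] compares x
    with z and y with the translate of z. *)
Lemma model_fwd t n S Q p : model t n S Q p -> forall s x y i j,
  s \in S -> Q x -> Q y -> pm p i x = pm p j y + lat s ->
  x = y + lat (nxt t n s i j) .
Proof.
move=> m s x y i j sS Qx Qy xy.
(* Other letters change the next vector by differences of digits, the quantity that [model_glue]
   also measures. *)
have E i' j' : lat (nxt t n s i j) = lat (nxt t n s i' j') + digit i' - digit j' - digit i + digit j.
  by rewrite /lat /nxt; case: i j i' j' {xy} => [] [] [] [] /=; congr pair;
     rewrite ?rmorphD ?rmorphB /=; lra.
have pmQ b z : Q z -> Q (pm p b z).
  move=> Qz; case: b => /=; first exact: (model_stable m).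
  by apply/(modelQN m)/(model_stable m)/(modelQN m).
have [s0|s0] := eqVneq s 0.
  have xy0 : pm p i x = pm p j y by rewrite xy s0 lat0 addr0.
  have := model_glue m Qx Qy xy0.
  rewrite (E true true) /lat /nxt s0 /= => /eqP; rewrite -subr_eq => /eqP <-.
  by rewrite (_ : (_, _) = 0) ?add0r; [ring|congr pair; ring].
have Qxs : Q (pm p i x - lat s) by rewrite xy addrK; apply: pmQ.
have [i' [j' [z [nS Qz Qzs xz]]]] := model_edge m sS s0 (pmQ i x Qx) Qxs.
have := model_back m sS nS Qz Qzs; rewrite -xz xy => /addIr /esym/(model_glue m Qzs Qy).
have := model_glue m Qx Qz xz; rewrite (E i' j').
move=> /eqP; rewrite -subr_eq => /eqP <- h2.
rewrite -[y](addrK (digit j)) -h2; ring.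
Qed.

End Model.

Section Build.
Context {R : realType}.
Variables (t n : int) (S : seq (int * int)) (Q : set (R * R)) (p : R * R -> R * R).
Implicit Types (x y z : R * R) (s : int * int).

Definition back_cond s i j := forall x, Q x -> Q (x - lat (nxt t n s i j)) ->
  pm p i x = pm p j (x - lat (nxt t n s i j)) + lat s.

Definition edge_cond s := forall x, Q x -> Q (x - lat s) ->
  exists i j y, [/\ nxt t n s i j \in S, Q y, Q (y - lat (nxt t n s i j)) &
    x = pm p i y].

Hypothesis QN : forall x, Q x -> Q (- x).

Lemma back_condN s i j : back_cond s i j -> back_cond (- s) (~~ i) (~~ j).
Proof.
move=> h x Qx; rewrite nxtN !latN opprK => Qx'.
have := h (- x) (QN Qx); rewrite -opprD => /(_ (QN Qx')) e.
by rewrite -{1}[x]opprK pmN e [- (_ + lat s)]opprD -pmN opprK.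
Qed.

Lemma back_cond_swap s i j : back_cond s i j -> back_cond (- s) j i.
Proof.
move=> h x Qx; rewrite nxt_swap latN opprK => Qx'.
by have := h _ Qx'; rewrite addrK => -> //; rewrite latN addrK.
Qed.

Lemma edge_condN s : (forall s, s \in S -> - s \in S) -> edge_cond s -> edge_cond (- s).
Proof.
move=> SN h x Qx; rewrite latN opprK => Qx'.
have := h (- x) (QN Qx); rewrite -opprD => /(_ (QN Qx'))[i [j [y [nS Qy Qy' e]]]].
exists (~~ i), (~~ j), (- y); rewrite nxtN; split; [exact: SN|exact: QN| |].
  by rewrite latN -opprD; apply: QN.
by rewrite pmN -e opprK.
Qed.

(** The functional [c] is nonnegative on the first piece and nonpositive on its opposite, so a
    common point lies on the chord c = 0. The chord is the image of the side shared with the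
    translate by (-1, 0), where the gluing identity is known; injectivity of [p] then determines
    both preimages. *)
Lemma glue_of_chord (c : R * R -> R) :
  (forall x, c (- x) = - c x) ->
  (forall x, Q x -> 0 <= c (p x)) ->
  (forall x, Q x -> c (p x) = 0 -> Q (x + (1, 0))) ->
  (forall x y, Q x -> Q y -> p x = p y -> x = y) ->
  (forall x, Q x -> Q (x + (1, 0)) -> p x = - p (- (x + (1, 0)))) ->
  forall x y i j, Q x -> Q y -> pm p i x = pm p j y -> x + digit i = y + digit j.
Proof.
move=> cN c_ge0 c0 inj chord.
have tf x y : Q x -> Q y -> p x = - p (- y) -> x + digit true = y + digit false.
  move=> Qx Qy e.
  have cx0 : c (p x) = 0.
    by apply/eqP; rewrite eq_le c_ge0// {1}e cN oppr_le0 c_ge0//; apply: QN.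
  have Qx' := c0 _ Qx cx0.
  have := chord _ Qx Qx'; rewrite e => /oppr_inj /(inj _ _ (QN Qy) (QN Qx')) /oppr_inj ->.
  rewrite -addrA; congr +%R; rewrite /digit; congr pair; rewrite /=; lra.
move=> x y [] [] Qx Qy /= e.
- by rewrite (inj _ _ Qx Qy e).
- exact: tf.
- by apply/esym/tf.
- by move: e => /oppr_inj /(inj _ _ (QN Qx) (QN Qy)) /oppr_inj ->.
Qed.

End Build.

(** * Piecewise affine contractions of convex sets *)

Section Lipschitz.
Context {R : realType}.
Variables (al be rho : R).
Hypotheses (be_gt0 : 0 < be) (rho_ge0 : 0 <= rho).
Local Notation N := (qnorm al be).
Implicit Types (A : set (R * R)) (f : R * R -> R * R).

Definition convex2 A := forall (x y : R * R) (a b : R), A x -> A y -> 0 <= a -> 0 <= b -> a + b = 1 ->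
  A (a * x.1 + b * y.1, a * x.2 + b * y.2).

Definition lip_on A f := forall x y, A x -> A y -> N (f x - f y) <= rho * N (x - y).

Lemma convex2_half (a b c : R) : convex2 [set x | 0 <= a * x.1 + b * x.2 + c].
Proof.
move=> x y p q /= xp yp p0 q0 pq.
have h1 := mulr_ge0 p0 xp; have h2 := mulr_ge0 q0 yp.
have -> : c = p * c + q * c by rewrite -mulrDl pq mul1r.
lra.
Qed.

Lemma convex2I A B : convex2 A -> convex2 B -> convex2 (A `&` B).
Proof. by move=> hA hB x y p q [Ax Bx] [Ay By] p0 q0 pq; split; [exact: hA|exact: hB]. Qed.

(** A segment joining the two halves crosses the dividing line at a point of [A], and the norm is
    additive along the segment. *)
Lemma lip_glue A f (a b c : R) : convex2 A ->
  lip_on (A `&` [set x | 0 <= a * x.1 + b * x.2 + c]) f ->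
  lip_on (A `&` [set x | 0 <= (- a) * x.1 + (- b) * x.2 + (- c)]) f -> lip_on A f.
Proof.
pose l (x : R * R) := a * x.1 + b * x.2 + c.
have lE (x : R * R) : - a * x.1 + - b * x.2 + - c = - l x by rewrite /l; ring.
move=> cA hp hn.
have cross x y : A x -> A y -> 0 < l x -> l y < 0 -> N (f x - f y) <= rho * N (x - y).
  move=> Ax Ay lx ly.
  have D0 : 0 < l x - l y by lra.
  pose p := - l y / (l x - l y); pose q := l x / (l x - l y).
  have p0 : 0 <= p by rewrite divr_ge0// ?oppr_ge0 ltW.
  have q0 : 0 <= q by rewrite divr_ge0// ltW.
  have pq : p + q = 1 by rewrite -mulrDl addrC divff// gt_eqF.
  pose z := (p * x.1 + q * y.1, p * x.2 + q * y.2).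
  have Az : A z by exact: cA.
  have lz : l z = 0.
    (* The weights [p] and [q] are chosen so that [z] is the crossing point. *)
    have -> : l z = p * l x + q * l y + (1 - p - q) * c by rewrite /l /z /=; ring.
    by rewrite /p /q -pq /p /q; field; rewrite gt_eqF.
  have zp : 0 <= a * z.1 + b * z.2 + c by rewrite -/(l z) lz.
  have zn : 0 <= (- a) * z.1 + (- b) * z.2 + (- c) by rewrite lE lz oppr0.
  have qE : 1 - p = q by rewrite -pq; ring.
  have pE : 1 - q = p by rewrite -pq; ring.
  have e1 : N (x - z) = q * N (x - y).
    rewrite -{1}(ger0_norm q0) -qnormZ; congr N; rewrite /z; congr pair; rewrite /= -qE; ring.
  have e2 : N (z - y) = p * N (x - y).
    rewrite -{1}(ger0_norm p0) -qnormZ; congr N; rewrite /z; congr pair; rewrite /= -qE; ring.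
  apply: le_trans (qnorm_triangle _ be_gt0 (f z) _ _) _.
  have i1 : N (f x - f z) <= rho * N (x - z) by apply: hp; split => //=; exact: ltW.
  have i2 : N (f z - f y) <= rho * N (z - y).
    by apply: hn; split => //=; rewrite lE oppr_ge0 ltW.
  apply: le_trans (lerD i1 i2) _.
  by rewrite e1 e2 -mulrDr -mulrDl addrC pq mul1r.
move=> x y Ax Ay.
have [lx|lx] := lerP 0 (l x); have [ly|ly] := lerP 0 (l y).
- exact: hp.
- move: lx; rewrite le_eqVlt => /predU1P[lx|lx]; last exact: cross.
  by apply: hn; split => //=; rewrite lE -?lx ?oppr0// oppr_ge0 ltW.
- move: ly; rewrite le_eqVlt => /predU1P[ly|ly].
    by apply: hn; split => //=; rewrite lE -?ly ?oppr0// oppr_ge0 ltW.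
  by rewrite qnorm_distC (qnorm_distC _ _ x); apply: cross.
- by apply: hn; split => //=; rewrite lE oppr_ge0 ltW.
Qed.

(** The form rho^2 N(u, v)^2 - N(L(u, v))^2 equals P u^2 + 2 S u v + T v^2; completing the square
    shows it to be nonnegative when P > 0 and P T >= S^2. *)
Lemma affine_lip (a b c e : R) :
  let P := rho ^+ 2 - ((a + al * c) ^+ 2 + be * c ^+ 2) in
  let S := rho ^+ 2 * al - ((a + al * c) * (b + al * e) + be * c * e) in
  let T := rho ^+ 2 * (al ^+ 2 + be) - ((b + al * e) ^+ 2 + be * e ^+ 2) in
  0 < P -> 0 <= P * T - S ^+ 2 -> forall u v, N (a * u + b * v, c * u + e * v) <= rho * N (u, v).
Proof.
move=> P S T P0 D0 u v.
rewrite -(ler_pXn2r (ltn0Sn 1)) ?nnegrE ?mulr_ge0 ?qnorm_ge0//.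
rewrite exprMn !qnorm_sqr//= -subr_ge0 -(pmulr_rge0 _ P0).
have -> : P * (rho ^+ 2 * ((u + al * v) ^+ 2 + be * v ^+ 2) -
   ((a * u + b * v + al * (c * u + e * v)) ^+ 2 + be * (c * u + e * v) ^+ 2)) =
   (P * u + S * v) ^+ 2 + (P * T - S ^+ 2) * v ^+ 2 by rewrite /P /S /T; ring.
by rewrite addr_ge0 ?sqr_ge0// mulr_ge0// sqr_ge0.
Qed.

Lemma affine_piece_lip A f (p q a b c e : R) :
  (forall x, A x -> f x = (p + a * x.1 + b * x.2, q + c * x.1 + e * x.2)) ->
  0 < rho ^+ 2 - ((a + al * c) ^+ 2 + be * c ^+ 2) ->
  0 <= (rho ^+ 2 - ((a + al * c) ^+ 2 + be * c ^+ 2)) *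
     (rho ^+ 2 * (al ^+ 2 + be) - ((b + al * e) ^+ 2 + be * e ^+ 2)) -
   (rho ^+ 2 * al - ((a + al * c) * (b + al * e) + be * c * e)) ^+ 2 ->
  lip_on A f.
Proof.
move=> fE h1 h2 x y Ax Ay; have := affine_lip h1 h2 (x - y).1 (x - y).2.
rewrite -surjective_pairing; apply: le_trans; rewrite le_eqVlt; apply/orP; left; apply/eqP.
by rewrite (fE x Ax) (fE y Ay); congr N; congr pair; rewrite /=; ring.
Qed.

Lemma pm_lip A p : (forall x, A x -> A (- x)) -> lip_on A p ->
  forall b, lip_on A (pm p b).
Proof.
move=> AN h [] x y Ax Ay /=; first exact: h.
rewrite -opprD qnormN.
have -> : p (- x) - p (- y) = p (-x) - p (-y) by [].
apply: le_trans (h _ _ (AN _ Ax) (AN _ Ay)) _.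
by rewrite -opprD qnormN.
Qed.

End Lipschitz.

(** * Hexagonal models of the bear and of the dragon *)

Ltac eval_pos := repeat match goal with |- context [pos ?a] =>
  first [rewrite (@pos_0 _ a); [|lra] | rewrite (@pos_id _ a); [|lra]] end.

Section BearModel.
Context {R : realType}.

Definition bear_hex : set (R * R) := [set x |
  [/\ -3 <= 2 * x.1 + 6 * x.2 <= 3, -3 <= 2 * x.1 - 4 * x.2 <= 3 &
      -1 <= 2 * x.1 + x.2 <= 1]].

(* Affine on each triangle of the fan of diagonals from the vertex -v3. With v1 = (3/10, 2/5),
   v2 = (-3/10, 3/5), v3 = (-7/10, 2/5) and g = (11/20, -1/10), it sends the vertices v1, v2, v3,
   -v1, -v2, -v3 to -v3, g, (1, 0) - g, g - (1, 0), -v1, -v2. *)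
Definition bear_fan (x : R * R) : R * R :=
  (3/8 + 3/4 * x.1 + 3/2 * x.2 + 5/12 * pos (x.1 + x.2 - 3/10)
     - 1/6 * pos (4 * x.1 + 7 * x.2),
   - x.1 / 2 - 1/4).

Definition bear_nbrs : seq (int * int) :=
  [:: (0, 0); (1, 0); (0, 1); (-1, 1); (-1, 0); (0, -1); (1, -1)].

Lemma bear_hexN x : bear_hex x -> bear_hex (- x).
Proof. by rewrite /bear_hex /= => -[/andP[a1 a2] /andP[a3 a4] /andP[a5 a6]]; split; lra. Qed.

Lemma bear_fan_stable x : bear_hex x -> bear_hex (bear_fan x).
Proof.
case: x => x1 x2; rewrite /bear_hex /bear_fan /= => -[/andP[a1 a2] /andP[a3 a4] /andP[a5 a6]].
case: (posP (x1 + x2 - 3/10)) => -[h1 ->]; case: (posP (4 * x1 + 7 * x2)) => -[h2 ->].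
all: by split; lra.
Qed.

Lemma bear_fan_inj x y : bear_hex x -> bear_hex y -> bear_fan x = bear_fan y -> x = y.
Proof.
case: x y => [x1 x2] [y1 y2]; rewrite /bear_hex /bear_fan /= => -[/andP[a1 a2] /andP[a3 a4] /andP[a5 a6]].
move=> -[/andP[b1 b2] /andP[b3 b4] /andP[b5 b6]] [+ e2].
have e1 : x1 = y1 by lra.
subst y1.
case: (posP (x1 + x2 - 3/10)) => -[h1 ->]; case: (posP (4 * x1 + 7 * x2)) => -[h2 ->];
case: (posP (x1 + y2 - 3/10)) => -[h3 ->]; case: (posP (4 * x1 + 7 * y2)) => -[h4 ->] e.
all: by clear -h1 h2 h3 h4 e; congr pair; lra.
Qed.

(** The three cases are the images of the affine pieces, separated by the segments from -v2 to g and
    from -v2 to (1, 0) - g; the witnesses invert the pieces. There are only three because the fan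
    map has no kink along the diagonal from -v3 to -v1. *)
Lemma bear_onto x : bear_hex x -> 0 <= 2 * x.1 - 9 * x.2 ->
  exists2 y, bear_hex y & x = bear_fan y.
Proof.
case: x => [x1 x2]; rewrite /bear_hex /bear_fan /= => -[/andP[a1 a2] /andP[a3 a4] /andP[a5 a6]] c.
have [h1|h1] := leP (- 2 * x1 + x2 + 6/5) 0.
  exists (- 2 * x2 - 1/2, 4/3 * x1 + 4/3 * x2) => /=; first by split; lra.
  by eval_pos; congr pair; first [field | lra].
have [h2|h2] := leP (- 14 * x1 + 3 * x2 + 6) 0.
  exists (- 2 * x2 - 1/2, 3 * x1 + x2 / 2 - 1) => /=; first by split; lra.
  by eval_pos; congr pair; first [field | lra].
exists (- 2 * x2 - 1/2, 2/3 * x1 + x2) => /=; first by split; lra.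
by eval_pos; congr pair; first [field | lra].
Qed.

Lemma bear_chord x : bear_hex x -> bear_hex (x + (1, 0)) ->
  bear_fan x = - bear_fan (- (x + (1, 0))).
Proof.
case: x => [x1 x2]; rewrite /bear_hex /bear_fan /= => -[/andP[a1 a2] /andP[a3 a4] /andP[a5 a6]].
move=> -[/andP[b1 b2] /andP[b3 b4] /andP[b5 b6]].
have e : x2 = - 1 - 2 * x1 by lra.
by rewrite e; congr pair; rewrite /=; eval_pos; first [field | lra].
Qed.

Lemma bear_chord_side x : bear_hex x -> 0 <= 2 * (bear_fan x).1 - 9 * (bear_fan x).2.
Proof.
case: x => x1 x2; rewrite /bear_hex /bear_fan /= => -[/andP[a1 a2] /andP[a3 a4] /andP[a5 a6]].
case: (posP (x1 + x2 - 3/10)) => -[h1 ->]; case: (posP (4 * x1 + 7 * x2)) => -[h2 ->].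
all: lra.
Qed.

Lemma bear_chord_eq x : bear_hex x -> 2 * (bear_fan x).1 - 9 * (bear_fan x).2 = 0 ->
  bear_hex (x + (1, 0)).
Proof.
case: x => x1 x2; rewrite /bear_hex /bear_fan /= => -[/andP[a1 a2] /andP[a3 a4] /andP[a5 a6]].
case: (posP (x1 + x2 - 3/10)) => -[h1 ->]; case: (posP (4 * x1 + 7 * x2)) => -[h2 ->] e.
all: by split; lra.
Qed.

End BearModel.

Section BearEdges.
Context {R : realType}.
Local Notation bear_hex := (@bear_hex R).
Local Notation bear_fan := (@bear_fan R).

Lemma bear_edge_a : edge_cond 1 2 bear_nbrs bear_hex bear_fan (1, 0).
Proof.
move=> [x1 x2]; rewrite /bear_hex /lat /= => -[/andP[a1 a2] /andP[a3 a4] /andP[a5 a6]] -[/andP[b1 b2] /andP[b3 b4] /andP[b5 b6]].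
have e : x2 = 1 - 2 * x1 by lra.
rewrite {}e in a1 a2 a3 a4 a5 a6 b1 b2 b3 b4 b5 b6 *.
have r1 : 3/10 <= x1 by lra.
have r2 : x1 <= 7/10 by lra.
clear a1 a2 a3 a4 a5 a6 b1 b2 b3 b4 b5 b6.
(* 11/20 and 9/20 are the abscissas of g and (1, 0) - g. They cut this side into images of three
   sides, one for each edge leaving (1, 0) in the neighbour graph. *)
have [h0|h0] := leP (11/20) x1.
  exists true, true, (4 * x1 - 5/2, 2/5 + 4/3 * (7/10 - x1)).
  have -> : nxt 1 2 (1, 0) true true = (0, 1) by [].
  split; [by []|by rewrite /bear_hex /=; split; lra|by rewrite /bear_hex /lat /=; split; lra|].
  by rewrite /pm /bear_fan /=; congr pair; rewrite /=; eval_pos; first [field | lra].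
have [h1|h1] := leP (9/20) x1.
  exists true, false, (4 * x1 - 5/2, 2 * x1 - 1/2).
  have -> : nxt 1 2 (1, 0) true false = (-1, 1) by [].
  split; [by []|by rewrite /bear_hex /=; split; lra|by rewrite /bear_hex /lat /=; split; lra|].
  by rewrite /pm /bear_fan /=; congr pair; rewrite /=; eval_pos; first [field | lra].
exists false, false, (4 * x1 - 3/2, 2/5 + 4/3 * (9/20 - x1)).
have -> : nxt 1 2 (1, 0) false false = (0, 1) by [].
split; [by []|by rewrite /bear_hex /=; split; lra|by rewrite /bear_hex /lat /=; split; lra|].
by rewrite /pm /bear_fan /=; congr pair; rewrite /=; eval_pos; first [field | lra].
Qed.

Lemma bear_edge_b : edge_cond 1 2 bear_nbrs bear_hex bear_fan (0, 1).
Proof.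
move=> [x1 x2]; rewrite /bear_hex /lat /= => -[/andP[a1 a2] /andP[a3 a4] /andP[a5 a6]] -[/andP[b1 b2] /andP[b3 b4] /andP[b5 b6]].
have e : x2 = 1/2 - x1 / 3 by lra.
rewrite {}e in a1 a2 a3 a4 a5 a6 b1 b2 b3 b4 b5 b6 *.
have r1 : -3/10 <= x1 by lra.
have r2 : x1 <= 3/10 by lra.
clear a1 a2 a3 a4 a5 a6 b1 b2 b3 b4 b5 b6.
exists false, true, (2/3 * x1 - 1/2, 1/2 + x1 / 3).
have -> : nxt 1 2 (0, 1) false true = (-1, 1) by [].
split; [by []|by rewrite /bear_hex /=; split; lra|by rewrite /bear_hex /lat /=; split; lra|].
by rewrite /pm /bear_fan /=; congr pair; rewrite /=; eval_pos; first [field | lra].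
Qed.

Lemma bear_edge_c : edge_cond 1 2 bear_nbrs bear_hex bear_fan (-1, 1).
Proof.
move=> [x1 x2]; rewrite /bear_hex /lat /= => -[/andP[a1 a2] /andP[a3 a4] /andP[a5 a6]] -[/andP[b1 b2] /andP[b3 b4] /andP[b5 b6]].
have e : x2 = (2 * x1 + 3) / 4 by lra.
rewrite {}e in a1 a2 a3 a4 a5 a6 b1 b2 b3 b4 b5 b6 *.
have r1 : -7/10 <= x1 by lra.
have r2 : x1 <= -3/10 by lra.
clear a1 a2 a3 a4 a5 a6 b1 b2 b3 b4 b5 b6.
exists false, true, (- 1 - x1, 1 + 2 * x1).
have -> : nxt 1 2 (-1, 1) false true = (-1, 0) by [].
split; [by []|by rewrite /bear_hex /=; split; lra|by rewrite /bear_hex /lat /=; split; lra|].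
by rewrite /pm /bear_fan /=; congr pair; rewrite /=; eval_pos; first [field | lra].
Qed.

Lemma bear_back_aa : back_cond 1 2 bear_hex bear_fan (1, 0) true true.
Proof.
have E : nxt 1 2 (1, 0) true true = (0, 1) by [].
move=> [x1 x2]; rewrite E /bear_hex /lat /= => -[/andP[a1 a2] /andP[a3 a4] /andP[a5 a6]] -[/andP[b1 b2] /andP[b3 b4] /andP[b5 b6]].
have e : x2 = 1/2 - x1 / 3 by lra.
rewrite {}e in a1 a2 a3 a4 a5 a6 b1 b2 b3 b4 b5 b6 *.
have r1 : -3/10 <= x1 by lra.
have r2 : x1 <= 3/10 by lra.
clear a1 a2 a3 a4 a5 a6 b1 b2 b3 b4 b5 b6.
by rewrite /pm /bear_fan /=; congr pair; rewrite /=; eval_pos; first [field | lra].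
Qed.

Lemma bear_back_ac : back_cond 1 2 bear_hex bear_fan (1, 0) true false.
Proof.
have E : nxt 1 2 (1, 0) true false = (-1, 1) by [].
move=> [x1 x2]; rewrite E /bear_hex /lat /= => -[/andP[a1 a2] /andP[a3 a4] /andP[a5 a6]] -[/andP[b1 b2] /andP[b3 b4] /andP[b5 b6]].
have e : x2 = (2 * x1 + 3) / 4 by lra.
rewrite {}e in a1 a2 a3 a4 a5 a6 b1 b2 b3 b4 b5 b6 *.
have r1 : -7/10 <= x1 by lra.
have r2 : x1 <= -3/10 by lra.
clear a1 a2 a3 a4 a5 a6 b1 b2 b3 b4 b5 b6.
by rewrite /pm /bear_fan /=; congr pair; rewrite /=; eval_pos; first [field | lra].
Qed.

Lemma bear_back_bc : back_cond 1 2 bear_hex bear_fan (0, 1) false true.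
Proof.
have E : nxt 1 2 (0, 1) false true = (-1, 1) by [].
move=> [x1 x2]; rewrite E /bear_hex /lat /= => -[/andP[a1 a2] /andP[a3 a4] /andP[a5 a6]] -[/andP[b1 b2] /andP[b3 b4] /andP[b5 b6]].
have e : x2 = (2 * x1 + 3) / 4 by lra.
rewrite {}e in a1 a2 a3 a4 a5 a6 b1 b2 b3 b4 b5 b6 *.
have r1 : -7/10 <= x1 by lra.
have r2 : x1 <= -3/10 by lra.
clear a1 a2 a3 a4 a5 a6 b1 b2 b3 b4 b5 b6.
by rewrite /pm /bear_fan /=; congr pair; rewrite /=; eval_pos; first [field | lra].
Qed.

Lemma bear_back_ca : back_cond 1 2 bear_hex bear_fan (-1, 1) false true.
Proof.
have E : nxt 1 2 (-1, 1) false true = (-1, 0) by [].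
move=> [x1 x2]; rewrite E /bear_hex /lat /= => -[/andP[a1 a2] /andP[a3 a4] /andP[a5 a6]] -[/andP[b1 b2] /andP[b3 b4] /andP[b5 b6]].
have e : x2 = - 1 - 2 * x1 by lra.
rewrite {}e in a1 a2 a3 a4 a5 a6 b1 b2 b3 b4 b5 b6 *.
have r1 : -7/10 <= x1 by lra.
have r2 : x1 <= -3/10 by lra.
clear a1 a2 a3 a4 a5 a6 b1 b2 b3 b4 b5 b6.
by rewrite /pm /bear_fan /=; congr pair; rewrite /=; eval_pos; first [field | lra].
Qed.

End BearEdges.

Section DragonModel.
Context {R : realType}.

Definition dragon_hex : set (R * R) := [set x |
  [/\ -2 <= x.1 + 5 * x.2 <= 2, -1 <= x.1 <= 1 & -2 <= 4 * x.1 + 5 * x.2 <= 2]].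

(* Affine on each triangle of the fan of diagonals from the vertex v1. With v1 = (0, 2/5),
   v2 = (-1, 3/5), v3 = (-1, 2/5) and g = (-1/5, 11/25), it sends the vertices v1, v2, v3,
   -v1, -v2, -v3 to -v3, v1, g, -g, g - (-1, 1), -v2. *)
Definition dragon_fan (x : R * R) : R * R :=
  (3/5 + 6/5 * x.1 + x.2 - 2/5 * pos x.1,
   - (21/25) * x.1 + x.2 / 20 - 21/50 - 1/4 * pos (x.2 - 2/5)
   + 73/100 * pos x.1 - 1/4 * pos (x.1 + x.2 - 2/5)).

Definition dragon_nbrs : seq (int * int) :=
  [:: (0, 0); (1, 0); (-1, 1); (-2, 1); (-1, 0); (1, -1); (2, -1)].

Lemma dragon_hexN x : dragon_hex x -> dragon_hex (- x).
Proof. by rewrite /dragon_hex /= => -[/andP[a1 a2] /andP[a3 a4] /andP[a5 a6]]; split; lra. Qed.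

(** Inside the hexagon only four of the eight sign patterns of the three kinks occur. *)
Lemma dragon_fanE x : dragon_hex x ->
  [\/ [/\ x.1 <= 0, 2/5 <= x.2 & dragon_fan x =
       (3/5 + 6/5 * x.1 + x.2, - (21/25) * x.1 - x.2 / 5 - 8/25)],
      [/\ x.1 <= 0, x.2 <= 2/5 & dragon_fan x =
       (3/5 + 6/5 * x.1 + x.2, - (21/25) * x.1 + x.2 / 20 - 21/50)],
      [/\ 0 <= x.1, x.1 + x.2 <= 2/5 & dragon_fan x =
       (3/5 + 4/5 * x.1 + x.2, - (11/100) * x.1 + x.2 / 20 - 21/50)] |
      [/\ 0 <= x.1, 2/5 <= x.1 + x.2 & dragon_fan x =
       (3/5 + 4/5 * x.1 + x.2, - (9/25) * x.1 - x.2 / 5 - 8/25)]].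
Proof.
case: x => x1 x2; rewrite /dragon_hex /dragon_fan /= => -[/andP[a1 a2] /andP[a3 a4] /andP[a5 a6]].
have [h|h] := leP 0 x1.
  have -> : pos (x2 - 2/5) = 0 by rewrite pos_0//; lra.
  rewrite (pos_id h); case: (posP (x1 + x2 - 2/5)) => -[k ->].
    by apply: Or44; split; [lra|lra|congr pair; lra].
  by apply: Or43; split; [lra|lra|congr pair; lra].
have -> : pos (x1 + x2 - 2/5) = 0 by rewrite pos_0//; lra.
rewrite (pos_0 (ltW h)); case: (posP (x2 - 2/5)) => -[k ->].
  by apply: Or41; split; [lra|lra|congr pair; lra].
by apply: Or42; split; [lra|lra|congr pair; lra].
Qed.

Lemma dragon_fan_stable x : dragon_hex x -> dragon_hex (dragon_fan x).
Proof.
move=> hx; case: (dragon_fanE hx) => -[+ + ->]; move: hx; case: x => x1 x2;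
rewrite /dragon_hex /= => -[/andP[a1 a2] /andP[a3 a4] /andP[a5 a6]] h k.
all: by split; lra.
Qed.

Lemma dragon_fan_inj x y : dragon_hex x -> dragon_hex y ->
  dragon_fan x = dragon_fan y -> x = y.
Proof.
move=> hx hy; case: (dragon_fanE hx) => -[+ + ->]; case: (dragon_fanE hy) => -[+ + ->];
move: hx hy; case: x y => [x1 x2] [y1 y2]; rewrite /dragon_hex /= => -[/andP[a1 a2] /andP[a3 a4] /andP[a5 a6]]
  -[/andP[b1 b2] /andP[b3 b4] /andP[b5 b6]] h1 h2 h3 h4 [e1 e2].
all: by clear -h1 h2 h3 h4 e1 e2; congr pair; lra.
Qed.

Lemma dragon_onto x : dragon_hex x -> 0 <= 11 * x.1 + 5 * x.2 ->
  exists2 y, dragon_hex y & x = dragon_fan y.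
Proof.
case: x => [x1 x2]; rewrite /dragon_hex /dragon_fan /= => -[/andP[a1 a2] /andP[a3 a4] /andP[a5 a6]] c.
have [h1|h1] := leP (- 21 * x1 - 30 * x2 + 9) 0.
  exists (- (x1 / 3) - 5/3 * x2 - 1/3, 7/5 * x1 + 2 * x2 - 1/5) => /=; first by split; lra.
  by eval_pos; congr pair; first [field | lra].
have [h2|h2] := leP (x1 - 20 * x2 - 9) 0.
  exists (x1 / 18 - 10/9 * x2 - 1/2, 14/15 * x1 + 4/3 * x2) => /=; first by split; lra.
  by eval_pos; congr pair; first [field | lra].
have [h3|h3] := leP (4 * x1 - 5 * x2 - 6) 0.
  exists (x1 / 3 - 20/3 * x2 - 3, 11/15 * x1 + 16/3 * x2 + 9/5) => /=; first by split; lra.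
  by eval_pos; congr pair; first [field | lra].
exists (- x1 - 5 * x2 - 1, 9/5 * x1 + 4 * x2 + 1/5) => /=; first by split; lra.
by eval_pos; congr pair; first [field | lra].
Qed.

Lemma dragon_chord x : dragon_hex x -> dragon_hex (x + (1, 0)) ->
  dragon_fan x = - dragon_fan (- (x + (1, 0))).
Proof.
case: x => [x1 x2]; rewrite /dragon_hex /dragon_fan /= => -[/andP[a1 a2] /andP[a3 a4] /andP[a5 a6]].
move=> -[/andP[b1 b2] /andP[b3 b4] /andP[b5 b6]].
have e : x2 = - (2/5) - 4/5 * x1 by lra.
by rewrite e; congr pair; rewrite /=; eval_pos; first [field | lra].
Qed.

Lemma dragon_chord_side x : dragon_hex x ->
  0 <= 11 * (dragon_fan x).1 + 5 * (dragon_fan x).2.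
Proof.
move=> hx; case: (dragon_fanE hx) => -[+ + ->]; move: hx; case: x => x1 x2;
rewrite /dragon_hex /= => -[/andP[a1 a2] /andP[a3 a4] /andP[a5 a6]] h k.
all: lra.
Qed.

Lemma dragon_chord_eq x : dragon_hex x ->
  11 * (dragon_fan x).1 + 5 * (dragon_fan x).2 = 0 -> dragon_hex (x + (1, 0)).
Proof.
move=> hx; case: (dragon_fanE hx) => -[+ + ->]; move: hx; case: x => x1 x2;
rewrite /dragon_hex /= => -[/andP[a1 a2] /andP[a3 a4] /andP[a5 a6]] h k e.
all: by split; lra.
Qed.

End DragonModel.

Section DragonEdges.
Context {R : realType}.
Local Notation dragon_hex := (@dragon_hex R).
Local Notation dragon_fan := (@dragon_fan R).

Lemma dragon_edge_a : edge_cond 2 2 dragon_nbrs dragon_hex dragon_fan (1, 0).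
Proof.
move=> [x1 x2]; rewrite /dragon_hex /lat /= => -[/andP[a1 a2] /andP[a3 a4] /andP[a5 a6]] -[/andP[b1 b2] /andP[b3 b4] /andP[b5 b6]].
have e : x2 = (2 - 4 * x1) / 5 by lra.
rewrite {}e in a1 a2 a3 a4 a5 a6 b1 b2 b3 b4 b5 b6 *.
have r1 : 0 <= x1 by lra.
have r2 : x1 <= 1 by lra.
clear a1 a2 a3 a4 a5 a6 b1 b2 b3 b4 b5 b6.
exists true, false, (x1 - 1, 3/5 - x1 / 5).
have -> : nxt 2 2 (1, 0) true false = (-1, 1) by [].
split; [by []|by rewrite /dragon_hex /=; split; lra|by rewrite /dragon_hex /lat /=; split; lra|].
by rewrite /pm /dragon_fan /=; congr pair; rewrite /=; eval_pos; first [field | lra].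
Qed.

Lemma dragon_edge_b : edge_cond 2 2 dragon_nbrs dragon_hex dragon_fan (-1, 1).
Proof.
move=> [x1 x2]; rewrite /dragon_hex /lat /= => -[/andP[a1 a2] /andP[a3 a4] /andP[a5 a6]] -[/andP[b1 b2] /andP[b3 b4] /andP[b5 b6]].
have e : x2 = (2 - x1) / 5 by lra.
rewrite {}e in a1 a2 a3 a4 a5 a6 b1 b2 b3 b4 b5 b6 *.
have r1 : -1 <= x1 by lra.
have r2 : x1 <= 0 by lra.
clear a1 a2 a3 a4 a5 a6 b1 b2 b3 b4 b5 b6.
(* -1/5 and -4/5 are the abscissas of g and (-1, 1) - g, where this side is cut into images of three
   sides. *)
have [h0|h0] := leP (- (1/5)) x1.
  exists true, true, (-1, 3/5 + x1).
  have -> : nxt 2 2 (-1, 1) true true = (-2, 1) by [].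
  split; [by []|by rewrite /dragon_hex /=; split; lra|by rewrite /dragon_hex /lat /=; split; lra|].
  by rewrite /pm /dragon_fan /=; congr pair; rewrite /=; eval_pos; first [field | lra].
have [h1|h1] := leP (- (4/5)) x1.
  exists false, true, (5/3 * x1 + 1/3, 1/3 - x1 / 3).
  have -> : nxt 2 2 (-1, 1) false true = (-1, 1) by [].
  split; [by []|by rewrite /dragon_hex /=; split; lra|by rewrite /dragon_hex /lat /=; split; lra|].
  by rewrite /pm /dragon_fan /=; congr pair; rewrite /=; eval_pos; first [field | lra].
exists false, false, (-1, 7/5 + x1).
have -> : nxt 2 2 (-1, 1) false false = (-2, 1) by [].
split; [by []|by rewrite /dragon_hex /=; split; lra|by rewrite /dragon_hex /lat /=; split; lra|].
by rewrite /pm /dragon_fan /=; congr pair; rewrite /=; eval_pos; first [field | lra].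
Qed.

Lemma dragon_edge_c : edge_cond 2 2 dragon_nbrs dragon_hex dragon_fan (-2, 1).
Proof.
move=> [x1 x2]; rewrite /dragon_hex /lat /= => -[/andP[a1 a2] /andP[a3 a4] /andP[a5 a6]] -[/andP[b1 b2] /andP[b3 b4] /andP[b5 b6]].
have e : x1 = - 1 by lra.
rewrite {}e in a1 a2 a3 a4 a5 a6 b1 b2 b3 b4 b5 b6 *.
have r1 : 2/5 <= x2 by lra.
have r2 : x2 <= 3/5 by lra.
clear a1 a2 a3 a4 a5 a6 b1 b2 b3 b4 b5 b6.
exists false, true, (2 - 5 * x2, 4 * x2 - 2).
have -> : nxt 2 2 (-2, 1) false true = (-1, 0) by [].
split; [by []|by rewrite /dragon_hex /=; split; lra|by rewrite /dragon_hex /lat /=; split; lra|].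
by rewrite /pm /dragon_fan /=; congr pair; rewrite /=; eval_pos; first [field | lra].
Qed.

Lemma dragon_back_ab : back_cond 2 2 dragon_hex dragon_fan (1, 0) true false.
Proof.
have E : nxt 2 2 (1, 0) true false = (-1, 1) by [].
move=> [x1 x2]; rewrite E /dragon_hex /lat /= => -[/andP[a1 a2] /andP[a3 a4] /andP[a5 a6]] -[/andP[b1 b2] /andP[b3 b4] /andP[b5 b6]].
have e : x2 = (2 - x1) / 5 by lra.
rewrite {}e in a1 a2 a3 a4 a5 a6 b1 b2 b3 b4 b5 b6 *.
have r1 : -1 <= x1 by lra.
have r2 : x1 <= 0 by lra.
clear a1 a2 a3 a4 a5 a6 b1 b2 b3 b4 b5 b6.
by rewrite /pm /dragon_fan /=; congr pair; rewrite /=; eval_pos; first [field | lra].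
Qed.

Lemma dragon_back_bb : back_cond 2 2 dragon_hex dragon_fan (-1, 1) false true.
Proof.
have E : nxt 2 2 (-1, 1) false true = (-1, 1) by [].
move=> [x1 x2]; rewrite E /dragon_hex /lat /= => -[/andP[a1 a2] /andP[a3 a4] /andP[a5 a6]] -[/andP[b1 b2] /andP[b3 b4] /andP[b5 b6]].
have e : x2 = (2 - x1) / 5 by lra.
rewrite {}e in a1 a2 a3 a4 a5 a6 b1 b2 b3 b4 b5 b6 *.
have r1 : -1 <= x1 by lra.
have r2 : x1 <= 0 by lra.
clear a1 a2 a3 a4 a5 a6 b1 b2 b3 b4 b5 b6.
by rewrite /pm /dragon_fan /=; congr pair; rewrite /=; eval_pos; first [field | lra].
Qed.

Lemma dragon_back_bc : back_cond 2 2 dragon_hex dragon_fan (-1, 1) true true.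
Proof.
have E : nxt 2 2 (-1, 1) true true = (-2, 1) by [].
move=> [x1 x2]; rewrite E /dragon_hex /lat /= => -[/andP[a1 a2] /andP[a3 a4] /andP[a5 a6]] -[/andP[b1 b2] /andP[b3 b4] /andP[b5 b6]].
have e : x1 = - 1 by lra.
rewrite {}e in a1 a2 a3 a4 a5 a6 b1 b2 b3 b4 b5 b6 *.
have r1 : 2/5 <= x2 by lra.
have r2 : x2 <= 3/5 by lra.
clear a1 a2 a3 a4 a5 a6 b1 b2 b3 b4 b5 b6.
by rewrite /pm /dragon_fan /=; congr pair; rewrite /=; eval_pos; first [field | lra].
Qed.

Lemma dragon_back_ca : back_cond 2 2 dragon_hex dragon_fan (-2, 1) false true.
Proof.
have E : nxt 2 2 (-2, 1) false true = (-1, 0) by [].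
move=> [x1 x2]; rewrite E /dragon_hex /lat /= => -[/andP[a1 a2] /andP[a3 a4] /andP[a5 a6]] -[/andP[b1 b2] /andP[b3 b4] /andP[b5 b6]].
have e : x2 = - (2/5) - 4/5 * x1 by lra.
rewrite {}e in a1 a2 a3 a4 a5 a6 b1 b2 b3 b4 b5 b6 *.
have r1 : -1 <= x1 by lra.
have r2 : x1 <= 0 by lra.
clear a1 a2 a3 a4 a5 a6 b1 b2 b3 b4 b5 b6.
by rewrite /pm /dragon_fan /=; congr pair; rewrite /=; eval_pos; first [field | lra].
Qed.

End DragonEdges.

(** * Contraction ratios of the fan maps *)

Section FanLip.
Context {R : realType}.

Lemma bear_hexE : @bear_hex R = [set x | 0 <= 2 * x.1 + 6 * x.2 + 3] `&` [set x | 0 <= - 2 * x.1 + - 6 * x.2 + 3] `&`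
  ([set x | 0 <= 2 * x.1 + - 4 * x.2 + 3] `&` [set x | 0 <= - 2 * x.1 + 4 * x.2 + 3]) `&`
  ([set x | 0 <= 2 * x.1 + 1 * x.2 + 1] `&` [set x | 0 <= - 2 * x.1 + - 1 * x.2 + 1]).
Proof.
apply/seteqP; split => [x [/andP[a1 a2] /andP[a3 a4] /andP[a5 a6]]|x [[[a1 a2] [a3 a4]] [a5 a6]]] /=.
  by do !split; rewrite /=; lra.
by move: a1 a2 a3 a4 a5 a6 => /= a1 a2 a3 a4 a5 a6; split; lra.
Qed.

Lemma bear_hex_convex : convex2 (@bear_hex R).
Proof. by rewrite bear_hexE; do !apply: convex2I; apply: convex2_half. Qed.

Lemma dragon_hexE : @dragon_hex R = [set x | 0 <= 1 * x.1 + 5 * x.2 + 2] `&` [set x | 0 <= - 1 * x.1 + - 5 * x.2 + 2] `&`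
  ([set x | 0 <= 1 * x.1 + 0 * x.2 + 1] `&` [set x | 0 <= - 1 * x.1 + 0 * x.2 + 1]) `&`
  ([set x | 0 <= 4 * x.1 + 5 * x.2 + 2] `&` [set x | 0 <= - 4 * x.1 + - 5 * x.2 + 2]).
Proof.
apply/seteqP; split => [x [/andP[a1 a2] /andP[a3 a4] /andP[a5 a6]]|x [[[a1 a2] [a3 a4]] [a5 a6]]] /=.
  by do !split; rewrite /=; lra.
by move: a1 a2 a3 a4 a5 a6 => /= a1 a2 a3 a4 a5 a6; split; lra.
Qed.

Lemma dragon_hex_convex : convex2 (@dragon_hex R).
Proof. by rewrite dragon_hexE; do !apply: convex2I; apply: convex2_half. Qed.

(** The affine pieces of the fan are not similarities, so the companion norm is replaced by a
    quadratic norm for which every piece contracts by at least 97/100. The kink lines cut the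
    hexagon into the regions to be glued. *)
Lemma bear_fan_lip : lip_on (2/3) (9/4) (97/100) (@bear_hex R) (@bear_fan R).
Proof.
have be0 : 0 < 9/4 :> R by lra.
have r0 : 0 <= 97/100 :> R by lra.
have cH := bear_hex_convex.
have l1 := @lip_glue R (2/3) (9/4) (97/100) be0 _ bear_fan 1 1 (-3/10).
have l2 := @lip_glue R (2/3) (9/4) (97/100) be0 _ bear_fan 4 7 0.
apply: l1 => //; (apply: l2; first by apply: convex2I => //; apply: convex2_half).
- apply: (affine_piece_lip be0 r0 (p := 1/4) (q := -1/4) (a := 1/2) (b := 3/4) (c := -1/2) (e := 0));
    [|lra|lra].
  move=> [x1 x2] [[_ /= a1] /= a2]; rewrite /bear_fan /= !pos_id; [|lra|lra].
  by congr pair; field.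
(* This sign pattern occurs only at the apex -v3 of the fan. *)
- move=> [x1 x2] [y1 y2] [[+ /= a1] /= a2] [[+ /= b1] /= b2].
  rewrite /bear_hex /= => -[/andP[c1 c2] /andP[c3 c4] /andP[c5 c6]] -[/andP[d1 d2] /andP[d3 d4] /andP[d5 d6]].
  have -> : x1 = y1 by lra.
  have -> : x2 = y2 by lra.
  by rewrite !subrr !qnorm0 mulr0.
- apply: (affine_piece_lip be0 r0 (p := 3/8) (q := -1/4) (a := 1/12) (b := 1/3) (c := -1/2) (e := 0));
    [|lra|lra].
  move=> [x1 x2] [[_ /= a1] /= a2]; rewrite /bear_fan /= pos_0 ?pos_id; [|lra|lra].
  by congr pair; field.
- apply: (affine_piece_lip be0 r0 (p := 3/8) (q := -1/4) (a := 3/4) (b := 3/2) (c := -1/2) (e := 0));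
    [|lra|lra].
  move=> [x1 x2] [[_ /= a1] /= a2]; rewrite /bear_fan /= !pos_0; [|lra|lra].
  by congr pair; field.
Qed.

Lemma dragon_fan_lip : lip_on (7/10) (3/4) (97/100) (@dragon_hex R) (@dragon_fan R).
Proof.
have be0 : 0 < 3/4 :> R by lra.
have r0 : 0 <= 97/100 :> R by lra.
have cH := dragon_hex_convex.
have l1 := @lip_glue R (7/10) (3/4) (97/100) be0 _ dragon_fan 1 0 0.
have l2 := @lip_glue R (7/10) (3/4) (97/100) be0 _ dragon_fan 1 1 (-2/5).
have l3 := @lip_glue R (7/10) (3/4) (97/100) be0 _ dragon_fan 0 1 (-2/5).
apply: l1 => //; [apply: l2|apply: l3]; first by apply: convex2I => //; apply: convex2_half.
- apply: (affine_piece_lip be0 r0 (p := 3/5) (q := -8/25) (a := 4/5) (b := 1) (c := -9/25) (e := -1/5));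
    [|lra|lra].
  move=> [x1 x2] [[[_ /andP[/= c3 c4] /andP[/= c5 c6]] /= a1] /= a2].
  rewrite /dragon_fan /= (@pos_id _ x1) ?(@pos_0 _ (x2 - 2/5)) ?(@pos_id _ (x1 + x2 - 2/5)); [|lra|lra|lra].
  by congr pair; field.
- apply: (affine_piece_lip be0 r0 (p := 3/5) (q := -21/50) (a := 4/5) (b := 1) (c := -11/100) (e := 1/20));
    [|lra|lra].
  move=> [x1 x2] [[[_ /andP[/= c3 c4] /andP[/= c5 c6]] /= a1] /= a2].
  rewrite /dragon_fan /= (@pos_id _ x1) ?(@pos_0 _ (x2 - 2/5)) ?(@pos_0 _ (x1 + x2 - 2/5)); [|lra|lra|lra].
  by congr pair; field.
- by apply: convex2I => //; apply: convex2_half.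
- apply: (affine_piece_lip be0 r0 (p := 3/5) (q := -8/25) (a := 6/5) (b := 1) (c := -21/25) (e := -1/5));
    [|lra|lra].
  move=> [x1 x2] [[[/andP[/= c1 c2] /andP[/= c3 c4] /andP[/= c5 c6]] /= a1] /= a2].
  rewrite /dragon_fan /= (@pos_0 _ x1) ?(@pos_id _ (x2 - 2/5)) ?(@pos_0 _ (x1 + x2 - 2/5)); [|lra|lra|lra].
  by congr pair; field.
- apply: (affine_piece_lip be0 r0 (p := 3/5) (q := -21/50) (a := 6/5) (b := 1) (c := -21/25) (e := 1/20));
    [|lra|lra].
  move=> [x1 x2] [[[_ /andP[/= c3 c4] /andP[/= c5 c6]] /= a1] /= a2].
  rewrite /dragon_fan /= (@pos_0 _ x1) ?(@pos_0 _ (x2 - 2/5)) ?(@pos_0 _ (x1 + x2 - 2/5)); [|lra|lra|lra].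
  by congr pair; field.
Qed.

End FanLip.

(** * From the model to the tile *)

Section Address.
Context {R : realType}.

(* [pi] codes the points of [A] by infinite words: [pi u] is the common point of the nested pieces
   [act h n u A]. *)
Record address (al be rho D : R) (h : bool -> R * R -> R * R) (A : set (R * R))
    (pi : (nat -> bool) -> R * R) : Prop := Address {
  address_in : forall u, A (pi u);
  addressS : forall u, pi u = h (u 0%N) (pi (wtail u));
  address_act : forall n u x, A x -> qnorm al be (pi u - act h n u x) <= D * rho ^+ n }.

Lemma addressP (al be rho D : R) h A : 0 < be -> 0 <= rho -> rho < 1 -> A !=set0 ->
  (forall b x, A x -> A (h b x)) ->
  (forall x y, A x -> A y -> qnorm al be (x - y) <= D) ->
  (forall b, lip_on al be rho A (h b)) ->
  (forall x, (forall e, 0 < e -> exists2 y, A y & qnorm al be (x - y) <= e) -> A x) ->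
  exists2 pi, address al be rho D h A pi &
    (forall x, A x -> exists b, exists2 y, A y & x = h b y) ->
    forall x, A x -> exists u, pi u = x.
Proof.
move=> be0 r0 r1 [x0 Ax0] hA hD hl hc.
exists (addr_pt be0 r0 r1 Ax0 hA hD hl); last first.
  by move=> honto x Ax; apply: addr_pt_surj.
split.
- exact: addr_ptQ.
- move=> u; exact: addr_ptS.
- move=> n u x Ax; exact: addr_pt_prefix.
Qed.

Lemma address_modulus (al be rho D : R) h A pi : 0 < be -> address al be rho D h A pi ->
  forall n u v, (forall i, (i < n)%N -> u i = v i) ->
  qnorm al be (pi u - pi v) <= 2 * D * rho ^+ n.
Proof.
move=> be0 [pA pS pact] n u v uv.
apply: le_trans (qnorm_triangle _ be0 (act h n u (pi u)) _ _) _.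
have h1 := pact n u (pi u) (pA u).
have h2 := pact n v (pi u) (pA u).
rewrite -[2]/(1 + 1) mulrDl mul1r mulrDl lerD// qnorm_distC (eq_act _ _ uv)//.
Qed.

End Address.

Section Tile.
Context {R : realType}.
Variables (t n : int) (al be : R).
Local Notation N := (qnorm al be).
Local Notation sh k u := (fun i : nat => u (k + i)%N).

(** The inverse of the companion matrix of X^2 - tX + n. *)
Definition cinv (x : R * R) : R * R := (x.2 + t%:~R * x.1 / n%:~R, - x.1 / n%:~R).

Definition gtile (b : bool) (x : R * R) : R * R := cinv (x + digit b).

Hypotheses (be_gt0 : 0 < be) (n_neq0 : n != 0).
Hypothesis cinv_scale : forall x, N (cinv x) = Num.sqrt 2^-1 * N x.

Lemma cinvB x y : cinv x - cinv y = cinv (x - y).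
Proof. by rewrite /cinv; congr pair; rewrite /=; field; rewrite intr_eq0. Qed.

Lemma gtileB b x y : gtile b x - gtile b y = cinv (x - y).
Proof. by rewrite /gtile cinvB; congr cinv; rewrite opprD addrACA subrr addr0. Qed.

Lemma gtile_step (s : int * int) i j x y :
  gtile i x - gtile j y - lat s = cinv (x - y - lat (nxt t n s i j)).
Proof.
rewrite /gtile /cinv /lat /nxt /digit.
by congr pair; case: i j => [] []; rewrite /= ?rmorphD ?rmorphB ?rmorphM ?rmorphN /=;
  field; rewrite intr_eq0.
Qed.

Let r : R := Num.sqrt 2^-1.

Lemma sqrt_half_ge0 : 0 <= r. Proof. exact: sqrtr_ge0. Qed.

Lemma sqrt_half_lt : r <= 3/4.
Proof.
have -> : 3/4 = Num.sqrt ((3/4) ^+ 2) :> R by rewrite sqrtr_sqr ger0_norm//; lra.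
by apply: ler_wsqrtr; lra.
Qed.

Definition ball2 : set (R * R) := [set x | N x <= 2].

(** The ball of radius 2 is stable because (2 + 1/2) * 3/4 <= 2, and its diameter 4 is the constant
    of the coding. The tile itself is then defined as the range of the coding. *)
Lemma gtile_address : exists pi, address al be r 4 gtile ball2 pi.
Proof.
have r1 : r < 1 by apply: le_lt_trans sqrt_half_lt _; lra.
have d1 b : N (digit b) = 1/2.
  rewrite /qnorm /digit /= mulr0 addr0 expr0n/= mulr0 addr0 sqrtr_sqr.
  by case: b; rewrite ?mulNr ?normrN ger0_norm; lra.
have [||||||||pi pa _] := @addressP R al be r 4 gtile ball2.
- by [].
- exact: sqrt_half_ge0.
- by [].
- by exists 0; rewrite /ball2 /= qnorm0; lra.
- move=> b x /= h; rewrite /gtile /ball2 /= cinv_scale.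
  have := qnormD al be_gt0 x (digit b); rewrite d1 => h2.
  have h3 : N (x + digit b) <= 5/2 by rewrite (le_trans h2)//; rewrite /ball2/= in h; lra.
  apply: le_trans (ler_pM sqrt_half_ge0 (qnorm_ge0 _ _ _) sqrt_half_lt h3) _; lra.
- move=> x y; rewrite /ball2 /= => hx hy.
  have := qnormD al be_gt0 x (- y); rewrite qnormN; lra.
- by move=> b x y _ _; rewrite gtileB cinv_scale.
- move=> x hx; rewrite /ball2 /= leNgt; apply/negP => h.
  have [|y hy hxy] := hx ((N x - 2) / 2); first by lra.
  have := qnormD al be_gt0 (x - y) y; rewrite subrK; rewrite /ball2/= in hy; lra.
by exists pi.
Qed.

End Tile.

(** * Comparing the identifications of words in the tile and in the model *)

Section Relation.
Context {R : realType}.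
Variables (t n : int) (al be : R).
Hypotheses (be_gt0 : 0 < be) (n_neq0 : n != 0).
Local Notation r := (Num.sqrt (2^-1 : R)).
Hypothesis cinv_scale : forall x, qnorm al be (cinv t n x) = r * qnorm al be x.
Implicit Types (s : int * int) (u v : nat -> bool).

(** The vertex reached from [s] in the neighbour graph by reading the two words: the lattice vector
    between the pieces of level [k], rescaled by C^k. *)
Fixpoint state s u v k : int * int :=
  if k is k'.+1 then state (nxt t n s (u 0%N) (v 0%N)) (wtail u) (wtail v) k' else s.

Lemma stateS s u v k : state s u v k.+1 = nxt t n (state s u v k) (u k) (v k).
Proof. by elim: k s u v => // k IH s u v; rewrite [LHS]IH. Qed.

Variable pK : (nat -> bool) -> R * R.
Hypothesis pKP : address al be r 4 (gtile t n) (ball2 al be) pK.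

Lemma tile_stepE s u v : pK u - pK v - lat s =
  cinv t n (pK (wtail u) - pK (wtail v) - lat (nxt t n s (u 0%N) (v 0%N))).
Proof. by rewrite (addressS pKP u) (addressS pKP v) gtile_step. Qed.

Lemma tile_step s u v : pK u = pK v + lat s <->
  pK (wtail u) = pK (wtail v) + lat (nxt t n s (u 0%N) (v 0%N)).
Proof.
have E x y z : (x = y + z) <-> (x - y - z = 0 :> R * R).
  rewrite -addrA -opprD; split => [->|/eqP]; first by rewrite subrr.
  by rewrite subr_eq0 => /eqP.
rewrite !E tile_stepE; split => [h|->].
  apply: (@qnorm_eq0 _ al _ be_gt0); apply/eqP.
  have : qnorm al be (cinv t n (pK (wtail u) - pK (wtail v) - lat (nxt t n s (u 0%N) (v 0%N)))) = 0.
    by rewrite h qnorm0.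
  move/eqP; rewrite cinv_scale mulf_eq0 => /orP[|//].
  by rewrite sqrtr_eq0 leNgt invr_gt0 ltr0n.
by rewrite /cinv /= oppr0 !(mulr0, mul0r, addr0).
Qed.

Lemma tile_stateE s u v : pK u = pK v + lat s -> forall k,
  pK (fun i => u (k + i)%N) = pK (fun i => v (k + i)%N) + lat (state s u v k).
Proof.
move=> h k; elim: k s u v h => [|k IH] s u v h //.
exact: (IH _ _ _ ((tile_step s u v).1 h)).
Qed.

Lemma tile_state_bounded s u v : pK u = pK v + lat s -> forall k,
  qnorm al be (lat (state s u v k)) <= 4.
Proof.
move=> h k; have := tile_stateE h k => /eqP; rewrite addrC -subr_eq => /eqP <-.
have hu := address_in pKP (fun i => u (k + i)%N); have hv := address_in pKP (fun i => v (k + i)%N).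
rewrite /ball2 /= in hu hv.
have := qnormD al be_gt0 (pK (fun i => u (k + i)%N)) (- pK (fun i => v (k + i)%N)).
by rewrite qnormN; lra.
Qed.

Lemma tile_state_norm s u v k : qnorm al be (pK u - pK v - lat s) = r ^+ k *
  qnorm al be (pK (fun i => u (k + i)%N) - pK (fun i => v (k + i)%N) - lat (state s u v k)).
Proof.
elim: k s u v => [|k IH] s u v; first by rewrite mul1r.
by rewrite tile_stepE cinv_scale IH mulrA -exprS.
Qed.

Variables (S : seq (int * int)) (Q : set (R * R)) (p : R * R -> R * R).
Variables (alQ beQ rho D : R) (pQ : (nat -> bool) -> R * R).
Hypotheses (beQ_gt0 : 0 < beQ) (rho_ge0 : 0 <= rho) (rho_lt1 : rho < 1).
Hypothesis mod : model t n S Q p.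
Hypothesis pQP : address alQ beQ rho D (pm p) Q pQ.
Hypothesis nbrs_model : forall s x, Q x -> Q (x - lat s) -> s \in S.
Hypothesis nbrs_tile : forall s u v, pK u = pK v + lat s -> s \in S.

Lemma pm_stable b x : Q x -> Q (pm p b x).
Proof.
by case: b => Qx /=; do ?[apply: (modelQN mod)]; apply: (model_stable mod) => //; apply: (modelQN mod).
Qed.

Lemma act_stable k u x : Q x -> Q (act (pm p) k u x).
Proof. by elim: k u => //= k IH u Qx; apply/pm_stable/IH. Qed.

(** The hexagon forces all states to lie in the finite set [S]. By [tile_state_norm] the
    corresponding distance in the tile is r^k times a bounded quantity for every k, hence 0. *)
Lemma model_to_tile s u v : pQ u = pQ v + lat s -> pK u = pK v + lat s.
Proof.
move=> h.
have st k : pQ (fun i => u (k + i)%N) = pQ (fun i => v (k + i)%N) + lat (state s u v k).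
  elim: k s u v h => [//|k IH] s u v h; apply: IH.
  have Qu := address_in pQP (wtail u); have Qv := address_in pQP (wtail v).
  move: (h); rewrite (addressS pQP u) (addressS pQP v).
  apply: (model_fwd mod) => //; apply: (nbrs_model (address_in pQP u)).
  by rewrite h addrK; apply: (address_in pQP v).
have stS k : state s u v k \in S.
  apply: (nbrs_model (address_in pQP (fun i => u (k + i)%N))).
  by rewrite st addrK; apply: address_in pQP _.
have [B hB] : exists B, forall s, s \in S -> qnorm al be (lat s) <= B.
  exists (\sum_(s <- S) qnorm al be (lat s)) => s' s'S.
  by rewrite (big_rem s')//= lerDl sumr_ge0// => *; apply: qnorm_ge0.
apply/eqP; rewrite -subr_eq0 opprD addrA; apply/eqP/(@qnorm_eq0 _ al _ be_gt0)/eqP.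
rewrite eq_le qnorm_ge0 andbT.
apply: (@le_geometric R r _ _ _ (4 + B)); first exact: sqrtr_ge0.
  by apply: (le_lt_trans (@sqrt_half_lt R)); lra.
move=> k; rewrite (tile_state_norm s u v k) mulrC ler_wpM2r ?exprn_ge0 ?sqrtr_ge0//.
set X := pK _; set Y := pK _.
have hX : qnorm al be X <= 2 := address_in pKP _.
have hY : qnorm al be Y <= 2 := address_in pKP _.
have := hB _ (stS k).
have := qnormD al be_gt0 X (- Y); have := qnormD al be_gt0 (X - Y) (- lat (state s u v k)).
by rewrite !qnormN; lra.
Qed.

(** All states lie in [S], so [model_back] can be applied along the whole walk: at each level k the
    two pieces of the hexagons share a point, and their diameters tend to 0. *)
Lemma tile_to_model s u v : pK u = pK v + lat s -> pQ u = pQ v + lat s.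
Proof.
move=> h.
have stS k : state s u v k \in S by exact: nbrs_tile (tile_stateE h k).
have key k : forall s' u' v', (forall i, (i <= k)%N -> state s' u' v' i \in S) ->
    forall x, Q x -> Q (x - lat (state s' u' v' k)) ->
    act (pm p) k u' x = act (pm p) k v' (x - lat (state s' u' v' k)) + lat s'.
  elim: k => [|k IH] s' u' v' hS x Qx Qx' /=; first by rewrite subrK.
  have hk := IH (nxt t n s' (u' 0%N) (v' 0%N)) (wtail u') (wtail v') (fun i ik => hS i.+1 ik) x Qx Qx'.
  have Qa := act_stable k (wtail u') Qx.
  have Qb := act_stable k (wtail v') Qx'.
  have := model_back mod (hS 0%N (leq0n _)) (hS 1%N isT) Qa.
  by rewrite /= {1 3}hk addrK => ->.
apply/eqP; rewrite -subr_eq0 opprD addrA; apply/eqP/(@qnorm_eq0 _ alQ _ beQ_gt0)/eqP.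
rewrite eq_le qnorm_ge0 andbT.
apply: (@le_geometric R rho _ _ _ (2 * D)) => // k.
(* A common point of [Q] and its translate by the current state; going back along the walk, it
   becomes a common point of the pieces of level k. *)
have [x Qx Qx'] := model_half mod (stS k).
have e := key k s u v (fun i _ => stS i) x Qx Qx'.
have h1 := address_act pQP k u Qx; have h2 := address_act pQP k v Qx'.
have -> : pQ u - pQ v - lat s = (pQ u - act (pm p) k u x) + - (pQ v - act (pm p) k v (x - lat (state s u v k))).
  by rewrite e; ring.
apply: le_trans (qnormD _ beQ_gt0 _ _) _; rewrite qnormN.
by rewrite -[2]/(1 + 1) !mulrDl !mul1r lerD.
Qed.

(* The point of the tile with the address of the centre of the hexagon. *)
Lemma tile_private u s v : pQ u = 0 -> pK u = pK v + lat s -> s = 0.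
Proof.
move=> u0 h; have sS := nbrs_tile h; have := tile_to_model h; rewrite u0.
move/eqP; rewrite eq_sym addr_eq0 => /eqP e; apply/eqP/negPn/negP => s0.
apply: (model_sep mod sS s0); rewrite -[lat s]opprK -e.
exact/(modelQN mod)/(address_in pQP).
Qed.

Lemma tile_kernel u v : pK u = pK v <-> pQ u = pQ v.
Proof.
have := @tile_to_model 0 u v; have := @model_to_tile 0 u v; rewrite lat0 !addr0.
by move=> ? ?; split.
Qed.

End Relation.

(** * Reduction of the finite checks by symmetry *)

Section Representatives.
Context {R : realType}.
Variables (t n : int) (S : seq (int * int)) (Q : set (R * R)) (p : R * R -> R * R).
Hypothesis QN : forall x, Q x -> Q (- x).
Implicit Types (s : int * int) (T : seq (int * int * bool * bool)).

Definition opp_closed := all (fun s => - s \in S) S.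

Lemma opp_closedP : opp_closed -> forall s, s \in S -> - s \in S.
Proof. by move/allP. Qed.

Definition reps_cover (E : seq (int * int)) := all (fun s => [|| s == 0, s \in E | - s \in E]) S.

Lemma edge_of_reps E : opp_closed -> reps_cover E ->
  (forall s, s \in E -> edge_cond t n S Q p s) ->
  forall s, s \in S -> s != 0 -> edge_cond t n S Q p s.
Proof.
move=> /opp_closedP SN /allP hE h s sS s0.
have := hE s sS; rewrite (negPf s0) /= => /orP[/h//|/h hs].
by rewrite -[s]opprK; apply: edge_condN.
Qed.

(** Transitions are taken up to the group of order four generated by x -> -x, which negates [s] and
    flips both letters, and by exchanging the two tiles, which negates [s] and swaps the letters. *)
Definition back_cover (T : seq (int * int * bool * bool)) := all (fun s => all (fun ij : bool * bool =>
  let: (i, j) := ij in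
  [|| nxt t n s i j \notin S, (s == 0) && (i == j), (s, i, j) \in T,
      (- s, ~~ i, ~~ j) \in T, (- s, j, i) \in T | (s, ~~ j, ~~ i) \in T])
  [:: (true, true); (true, false); (false, true); (false, false)]) S.

Lemma back_of_reps T : back_cover T ->
  (forall s i j, (s, i, j) \in T -> back_cond t n Q p s i j) ->
  forall s i j, s \in S -> nxt t n s i j \in S -> back_cond t n Q p s i j.
Proof.
move=> /allP hT h s i j sS nS.
have /allP/(_ (i, j)) := hT s sS.
have ij : (i, j) \in [:: (true, true); (true, false); (false, true); (false, false)].
  by case: i j {nS} => [] [].
move=> /(_ ij); rewrite nS /= => /orP[|/or4P[| | |]].
- move=> /andP[/eqP -> /eqP ->] y Qy Qy'.
  rewrite (_ : lat (nxt _ _ _ _ _) = 0) ?subr0 ?lat0 ?addr0//.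
  by rewrite /nxt subrr /= -lat0; congr lat; congr pair; rewrite /= ?mulr0.
- exact: h.
- by move=> /h/(back_condN QN); rewrite opprK !negbK.
- by move=> /h/back_cond_swap; rewrite opprK.
- by move=> /h/(back_condN QN)/back_cond_swap; rewrite opprK !negbK.
Qed.

Lemma onto_of_chord (c : R * R -> R) : (forall x, c (- x) = - c x) ->
  (forall x, Q x -> 0 <= c x -> exists2 y, Q y & x = p y) ->
  forall x, Q x -> exists b, exists2 y, Q y & x = pm p b y.
Proof.
move=> cN h x Qx; have [c0|c0] := leP 0 (c x).
  by have [y Qy e] := h x Qx c0; exists true, y.
have [|y Qy e] := h (- x) (QN Qx); first by rewrite cN oppr_ge0 ltW.
by exists false, (- y); [exact: QN|rewrite /pm opprK -e opprK].
Qed.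

(** From s = 0 with different letters, the transition expresses that the two pieces of one hexagon
    meet along the chord. *)
Lemma chord_back_cond :
  (forall x, Q x -> Q (x + (1, 0)) -> p x = - p (- (x + (1, 0)))) ->
  back_cond t n Q p (0, 0) true false.
Proof.
move=> h y Qy Qy'; rewrite (_ : lat (0,0) = 0) ?addr0; last exact: lat0.
have e : lat (nxt t n (0, 0) true false) = - (1, 0) :> R * R.
  by rewrite /lat /nxt /= !mulr0 !add0r; congr pair; rewrite /= ?oppr0.
by move: Qy'; rewrite e opprK => Qy'; apply: h.
Qed.

End Representatives.

(** * Finding the neighbours by pruning *)

Section Prune.
Variables (t n : int).
Implicit Types (L : seq (int * int)).

(** Keeps the vectors with a successor in [L]. The letters enter [nxt] only through their
    difference, so one pair of equal letters is tested. *)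
Definition prune L := [seq s <- L | [|| nxt t n s true true \in L,
  nxt t n s true false \in L | nxt t n s false true \in L]].

Lemma orbit_prune L (st : nat -> int * int) (i j : nat -> bool) :
  (forall k, st k.+1 = nxt t n (st k) (i k) (j k)) -> (forall k, st k \in L) ->
  forall m k, st k \in iter m prune L.
Proof.
move=> stS stL; elim=> [//|m IH] k /=; rewrite mem_filter IH andbT.
have := IH k.+1; rewrite stS; case: (i k) (j k) => [] [] ->; rewrite ?orbT//.
Qed.

Definition box5 : seq (int * int) :=
  [seq (a%:Z - 5, b%:Z - 5) | a <- iota 0 11, b <- iota 0 11].

Lemma mem_box5 (s : int * int) : -6 < s.1 < 6 -> -6 < s.2 < 6 -> s \in box5.
Proof.
case: s => a b /= ha hb; apply/allpairsP; exists (absz (a + 5), absz (b + 5)).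
by split; [rewrite mem_iota /=; lia|rewrite mem_iota /=; lia|congr pair; rewrite /=; lia].
Qed.

(** An infinite bounded walk survives any number of prunings of a box that contains it. Twelve
    rounds on this box leave only neighbours in both cases, which is checked by computation. *)
Lemma bounded_orbit (R : realType) (al be : R) (S : seq (int * int)) :
  (forall s, qnorm al be (lat s) <= 4 -> s \in box5) ->
  all (mem S) (iter 12 prune box5) ->
  forall (st : nat -> int * int) (i j : nat -> bool),
  (forall k, st k.+1 = nxt t n (st k) (i k) (j k)) ->
  (forall k, qnorm al be (lat (st k)) <= 4) -> st 0%N \in S.
Proof.
move=> hb /allP hS st i j stS stb; apply: hS.
by apply: (orbit_prune stS) => k; apply: hb.
Qed.

End Prune.

Section BearTile.
Context {R : realType}.

Lemma bear_mem_box (s : int * int) : qnorm (1/2) (7/4 : R) (lat s) <= 4 -> s \in box5.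
Proof.
have be0 : 0 < 7/4 :> R by lra.
move=> h; have : qnorm (1/2) (7/4 : R) (lat s) ^+ 2 <= 4 ^+ 2.
  by rewrite ler_pXn2r ?nnegrE ?qnorm_ge0//; lra.
rewrite (qnorm_sqr (1/2) be0) /lat /= => h2.
(* Completing the square in either variable bounds the other one. *)
have k1 := sqr_ge0 (s.2%:~R + s.1%:~R / 4 : R).
have k2 := sqr_ge0 (s.1%:~R + 1/2 * s.2%:~R : R).
have e1 : -6 < s.1%:~R :> R by nra.
have e2 : s.1%:~R < 6 :> R by nra.
have e3 : -6 < s.2%:~R :> R by nra.
have e4 : s.2%:~R < 6 :> R by nra.
by apply: mem_box5; apply/andP; split; rewrite -(ltr_int R); lra.
Qed.

Lemma bear_orbit (st : nat -> int * int) (i j : nat -> bool) :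
  (forall k, st k.+1 = nxt 1 2 (st k) (i k) (j k)) ->
  (forall k, qnorm (1/2) (7/4 : R) (lat (st k)) <= 4) -> st 0%N \in bear_nbrs.
Proof. by apply: bounded_orbit; [exact: bear_mem_box|vm_compute]. Qed.

Lemma bear_model_nbrs (s : int * int) (x : R * R) :
  bear_hex x -> bear_hex (x - lat s) -> s \in bear_nbrs.
Proof.
case: x s => [x1 x2] [a b]; rewrite /bear_hex /lat /= => -[/andP[a1 a2] /andP[a3 a4] /andP[a5 a6]].
move=> -[/andP[b1 b2] /andP[b3 b4] /andP[b5 b6]].
have h1 : -6 <= (2 * a + 6 * b) by rewrite -(ler_int R) rmorphD !rmorphM /=; lra.
have h2 : (2 * a + 6 * b) <= 6 by rewrite -(ler_int R) rmorphD !rmorphM /=; lra.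
have h3 : -6 <= (2 * a - 4 * b) by rewrite -(ler_int R) rmorphB !rmorphM /=; lra.
have h4 : (2 * a - 4 * b) <= 6 by rewrite -(ler_int R) rmorphB !rmorphM /=; lra.
have h5 : -2 <= (2 * a + b) by rewrite -(ler_int R) rmorphD !rmorphM /=; lra.
have h6 : (2 * a + b) <= 2 by rewrite -(ler_int R) rmorphD !rmorphM /=; lra.
have /allP/(_ (a, b)) : all (fun s : int * int => [&& -6 <= 2 * s.1 + 6 * s.2, 2 * s.1 + 6 * s.2 <= 6, -6 <= 2 * s.1 - 4 * s.2,
    2 * s.1 - 4 * s.2 <= 6, -2 <= 2 * s.1 + s.2 & 2 * s.1 + s.2 <= 2] ==> (s \in bear_nbrs)) box5.
  by vm_compute.
rewrite /= h1 h2 h3 h4 h5 h6 /=; apply.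
by clear -h1 h2 h3 h4 h5 h6; apply: mem_box5; apply/andP; split; rewrite /=; lra.
Qed.

Lemma bear_model : model 1 2 bear_nbrs (@bear_hex R) (@bear_fan R).
Proof.
have QN := @bear_hexN R.
have cN (x : R * R) : 2 * (- x).1 - 9 * (- x).2 = - (2 * x.1 - 9 * x.2) by rewrite /=; ring.
have SN : opp_closed bear_nbrs by vm_compute.
split => //.
- exact: opp_closedP.
- by move=> s sS; exists ((lat s).1 / 2, (lat s).2 / 2); move: sS;
    rewrite !inE => /or4P[/eqP->|/eqP->|/eqP->|/or4P[/eqP->|/eqP->|/eqP->|/eqP->]];
    rewrite /bear_hex /lat /=; split; lra.
- by rewrite /bear_hex /=; split; lra.
- by move=> s; rewrite !inE => /or4P[/eqP->|/eqP->|/eqP->|/or4P[/eqP->|/eqP->|/eqP->|/eqP->]] //= _;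
  rewrite /bear_hex /lat /= => -[]; lra.
- exact: bear_fan_stable.
- exact: (onto_of_chord QN cN (@bear_onto R)).
- exact: (glue_of_chord QN cN (@bear_chord_side R) (@bear_chord_eq R) (@bear_fan_inj R) (@bear_chord R)).
- move=> s x sS s0; suff : edge_cond 1 2 bear_nbrs (@bear_hex R) bear_fan s by apply.
  apply: (@edge_of_reps _ _ _ _ _ _ QN [:: (1, 0); (0, 1); (-1, 1)]) => // s'.
  by rewrite !inE => /or3P[/eqP->|/eqP->|/eqP->]; [exact: bear_edge_a|exact: bear_edge_b|exact: bear_edge_c].
- move=> s x i j sS nS; suff : back_cond 1 2 (@bear_hex R) bear_fan s i j by apply.
  apply: (@back_of_reps _ _ _ bear_nbrs _ _ QN
    [:: ((0, 0), true, false); ((1, 0), true, true); ((1, 0), true, false);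
    ((0, 1), false, true); ((-1, 1), false, true)]) => //.
  move=> s' i' j'; rewrite !inE => /or4P[/eqP[-> -> ->]|/eqP[-> -> ->]|/eqP[-> -> ->]|
    /orP[/eqP[-> -> ->]|/eqP[-> -> ->]]].
  + exact: chord_back_cond (@bear_chord R).
  + exact: bear_back_aa.
  + exact: bear_back_ac.
  + exact: bear_back_bc.
  + exact: bear_back_ca.
Qed.

End BearTile.

Section DragonTile.
Context {R : realType}.

Lemma dragon_mem_box (s : int * int) : qnorm 1 (1 : R) (lat s) <= 4 -> s \in box5.
Proof.
move=> h; have : qnorm 1 (1 : R) (lat s) ^+ 2 <= 4 ^+ 2.
  by rewrite ler_pXn2r ?nnegrE ?qnorm_ge0//; lra.
rewrite (qnorm_sqr 1 ltr01) /lat /= => h2.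
have k1 := sqr_ge0 (s.2%:~R + s.1%:~R / 2 : R).
have k2 := sqr_ge0 (s.1%:~R + s.2%:~R : R).
have e1 : -6 < s.1%:~R :> R by nra.
have e2 : s.1%:~R < 6 :> R by nra.
have e3 : -6 < s.2%:~R :> R by nra.
have e4 : s.2%:~R < 6 :> R by nra.
by apply: mem_box5; apply/andP; split; rewrite -(ltr_int R); lra.
Qed.

Lemma dragon_orbit (st : nat -> int * int) (i j : nat -> bool) :
  (forall k, st k.+1 = nxt 2 2 (st k) (i k) (j k)) ->
  (forall k, qnorm 1 (1 : R) (lat (st k)) <= 4) -> st 0%N \in dragon_nbrs.
Proof. by apply: bounded_orbit; [exact: dragon_mem_box|vm_compute]. Qed.

Lemma dragon_model_nbrs (s : int * int) (x : R * R) :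
  dragon_hex x -> dragon_hex (x - lat s) -> s \in dragon_nbrs.
Proof.
case: x s => [x1 x2] [a b]; rewrite /dragon_hex /lat /= => -[/andP[a1 a2] /andP[a3 a4] /andP[a5 a6]].
move=> -[/andP[b1 b2] /andP[b3 b4] /andP[b5 b6]].
have h1 : -4 <= (a + 5 * b) by rewrite -(ler_int R) rmorphD !rmorphM /=; lra.
have h2 : (a + 5 * b) <= 4 by rewrite -(ler_int R) rmorphD !rmorphM /=; lra.
have h3 : -2 <= a by rewrite -(ler_int R); lra.
have h4 : a <= 2 by rewrite -(ler_int R); lra.
have h5 : -4 <= (4 * a + 5 * b) by rewrite -(ler_int R) rmorphD !rmorphM /=; lra.
have h6 : (4 * a + 5 * b) <= 4 by rewrite -(ler_int R) rmorphD !rmorphM /=; lra.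
have /allP/(_ (a, b)) : all (fun s : int * int => [&& -4 <= s.1 + 5 * s.2, s.1 + 5 * s.2 <= 4, -2 <= s.1, s.1 <= 2,
    -4 <= 4 * s.1 + 5 * s.2 & 4 * s.1 + 5 * s.2 <= 4] ==> (s \in dragon_nbrs)) box5.
  by vm_compute.
rewrite /= h1 h2 h3 h4 h5 h6 /=; apply.
by clear -h1 h2 h3 h4 h5 h6; apply: mem_box5; apply/andP; split; rewrite /=; lra.
Qed.

Lemma dragon_model : model 2 2 dragon_nbrs (@dragon_hex R) (@dragon_fan R).
Proof.
have QN := @dragon_hexN R.
have cN (x : R * R) : 11 * (- x).1 + 5 * (- x).2 = - (11 * x.1 + 5 * x.2) by rewrite /=; ring.
have SN : opp_closed dragon_nbrs by vm_compute.
split => //.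
- exact: opp_closedP.
- by move=> s sS; exists ((lat s).1 / 2, (lat s).2 / 2); move: sS;
    rewrite !inE => /or4P[/eqP->|/eqP->|/eqP->|/or4P[/eqP->|/eqP->|/eqP->|/eqP->]];
    rewrite /dragon_hex /lat /=; split; lra.
- by rewrite /dragon_hex /=; split; lra.
- by move=> s; rewrite !inE => /or4P[/eqP->|/eqP->|/eqP->|/or4P[/eqP->|/eqP->|/eqP->|/eqP->]] //= _;
  rewrite /dragon_hex /lat /= => -[]; lra.
- exact: dragon_fan_stable.
- exact: (onto_of_chord QN cN (@dragon_onto R)).
- exact: (glue_of_chord QN cN (@dragon_chord_side R) (@dragon_chord_eq R) (@dragon_fan_inj R) (@dragon_chord R)).
- move=> s x sS s0; suff : edge_cond 2 2 dragon_nbrs (@dragon_hex R) dragon_fan s by apply.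
  apply: (@edge_of_reps _ _ _ _ _ _ QN [:: (1, 0); (-1, 1); (-2, 1)]) => // s'.
  by rewrite !inE => /or3P[/eqP->|/eqP->|/eqP->]; [exact: dragon_edge_a|exact: dragon_edge_b|exact: dragon_edge_c].
- move=> s x i j sS nS; suff : back_cond 2 2 (@dragon_hex R) dragon_fan s i j by apply.
  apply: (@back_of_reps _ _ _ dragon_nbrs _ _ QN
    [:: ((0, 0), true, false); ((1, 0), true, false); ((-1, 1), false, true);
    ((-1, 1), true, true); ((-2, 1), false, true)]) => //.
  move=> s' i' j'; rewrite !inE => /or4P[/eqP[-> -> ->]|/eqP[-> -> ->]|/eqP[-> -> ->]|
    /orP[/eqP[-> -> ->]|/eqP[-> -> ->]]].
  + exact: chord_back_cond (@dragon_chord R).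
  + exact: dragon_back_ab.
  + exact: dragon_back_bb.
  + exact: dragon_back_bc.
  + exact: dragon_back_ca.
Qed.

End DragonTile.

(** * Homeomorphisms *)

Section KernelHomeo.
Context {R : realType} (d : nat) (C : topologicalType).
Hypothesis Cc : compact [set: C].
Implicit Types p q : C -> 'cV[R]_d.

(** A continuous map from a compact space to a Hausdorff one is closed, so the induced map between
    the images is continuous. *)
Lemma kernel_factor p q : continuous p -> continuous q ->
  (forall u v, p u = p v -> q u = q v) ->
  exists2 f : 'cV[R]_d -> 'cV[R]_d, (forall u, f (p u) = q u) &
    {within range p, continuous f}.
Proof.
move=> cp cq h.
have [f hf] : exists f : 'cV[R]_d -> 'cV[R]_d, forall u, f (p u) = q u.
  have /choice[f hf] : forall x, exists y, forall u, p u = x -> q u = y.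
    move=> x; have [[u ux]|nx] := pselect (exists u, p u = x).
      by exists (q u) => v vx; apply: h; rewrite vx ux.
    by exists 0 => v vx; exfalso; apply: nx; exists v.
  by exists f => u; rewrite (hf (p u) u).
exists f => //.
apply/continuous_closedP => D cD; apply/closed_subspaceP.
(* On the range of [p] this is the preimage of [D] under [f], and it is the image of a compact
   set. *)
exists (p @` (q @^-1` D)).
  apply: compact_closed; first exact: norm_hausdorff.
  apply: continuous_compact; first exact: continuous_subspaceT.
  apply: subclosed_compact (Cc) _ => //.
  by apply: preimage_closed cD => x _; exact: cq.
apply/seteqP; split => x [] /=.
  by move=> [u Du <-] _; rewrite /from_subspace /= hf; split => //; exists u.
by move=> + [u _ ux]; rewrite /from_subspace /= -ux hf => Du; split; exists u.
Qed.

Lemma kernel_homeomorphic p q : continuous p -> continuous q ->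
  (forall u v, p u = p v <-> q u = q v) -> homeomorphic (range p) (range q).
Proof.
move=> cp cq h.
have [f hf cf] := kernel_factor cp cq (fun u v => (h u v).1).
have [g hg cg] := kernel_factor cq cp (fun u v => (h u v).2).
exists f, g; split => //.
- by split=> _ [_ [u _ <-] <-]; [rewrite hf|rewrite hg]; exists u.
- by split=> x /set_mem[u _ <-]; [rewrite hf hg|rewrite hg hf].
Qed.

End KernelHomeo.

Section HomeoBasics.
Context {R : realType} (d : nat).
Implicit Types A B C : set 'cV[R]_d.

Lemma homeomorphic_sym A B : homeomorphic A B -> homeomorphic B A.
Proof. by move=> [f [g [[? ?] [? ?] ? ?]]]; exists g, f; split. Qed.

Lemma within_continuous_trans A B (f g : 'cV[R]_d -> 'cV[R]_d) : (forall x, A x -> B (f x)) ->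
  {within A, continuous f} -> {within B, continuous g} -> {within A, continuous (g \o f)}.
Proof.
move=> fAB /continuous_closedP cf /continuous_closedP cg.
apply/continuous_closedP => D /cg/closed_subspaceP[V cV VB].
have /closed_subspaceP[W cW WA] := cf _ cV.
apply/closed_subspaceP; exists W => //; rewrite WA.
have E x : B x -> V x <-> D (g x).
  move=> Bx; have := congr1 (fun X => X x) VB; rewrite /= => e.
  by split => [Vx|Dx]; [have : (V `&` B) x by []; rewrite VB => -[]|
    have : (g @^-1` D `&` B) x by []; rewrite -VB => -[]].
by apply/seteqP; split => x /= [h Ax]; split => //; apply/E => //; apply: fAB.
Qed.

Lemma homeomorphic_trans A B C : homeomorphic A B -> homeomorphic B C -> homeomorphic A C.
Proof.
move=> [f [g [[fA gB] [fg gf] cf cg]]] [f' [g' [[fB gC] [fg' gf'] cf' cg']]].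
have fAB x : A x -> B (f x) by move=> Ax; apply: fA; exists x.
have gBA x : B x -> A (g x) by move=> Ax; apply: gB; exists x.
have fBC x : B x -> C (f' x) by move=> Ax; apply: fB; exists x.
have gCB x : C x -> B (g' x) by move=> Ax; apply: gC; exists x.
exists (f' \o f), (g \o g'); split.
- by split=> _ [x Ax <-] /=; auto.
- split=> x /set_mem Ax /=; first by rewrite fg' ?fg// ?mem_set//; auto.
  by rewrite gf ?gf'// ?mem_set//; auto.
- exact: within_continuous_trans cf cf'.
- exact: within_continuous_trans cg' cg.
Qed.

End HomeoBasics.

Section Words.
Context {R : realType}.

Lemma cantor_prefix_nbhs (u : cantor_space) n :
  nbhs u [set v : cantor_space | forall i, (i < n)%N -> u i = v i].
Proof.
elim: n => [|n IH]; first by apply: filterS filterT => v _ i.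
have : nbhs u [set v : cantor_space | v n = u n].
  have h : nbhs (u n) [set u n] by exact: discrete_set1.
  exact: (@proj_continuous _ (fun=> bool) n u _ h).
apply: filterS2 IH => v h1 h2 i; rewrite ltnS leq_eqVlt => /predU1P[->|]; first by rewrite h2.
exact: h1.
Qed.

Lemma modulus_continuous d (p : cantor_space -> 'cV[R]_d) :
  (forall e, 0 < e -> exists n, forall u v : nat -> bool,
     (forall i, (i < n)%N -> u i = v i) -> `|p u - p v| <= e) -> continuous p.
Proof.
move=> h u; apply/cvgrPdist_le => e e0.
have [n hn] := h e e0.
by apply: filterS (cantor_prefix_nbhs u n) => v uv; apply: hn.
Qed.

End Words.

Lemma lip_continuous (R : realType) (V W : normedModType R) (f : V -> W) (c : R) :
  (forall x y, `|f x - f y| <= c * `|x - y|) -> continuous f.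
Proof.
move=> h x; apply/cvgrPdist_le => e e0.
have c0 : 0 < `|c| + 1 by rewrite ltr_wpDl.
apply/nbhs_normP; exists (e / (`|c| + 1)); first by rewrite /= divr_gt0.
move=> y /= /ltW; rewrite ler_pdivlMr// => hxy.
apply: le_trans (h _ _) _; apply: le_trans hxy.
by rewrite mulrC ler_wpM2l// (le_trans (ler_norm c))// lerDl.
Qed.

(** * Norms and affine maps on columns *)

Section ColumnNorm.
Context {R : realType} (d : nat).
Implicit Types x y : 'cV[R]_d.

Lemma coord_le_norm x i : `|x i 0| <= `|x|.
Proof.
have : mx_norm x = `|x| by [].
rewrite mx_normrE => <-.
exact: (le_bigmax _ (fun ij : 'I_d * 'I_1 => `|x ij.1 ij.2|) (i, 0)).
Qed.

Lemma norm_le_coord x (c : R) : 0 <= c -> (forall i, `|x i 0| <= c) -> `|x| <= c.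
Proof.
move=> c0 h; have : mx_norm x = `|x| by [].
rewrite mx_normrE => <-; apply: bigmax_le => // -[i j] _ /=.
by rewrite ord1.
Qed.

Lemma norm_le_euclid x : `|x| <= euclid x.
Proof.
apply: norm_le_coord; first exact: sqrtr_ge0.
move=> i; rewrite -sqrtr_sqr /euclid; apply: ler_wsqrtr.
by rewrite (bigD1 i)//= lerDl sumr_ge0// => *; apply: sqr_ge0.
Qed.

Lemma euclid_le_norm x : euclid x <= d%:R * `|x|.
Proof.
have -> : d%:R * `|x| = Num.sqrt ((d%:R * `|x|) ^+ 2) by rewrite sqrtr_sqr ger0_norm// mulr_ge0.
apply: ler_wsqrtr; rewrite exprMn.
apply: (@le_trans _ _ (\sum_(i < d) `|x| ^+ 2)).
  apply: ler_sum => i _; rewrite -(real_normK (num_real (x i 0))).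
  by rewrite ler_pXn2r ?nnegrE ?coord_le_norm.
rewrite sumr_const card_ord -(mulr_natl (`|x| ^+ 2)) ler_wpM2r ?sqr_ge0// -natrX ler_nat.
by case: (d) => // m; rewrite -[leqLHS]muln1 expnS leq_pmul2l// expn1.
Qed.

Lemma mulmx_lip (L : 'M[R]_d) : exists2 c, 0 < c & forall x, `|L *m x| <= c * `|x|.
Proof.
exists (1 + \sum_i \sum_j `|L i j|) => [|x].
  by rewrite ltr_wpDr// sumr_ge0// => i _; apply: sumr_ge0 => j _.
apply: norm_le_coord => [|i].
  by rewrite mulr_ge0// addr_ge0// sumr_ge0// => i _; apply: sumr_ge0 => j _.
rewrite mxE; apply: le_trans (ler_norm_sum _ _ _) _.
rewrite mulrDl mul1r [X in _ <= _ + X * _](bigD1 i)//= mulrDl addrCA ler_wpDr//.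
  by rewrite addr_ge0// mulr_ge0// sumr_ge0// => k _; apply: sumr_ge0.
rewrite mulr_suml; apply: ler_sum => j _; rewrite normrM ler_wpM2l//.
exact: coord_le_norm.
Qed.

Lemma affine_continuous (L : 'M[R]_d) (b : 'cV[R]_d) : continuous (fun x => L *m x + b).
Proof.
have [c _ hc] := mulmx_lip L; apply: (@lip_continuous R _ _ _ c) => x y.
by rewrite opprD addrACA subrr addr0 -mulmxBr.
Qed.

Lemma affine_inv (L : 'M[R]_d) (b : 'cV[R]_d) : L \in unitmx ->
  cancel (fun x => L *m x + b) (fun x => invmx L *m x + (- (invmx L *m b))) /\
  cancel (fun x => invmx L *m x + (- (invmx L *m b))) (fun x => L *m x + b).
Proof.
move=> Lu; split=> x /=.
  by rewrite mulmxDr mulmxA mulVmx// mul1mx addrK.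
by rewrite mulmxDr mulmxN !mulmxA mulmxV// !mul1mx subrK.
Qed.

Lemma affinely_similar_homeomorphic (A B : set 'cV[R]_d) :
  affinely_similar A B -> homeomorphic A B.
Proof.
move=> [L [b [Lu ->]]]; have [fg gf] := affine_inv b Lu.
exists (fun x => L *m x + b), (fun x => invmx L *m x + (- (invmx L *m b))); split.
- by split=> // _ [_ [x Ax <-] <-]; rewrite fg.
- by split=> x _; [exact: fg|exact: gf].
- exact/continuous_subspaceT/affine_continuous.
- exact/continuous_subspaceT/affine_continuous.
Qed.

Lemma affinely_similar_trans (A B C : set 'cV[R]_d) :
  affinely_similar A B -> affinely_similar B C -> affinely_similar A C.
Proof.
move=> [L [b [Lu ->]]] [L' [b' [Lu' ->]]]; exists (L' *m L), (L' *m b + b'); split.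
  by rewrite unitmx_mul Lu' Lu.
apply/seteqP; split.
  by move=> _ [_ [x Ax <-] <-]; exists x => //; rewrite mulmxDr mulmxA addrA.
by move=> _ [x Ax <-]; exists (L *m x + b); [exists x|rewrite mulmxDr mulmxA addrA].
Qed.

Lemma affinely_similar_sym (A B : set 'cV[R]_d) :
  affinely_similar A B -> affinely_similar B A.
Proof.
move=> [L [b [Lu ->]]]; have [fg gf] := affine_inv b Lu.
exists (invmx L), (- (invmx L *m b)); split; first by rewrite unitmx_inv.
apply/seteqP; split => [x Ax|_ [_ [x Ax <-] <-]]; last by rewrite fg.
by exists (L *m x + b); [exists x|rewrite fg].
Qed.

End ColumnNorm.

(** * Powers of planar codings *)

Section Spread.
Context {R : realType} (d : nat).
Hypotheses (d_gt0 : (0 < d)%N) (d_even : ~~ odd d).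

Definition col2 (a : R * R) : 'cV[R]_2 := \col_j (if j == 0 then a.1 else a.2).

(** The blocks are indexed by natural numbers to avoid carrying bounds; only the first [d./2] values
    matter. *)
Definition assemble (x : nat -> R * R) : 'cV[R]_d :=
  \col_l (if odd l then (x l./2).2 else (x l./2).1).

Lemma block_assemble x i : block (assemble x) i = col2 (x i).
Proof.
apply/matrixP => -[[|[|//]] hj] k; rewrite !mxE /=.
  by rewrite addn0 odd_double doubleK.
by rewrite addn1 /= odd_double /= uphalf_double.
Qed.

Lemma half_lt (l : 'I_d) : (l./2 < d./2)%N.
Proof. by have := ltn_ord l; have := odd_double_half d; rewrite (negPf d_even); lia. Qed.

Lemma assemble_eq x y : (forall i, (i < d./2)%N -> x i = y i) -> assemble x = assemble y.
Proof. by move=> h; apply/colP => l; rewrite !mxE h ?half_lt. Qed.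

Lemma col2_inj : injective col2.
Proof.
move=> [a b] [a' b'] /colP h; have := h 0; have := h 1; rewrite !mxE /= => -> ->//.
Qed.

Lemma assemble_inj x y : assemble x = assemble y -> forall i, (i < d./2)%N -> x i = y i.
Proof.
move=> h i id; apply: col2_inj; have := congr1 (fun v => block v (Ordinal id)) h.
by rewrite !block_assemble.
Qed.

Lemma assemble_block (v : 'cV[R]_d) (x : nat -> R * R) :
  (forall i : 'I_d./2, block v i = col2 (x i)) -> v = assemble x.
Proof.
move=> h; apply/colP => l; rewrite mxE.
have /colP hl := h (Ordinal (half_lt l)).
have e := odd_double_half l.
case: ifPn => ol; rewrite ?(negPf ol) ?ol in e.
  have := hl 1; rewrite !mxE /= => <-; congr (v _ _); apply: val_inj => /=; lia.
have := hl 0; rewrite !mxE /= => <-; congr (v _ _); apply: val_inj => /=; lia.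
Qed.

(** Letters are dealt to the blocks in turn, so that one word codes a point of the power and a shift
    of the long word rotates the blocks. *)
Definition subword (u : nat -> bool) i : nat -> bool := fun j => u (j * d./2 + i)%N.

Definition spread (pi : (nat -> bool) -> R * R) (u : cantor_space) : 'cV[R]_d :=
  assemble (fun i => pi (subword u i)).

Let k_gt0 : (0 < d./2)%N.
Proof. by have := odd_double_half d; rewrite (negPf d_even); lia. Qed.

Lemma subword_surj (w : nat -> nat -> bool) :
  exists u, forall i, (i < d./2)%N -> subword u i = w i.
Proof.
exists (fun m => w (m %% d./2)%N (m %/ d./2)%N) => i ik; apply/funext => j.
by rewrite /subword modnMDl modn_small// divnMDl// divn_small// addn0.
Qed.

Lemma spread_range pi :
  range (spread pi) = planar_product (fun _ : 'I_d./2 => col2 @` range pi).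
Proof.
apply/seteqP; split => [_ [u _ <-] i|v hv].
  by rewrite block_assemble; exists (pi (subword u i)) => //; exists (subword u i).
have /choice[w hw] : forall i, exists w : nat -> bool,
    forall ik : (i < d./2)%N, block v (Ordinal ik) = col2 (pi w).
  move=> i; have [ik|ik] := pselect (i < d./2)%N; last by exists (fun=> true).
  have [_ [w _ <-] e] := hv (Ordinal ik).
  by exists w => ik'; rewrite (bool_irrelevance ik' ik) -e.
have [u hu] := subword_surj w.
exists u => //; apply/esym/assemble_block => i.
by rewrite hu// -(hw i (ltn_ord i)); congr block; apply: val_inj.
Qed.

Definition planar_modulus (pi : (nat -> bool) -> R * R) := forall e : R, 0 < e ->
  exists n, forall u v : nat -> bool, (forall i, (i < n)%N -> u i = v i) ->
    `|(pi u).1 - (pi v).1| <= e /\ `|(pi u).2 - (pi v).2| <= e.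

Lemma spread_continuous pi : planar_modulus pi -> continuous (spread pi).
Proof.
move=> h; apply: modulus_continuous => e e0.
have [n hn] := h e e0; exists (n * d./2)%N => u v uv.
apply: norm_le_coord => [|l]; first exact: ltW.
have hl : forall j, (j < n)%N -> subword u l./2 j = subword v l./2 j.
  move=> j jn; apply: uv; have := half_lt l; rewrite -(ltn_pmul2r k_gt0) in jn.
  have : (j.+1 * d./2 <= n * d./2)%N by rewrite leq_pmul2r// -(ltn_pmul2r k_gt0).
  by rewrite mulSn; lia.
have [h1 h2] := hn _ _ hl.
by rewrite !mxE; case: ifP => _.
Qed.

Lemma spread_kernel pi pi' : (forall u v, pi u = pi v <-> pi' u = pi' v) ->
  forall u v, spread pi u = spread pi v <-> spread pi' u = spread pi' v.
Proof.
move=> h u v; split => /assemble_inj e; apply: assemble_eq => i id;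
by apply/h/e.
Qed.

Lemma product_homeomorphic pi pi' : planar_modulus pi -> planar_modulus pi' ->
  (forall u v, pi u = pi v <-> pi' u = pi' v) ->
  homeomorphic (planar_product (fun _ : 'I_d./2 => col2 @` range pi))
               (planar_product (fun _ : 'I_d./2 => col2 @` range pi')).
Proof.
move=> m m' h; rewrite -!spread_range.
apply: kernel_homeomorphic; [exact: cantor_space_compact|exact: spread_continuous..|].
exact: spread_kernel.
Qed.

End Spread.

Lemma bear_scale {R : realType} (x : R * R) :
  qnorm (1/2) (7/4) (cinv 1 2 x) = Num.sqrt 2^-1 * qnorm (1/2) (7/4) x.
Proof. by rewrite /qnorm -sqrtrM ?invr_ge0//; congr Num.sqrt; rewrite /cinv /=; field. Qed.

Lemma dragon_scale {R : realType} (x : R * R) :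
  qnorm 1 1 (cinv 2 2 x) = Num.sqrt 2^-1 * qnorm 1 1 x.
Proof. by rewrite /qnorm -sqrtrM ?invr_ge0//; congr Num.sqrt; rewrite /cinv /=; field. Qed.

Section ClosedPlanarSets.
Context {R : realType}.
Variables (al be : R).
Hypothesis be_gt0 : 0 < be.
Implicit Types (A B : set (R * R)).

Definition closed2 A := forall x, (forall e : R, 0 < e -> exists2 y, A y & qnorm al be (x - y) <= e) -> A x.

Lemma closed2I A B : closed2 A -> closed2 B -> closed2 (A `&` B).
Proof.
move=> hA hB x h; split; [apply: hA|apply: hB] => e e0;
by have [y [Ay By] xy] := h e e0; exists y.
Qed.

Lemma closed2_half (a b c : R) : closed2 [set x | 0 <= a * x.1 + b * x.2 + c].
Proof.
move=> x h /=; rewrite leNgt; apply/negP => neg.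
set l := _ + c in neg *.
have k0 := qnorm_cst_gt0 al be_gt0; set k := qnorm_cst al be in k0 *.
pose m := (`|a| + `|b| + 1) * k.
have m0 : 0 < m by rewrite mulr_gt0// ltr_wpDl// addr_ge0.
have [|y /= hy hxy] := h (- l / 2 / m); first by rewrite !divr_gt0 ?oppr_gt0.
have [h1 h2] := qnorm_coord al be_gt0 (x - y); rewrite -/k in h1 h2.
have e1 : k * qnorm al be (x - y) <= - l / 2 / (`|a| + `|b| + 1).
  have -> : - l / 2 / (`|a| + `|b| + 1) = k * (- l / 2 / m).
    by rewrite /m; field; rewrite !gt_eqF// ltr_wpDl// addr_ge0.
  by rewrite ler_pM2l.
have e2 : a * (x - y).1 + b * (x - y).2 >= - ((`|a| + `|b|) * (- l / 2 / (`|a| + `|b| + 1))).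
  rewrite lerNl; apply: le_trans (ler_norm _) _; rewrite normrN.
  apply: le_trans (ler_normD _ _) _; rewrite !normrM mulrDl.
  by apply: lerD; rewrite ler_wpM2l// (le_trans _ e1).
have e3 : (`|a| + `|b|) * (- l / 2 / (`|a| + `|b| + 1)) <= - l / 2.
  rewrite mulrC mulrAC ler_pdivrMr; last by rewrite ltr_wpDl// addr_ge0.
  rewrite ler_pM2l; first by rewrite lerDl.
  by rewrite divr_gt0// oppr_gt0.
have e4 : a * (x - y).1 + b * (x - y).2 = l - (a * y.1 + b * y.2 + c) by rewrite /l /=; ring.
lra.
Qed.

Lemma unit_box_diam A : (forall x, A x -> `|x.1| <= 1 /\ `|x.2| <= 1) ->
  forall x y, A x -> A y -> qnorm al be (x - y) <= (1 + `|al| + Num.sqrt be) * 2.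
Proof.
move=> h x y /h[x1 x2] /h[y1 y2]; apply: le_trans (qnorm_le _ be_gt0 _) _.
rewrite ler_wpM2l ?addr_ge0 ?sqrtr_ge0// ge_max; apply/andP; split => /=.
  by apply: le_trans (ler_normB _ _) _; lra.
by apply: le_trans (ler_normB _ _) _; lra.
Qed.

End ClosedPlanarSets.

Section AddressModulus.
Context {R : realType}.

Lemma address_planar_modulus (al be rho D : R) h A pi : 0 < be -> 0 <= rho -> rho < 1 ->
  address al be rho D h A pi -> planar_modulus pi.
Proof.
move=> be0 r0 r1 pa e e0.
have c0 := qnorm_cst_gt0 al be0.
have [n hn] := geometric_small r0 r1 (2 * D * qnorm_cst al be) e0.
exists n => u v uv; have := address_modulus be0 pa uv => h1.
have h2 : qnorm_cst al be * qnorm al be (pi u - pi v) <= e.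
  apply: (@le_trans _ _ (qnorm_cst al be * (2 * D * rho ^+ n))).
    by rewrite ler_pM2l//; apply: h1.
  by apply: le_trans (ltW hn); rewrite le_eqVlt; apply/orP; left; apply/eqP; ring.
have [e1 e2] := qnorm_coord al be0 (pi u - pi v).
by split; [exact: le_trans e1 h2|exact: le_trans e2 h2].
Qed.

End AddressModulus.

(** * Codings of the bear and of the dragon *)

Section Packages.
Context {R : realType}.
Local Notation r := (Num.sqrt (2^-1 : R)).

(** What the rest of the proof uses of a tile. [coding_kernel] gives the homeomorphism with [Q];
    [coding_meet] and [coding_private] give the growth of the boundary: each vector of [S] is
    realised by a common point, and some point of the tile lies in no other translate. *)
Record tile_coding (t n : int) (al be : R) (S : seq (int * int)) (Q : set (R * R))
    (pK pQ : (nat -> bool) -> R * R) : Prop := TileCoding {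
  coding_address : address al be r 4 (gtile t n) (ball2 al be) pK;
  coding_modulus : planar_modulus pQ;
  coding_range : range pQ = Q;
  coding_kernel : forall u v, pK u = pK v <-> pQ u = pQ v;
  coding_nbrs : forall s u v, pK u = pK v + lat s -> s \in S;
  coding_meet : forall s, s \in S -> exists u v, pK u = pK v + lat s;
  coding_private : exists u, forall s v, pK u = pK v + lat s -> s = 0 }.

Lemma coding_exists (t n : int) (al be alQ beQ : R) (S : seq (int * int)) (Q : set (R * R)) p :
  0 < be -> n != 0 -> (forall x, qnorm al be (cinv t n x) = r * qnorm al be x) ->
  (forall (st : nat -> int * int) (i j : nat -> bool),
     (forall k, st k.+1 = nxt t n (st k) (i k) (j k)) ->
     (forall k, qnorm al be (lat (st k)) <= 4) -> st 0%N \in S) ->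
  0 < beQ -> model t n S Q p -> (forall s x, Q x -> Q (x - lat s) -> s \in S) ->
  lip_on alQ beQ (97/100) Q p -> closed2 alQ beQ Q ->
  (forall x, Q x -> `|x.1| <= 1 /\ `|x.2| <= 1) ->
  exists pK pQ, tile_coding t n al be S Q pK pQ.
Proof.
move=> be0 n0 sc orb beQ0 m nb lipQ clQ boxQ.
have [pK pKP] := gtile_address be0 n0 sc.
have QN := modelQN m.
have pmQ b x : Q x -> Q (pm p b x).
  by case: b => Qx; [exact: (model_stable m)|exact: (QN _ (model_stable m (QN _ Qx)))].
have r0 : 0 <= 97/100 :> R by lra.
have r1 : 97/100 < 1 :> R by lra.
have [|pQ pQP ponto] := @addressP R alQ beQ (97/100) _ (pm p) Q beQ0 r0 r1 _ pmQ
  (unit_box_diam alQ beQ0 boxQ) (pm_lip QN lipQ) clQ.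
  by exists 0; exact: model_centre m.
have nbK s u v : pK u = pK v + lat s -> s \in S.
  move=> h; apply: (orb (state t n s u v) u v); first exact: stateS.
  exact: (tile_state_bounded be0 n0 sc pKP h).
exists pK, pQ; split => //.
- exact: address_planar_modulus pQP.
- apply/seteqP; split => [_ [u _ <-]|x Qx]; first exact: address_in pQP u.
  by have [u <-] := ponto (model_onto m) x Qx; exists u.
- exact: (tile_kernel be0 n0 sc pKP beQ0 r0 r1 m pQP nb nbK).
- move=> s sS; have [x Qx Qx'] := model_half m sS.
  have [u ux] := ponto (model_onto m) _ Qx; have [v vx] := ponto (model_onto m) _ Qx'.
  exists u, v; apply: (model_to_tile be0 n0 sc pKP m pQP nb).
  by rewrite ux vx subrK.
- have [u u0] := ponto (model_onto m) 0 (model_centre m).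
  exists u => s v; move=> h; exact: (tile_private be0 n0 sc pKP beQ0 r0 r1 m pQP nbK u0 h).
Qed.

Lemma norm_le1 (a : R) : -1 <= a <= 1 -> `|a| <= 1.
Proof. by rewrite ler_norml. Qed.

Lemma bear_coding : exists pK pQ, tile_coding 1 2 (1/2) (7/4) bear_nbrs (@bear_hex R) pK pQ.
Proof.
have be0 : 0 < 7/4 :> R by lra.
have be1 : 0 < 9/4 :> R by lra.
apply: (@coding_exists 1 2 (1/2) (7/4) (2/3) (9/4) _ _ (@bear_fan R)) => //.
- exact: bear_scale.
- exact: bear_orbit.
- exact: bear_model.
- exact: bear_model_nbrs.
- exact: bear_fan_lip.
- by rewrite bear_hexE; do !apply: closed2I; apply: closed2_half; lra.
- by move=> x [/andP[a1 a2] /andP[a3 a4] /andP[a5 a6]]; split; apply: norm_le1; lra.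
Qed.

Lemma dragon_coding : exists pK pQ, tile_coding 2 2 1 1 dragon_nbrs (@dragon_hex R) pK pQ.
Proof.
have be1 : 0 < 3/4 :> R by lra.
apply: (@coding_exists 2 2 1 1 (7/10) (3/4) _ _ (@dragon_fan R)) => //.
- exact: dragon_scale.
- exact: dragon_orbit.
- exact: dragon_model.
- exact: dragon_model_nbrs.
- exact: dragon_fan_lip.
- by rewrite dragon_hexE; do !apply: closed2I; apply: closed2_half; lra.
- by move=> x [/andP[a1 a2] /andP[a3 a4] /andP[a5 a6]]; split; apply: norm_le1; lra.
Qed.

End Packages.

Lemma square_scale (R : realType) (x : R * R) :
  qnorm 0 2 (cinv 0 (-2) x) = Num.sqrt 2^-1 * qnorm 0 2 x.
Proof. by rewrite /qnorm -sqrtrM ?invr_ge0//; congr Num.sqrt; rewrite /cinv /=; field. Qed.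

(** * The square as a tile and as a model of the hexagons *)

Section Square.
Context {R : realType}.
Local Notation r := (Num.sqrt (2^-1 : R)).

Definition square : set (R * R) := [set x | `|x.1| <= 1/2 /\ `|x.2| <= 1/2].

Lemma squareE : square =
  [set x | 0 <= 1 * x.1 + 0 * x.2 + 1/2] `&` [set x | 0 <= - 1 * x.1 + 0 * x.2 + 1/2] `&`
  ([set x | 0 <= 0 * x.1 + 1 * x.2 + 1/2] `&` [set x | 0 <= 0 * x.1 + - 1 * x.2 + 1/2]).
Proof.
apply/seteqP; split => x; rewrite /square /= !ler_norml.
  by move=> [/andP[a1 a2] /andP[a3 a4]]; do !split; rewrite /=; lra.
by move=> [[a1 a2] [a3 a4]]; split; lra.
Qed.

(** For t = 0 and n = -2 the inverse companion matrix is (x1, x2) -> (x2, x1 / 2), so the two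
    contractions map the square onto its upper and lower halves. *)
Lemma square_address : exists2 pi, exists D, address 0 2 r D (gtile 0 (-2)) square pi &
  range pi = square.
Proof.
have be0 : 0 < 2 :> R by [].
have r1 : r < 1 by apply: (le_lt_trans (@sqrt_half_lt R)); lra.
have sc (x : R * R) : qnorm 0 2 (cinv 0 (-2) x) = r * qnorm 0 2 x by exact: square_scale.
have stab b x : square x -> square (gtile 0 (-2) b x).
  rewrite /square /gtile /cinv /digit /= !ler_norml => -[/andP[a1 a2] /andP[a3 a4]].
  by case: b; split; lra.
have box x : square x -> `|x.1| <= 1 /\ `|x.2| <= 1.
  by move=> [a1 a2]; split; lra.
have lip b : lip_on 0 2 r square (gtile 0 (-2) b).
  by move=> x y _ _; rewrite gtileB// sc.
have cl : closed2 0 2 square by rewrite squareE; do !apply: closed2I; apply: closed2_half.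
have [|pi pa ponto] := @addressP R 0 2 r _ (gtile 0 (-2)) square be0 (sqrt_half_ge0 (R := R)) r1 _ stab
  (unit_box_diam 0 be0 box) lip cl.
  by exists 0; rewrite /square /= normr0; split; lra.
exists pi; first by eexists; exact: pa.
apply/seteqP; split => [_ [u _ <-]|x Qx]; first exact: address_in pa u.
have [|u <-] := ponto _ x Qx; last by exists u.
move=> [y1 y2]; rewrite /square /= !ler_norml => -[/andP[a1 a2] /andP[a3 a4]].
have [h|h] := leP 0 y2; [exists true, (2 * y2 - 1/2, y1)|exists false, (2 * y2 + 1/2, y1)];
  rewrite /= ?ler_norml; try (by split; lra);
  by rewrite /gtile /cinv /digit /=; congr pair; rewrite /=; field.
Qed.

(* A hexagon with two sides parallel to the slicing direction is the image of the square under an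
   affine rescaling of the slices. *)
Definition bear_slice (x : R * R) : R * R :=
  (x.1 + x.2 * (3/5 - 2/5 * `|x.1|), - 2 * (x.2 * (3/5 - 2/5 * `|x.1|))).

Definition dragon_slice (x : R * R) : R * R :=
  (2 * x.1, - x.1 + x.2 * (4/5 - 6/5 * `|x.1|)).

Lemma slice_lip (c e : R) x y : 0 <= c <= 1 -> 0 <= e <= 2 * c -> square x -> square y ->
  `|x.2 * (c - e * `|x.1|) - y.2 * (c - e * `|y.1|)| <= `|x.1 - y.1| + `|x.2 - y.2|.
Proof.
move=> /andP[c0 c1] /andP[e0 e1] [x1 x2] [y1 y2].
have -> : x.2 * (c - e * `|x.1|) - y.2 * (c - e * `|y.1|) =
  (x.2 - y.2) * (c - e * `|x.1|) - y.2 * (e * (`|x.1| - `|y.1|)) by ring.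
apply: le_trans (ler_normB _ _) _; rewrite !normrM addrC; apply: lerD.
  have h := ler_dist_dist x.1 y.1.
  rewrite (ger0_norm e0) mulrA -[leRHS]mul1r; apply: ler_pM => //; first by rewrite mulr_ge0.
  by have := ler_pM (normr_ge0 _) e0 y2 e1; lra.
rewrite -[leRHS]mulr1 ler_wpM2l//.
have h : e * `|x.1| <= 2 * c * (1/2) by apply: ler_pM.
have h' : 0 <= e * `|x.1| by rewrite mulr_ge0.
by rewrite ler_norml; lra.
Qed.

Lemma slice_modulus (f : R * R -> R * R) (pi : (nat -> bool) -> R * R) :
  (forall x y, square x -> square y ->
    `|(f x).1 - (f y).1| <= 4 * (`|x.1 - y.1| + `|x.2 - y.2|) /\
    `|(f x).2 - (f y).2| <= 4 * (`|x.1 - y.1| + `|x.2 - y.2|)) ->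
  (forall u, square (pi u)) -> planar_modulus pi -> planar_modulus (f \o pi).
Proof.
move=> hf hp hm e e0; have [|n hn] := hm (e / 8); first by rewrite divr_gt0.
exists n => u v uv /=; have [h1 h2] := hn u v uv.
by have [k1 k2] := hf _ _ (hp u) (hp v); split; lra.
Qed.

Lemma bear_slice_lip x y : square x -> square y ->
    `|(bear_slice x).1 - (bear_slice y).1| <= 4 * (`|x.1 - y.1| + `|x.2 - y.2|) /\
    `|(bear_slice x).2 - (bear_slice y).2| <= 4 * (`|x.1 - y.1| + `|x.2 - y.2|).
Proof.
move=> sx sy; have c01 : 0 <= (3/5 : R) <= 1 by apply/andP; split; lra.
have e01 : 0 <= (2/5 : R) <= 2 * (3/5) by apply/andP; split; lra.
move: (slice_lip c01 e01 sx sy); rewrite /bear_slice /=.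
set a := x.2 * _; set b := y.2 * _ => h.
have n1 := normr_ge0 (x.1 - y.1); have n2 := normr_ge0 (x.2 - y.2).
split.
  have -> : x.1 + a - (y.1 + b) = (x.1 - y.1) + (a - b) by ring.
  by apply: le_trans (ler_normD _ _) _; lra.
have -> : -2 * a - -2 * b = - (2 * (a - b)) by ring.
by rewrite normrN normrM ger0_norm//; lra.
Qed.

Lemma dragon_slice_lip x y : square x -> square y ->
    `|(dragon_slice x).1 - (dragon_slice y).1| <= 4 * (`|x.1 - y.1| + `|x.2 - y.2|) /\
    `|(dragon_slice x).2 - (dragon_slice y).2| <= 4 * (`|x.1 - y.1| + `|x.2 - y.2|).
Proof.
move=> sx sy; have c01 : 0 <= (4/5 : R) <= 1 by apply/andP; split; lra.
have e01 : 0 <= (6/5 : R) <= 2 * (4/5) by apply/andP; split; lra.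
move: (slice_lip c01 e01 sx sy); rewrite /dragon_slice /=.
set a := x.2 * _; set b := y.2 * _ => h.
have n1 := normr_ge0 (x.1 - y.1); have n2 := normr_ge0 (x.2 - y.2).
split.
  by rewrite -mulrBr normrM ger0_norm//; lra.
have -> : - x.1 + a - (- y.1 + b) = (a - b) - (x.1 - y.1) by ring.
by apply: le_trans (ler_normB _ _) _; lra.
Qed.

Lemma bear_slice_inj x y : square x -> square y -> bear_slice x = bear_slice y -> x = y.
Proof.
case: x y => [x1 x2] [y1 y2]; rewrite /square /bear_slice /= => -[a1 a2] [b1 b2] [e1 e2].
have e : x1 = y1 by lra.
move: e2; rewrite e => e2; congr pair.
apply: (@mulIf _ (3/5 - 2/5 * `|y1|)); last by lra.
by rewrite gt_eqF//; lra.
Qed.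

Lemma dragon_slice_inj x y : square x -> square y -> dragon_slice x = dragon_slice y -> x = y.
Proof.
case: x y => [x1 x2] [y1 y2]; rewrite /square /dragon_slice /= => -[a1 a2] [b1 b2] [e1 e2].
have e : x1 = y1 by lra.
move: e2; rewrite e => e2; congr pair.
apply: (@mulIf _ (4/5 - 6/5 * `|y1|)); last by lra.
by rewrite gt_eqF//; lra.
Qed.

Lemma bear_slice_image : bear_slice @` square = bear_hex.
Proof.
apply/seteqP; split => [_ [[x1 x2] [/= a1 a2] <-]|[x1 x2]].
  rewrite /bear_hex /bear_slice /=.
  have d0 : 0 <= 3/5 - 2/5 * `|x1| by lra.
  have [b1 b2] : x2 * (3/5 - 2/5 * `|x1|) <= 1/2 * (3/5 - 2/5 * `|x1|) /\
     -1/2 * (3/5 - 2/5 * `|x1|) <= x2 * (3/5 - 2/5 * `|x1|).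
    by move: a2; rewrite ler_norml => /andP[c1 c2]; split; rewrite ler_wpM2r//; lra.
  move: (x2 * _) b1 b2 => w b1 b2.
  move: b1 b2 a1 d0; case: (ger0P x1) => h b1 b2 a1 d0; split; lra.
rewrite /bear_hex /= => -[/andP[a1 a2] /andP[a3 a4] /andP[a5 a6]].
(* Constant along the direction (1, -2) of one pair of sides. The longest slice, at [xi = 0], joins
   the vertices v2 and -v2. *)
pose xi := x1 + x2 / 2.
have nx : `|xi| <= 1/2 by rewrite ler_norml /xi; lra.
have d0 : 0 < 3/5 - 2/5 * `|xi| by lra.
exists (xi, - x2 / 2 / (3/5 - 2/5 * `|xi|)).
  split => //=; rewrite ler_norml ler_pdivlMr// ler_pdivrMr//.
  by move: d0; rewrite {1}/xi; case: (ger0P xi); rewrite /xi => *; lra.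
by rewrite /bear_slice /= divfK ?gt_eqF// /xi; congr pair; field.
Qed.

Lemma dragon_slice_image : dragon_slice @` square = dragon_hex.
Proof.
apply/seteqP; split => [_ [[x1 x2] [/= a1 a2] <-]|[x1 x2]].
  rewrite /dragon_hex /dragon_slice /=.
  have d0 : 0 <= 4/5 - 6/5 * `|x1| by lra.
  have [b1 b2] : x2 * (4/5 - 6/5 * `|x1|) <= 1/2 * (4/5 - 6/5 * `|x1|) /\
     -1/2 * (4/5 - 6/5 * `|x1|) <= x2 * (4/5 - 6/5 * `|x1|).
    by move: a2; rewrite ler_norml => /andP[c1 c2]; split; rewrite ler_wpM2r//; lra.
  move: (x2 * _) b1 b2 => w b1 b2.
  move: b1 b2 a1 d0; case: (ger0P x1) => h b1 b2 a1 d0; split; lra.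
rewrite /dragon_hex /= => -[/andP[a1 a2] /andP[a3 a4] /andP[a5 a6]].
(* The slices are vertical, like the sides at x1 = 1 and x1 = -1; the longest one joins the vertices
   v1 and -v1. *)
pose xi := x1 / 2.
have nx : `|xi| <= 1/2 by rewrite ler_norml /xi; lra.
have d0 : 0 < 4/5 - 6/5 * `|xi| by lra.
exists (xi, (x2 + xi) / (4/5 - 6/5 * `|xi|)).
  split => //=; rewrite ler_norml ler_pdivlMr// ler_pdivrMr//.
  by move: d0; rewrite {1}/xi; case: (ger0P xi); rewrite /xi => *; lra.
by rewrite /dragon_slice /= divfK ?gt_eqF// /xi; congr pair; field.
Qed.

Variable d : nat.
Hypotheses (d_gt0 : (0 < d)%N) (d_even : ~~ odd d).

(** The hexagon is used with two codings: the image under [f] of a coding of the square, and [pQ],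
    which has the fibres of the coding of the tile. Both comparisons are made on words, so they pass
    to powers. *)
Lemma coding_square_homeomorphic t n al be S Q pK pQ f :
  tile_coding t n al be S Q pK pQ -> f @` square = Q ->
  (forall x y, square x -> square y -> f x = f y -> x = y) ->
  (forall x y, square x -> square y ->
    `|(f x).1 - (f y).1| <= 4 * (`|x.1 - y.1| + `|x.2 - y.2|) /\
    `|(f x).2 - (f y).2| <= 4 * (`|x.1 - y.1| + `|x.2 - y.2|)) ->
  planar_modulus pK ->
  homeomorphic (planar_product (fun _ : 'I_d./2 => col2 @` square))
    (planar_product (fun _ : 'I_d./2 => col2 @` range pK)).
Proof.
move=> cd fQ finj flip mK.
have [pi [D pa] pr] := square_address.
have sq u : square (pi u) := address_in pa u.
have mpi : planar_modulus pi.
  apply: address_planar_modulus pa => //.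
  by apply: (le_lt_trans (@sqrt_half_lt R)); lra.
apply: (@homeomorphic_trans _ _ _ (planar_product (fun _ : 'I_d./2 => col2 @` Q))).
  have -> : Q = range (f \o pi) by rewrite -fQ -pr image_comp.
  rewrite -{1}pr.
  apply: product_homeomorphic => //; first exact: slice_modulus.
  by move=> u v /=; split => [->//|]; apply: finj.
rewrite -(coding_range cd); apply: product_homeomorphic => //; first exact: coding_modulus cd.
by move=> u v; have := coding_kernel cd u v => -[? ?]; split.
Qed.

End Square.

(** * Growth of the boundary *)

Section WordCat.

Definition consw (b : bool) (u : nat -> bool) : nat -> bool := fun i => if i is j.+1 then u j else b.

Definition catw (l : seq bool) (u : nat -> bool) : nat -> bool := foldr consw u l.

Lemma mkseq_cons (u : nat -> bool) k : mkseq u k.+1 = u 0%N :: mkseq (wtail u) k.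
Proof. by rewrite /mkseq /= (iotaDl 1 0 k) -map_comp. Qed.

Lemma catw_mkseq (u v : nat -> bool) k : mkseq (catw (mkseq u k) v) k = mkseq u k.
Proof. by elim: k u => // k IH u; rewrite !mkseq_cons; congr (_ :: _); exact: IH. Qed.

Lemma mkseq_catw (l : seq bool) (u : nat -> bool) : mkseq (catw l u) (size l) = l.
Proof. by elim: l => //= b l IH; rewrite mkseq_cons; congr (_ :: _); exact: IH. Qed.

Lemma eq_mkseq_lt (u v : nat -> bool) k : mkseq u k = mkseq v k ->
  forall i, (i < k)%N -> u i = v i.
Proof. by move=> e i ik; rewrite -(nth_mkseq true u ik) e nth_mkseq. Qed.

End WordCat.

Section StateNonzero.
Variable t : int.
Local Notation n := (2 : int).
Implicit Types (s : int * int) (u v : nat -> bool).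

(** By parity: the first coordinate of [nxt] is -2 s.2 plus a number between -1 and 1. Hence
    distinct translates never acquire a common piece. *)
Lemma nxt_eq0 s i j : nxt t n s i j = 0 -> s = 0.
Proof.
case: s => a b; rewrite /nxt /= => -[e1 e2].
have b0 : b = 0 by case: i j e1 => [] [] /=; lia.
by move: e2; rewrite b0 mulr0 addr0 => ->.
Qed.

Lemma state_neq0 s u v k : s != 0 -> state t n s u v k != 0.
Proof.
elim: k s u v => //= k IH s u v s0; apply: IH.
by apply: contra_neq s0 => /nxt_eq0.
Qed.

End StateNonzero.

(** * The boundary of a tile and its neighbouring translates *)

Section Boundary.
Context {R : realType}.
Variables (t : int) (al be : R) (S : seq (int * int)) (Q : set (R * R)).
Variables (pK pQ : (nat -> bool) -> R * R).
Local Notation n := (2 : int).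
Local Notation N := (qnorm al be).
Local Notation r := (Num.sqrt (2^-1 : R)).
Hypotheses (be_gt0 : 0 < be).
Hypothesis sc : forall x, N (cinv t n x) = r * N x.
Hypothesis cd : tile_coding t n al be S Q pK pQ.
Local Notation K := (range pK).
Implicit Types (s : int * int) (x y : R * R) (u v w : nat -> bool).

Let pKP : address al be r 4 (gtile t n) (ball2 al be) pK := coding_address cd.
Let n0 : (n : int) != 0. Proof. by []. Qed.
Let r_ge0 : 0 <= r. Proof. exact: sqrtr_ge0. Qed.
Let r_lt1 : r < 1. Proof. by apply: (le_lt_trans (@sqrt_half_lt R)); lra. Qed.

Lemma coding_modulusK : planar_modulus pK.
Proof. exact: address_planar_modulus pKP. Qed.

Definition near_set (A : set (R * R)) x := forall e : R, 0 < e -> exists2 y, A y & N (x - y) < e.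

Lemma tile_closed x : near_set K x -> K x.
Proof.
move=> h; apply: contrapT => nKx.
(* For d = 2 there is a single block, and [spread] transfers compactness from the space of words. *)
have clK : closed (range (@spread R 2 pK)).
  apply: compact_closed; first exact: norm_hausdorff.
  have cs : continuous (@spread R 2 pK) by exact: (spread_continuous _ _ coding_modulusK).
  by apply: continuous_compact cantor_space_compact; exact: continuous_subspaceT.
have nx : (~` range (@spread R 2 pK)) (assemble 2 (fun=> x)).
  by move=> [u _] /assemble_inj/(_ 0%N isT) e; apply: nKx; exists (subword 2 u 0).
have : nbhs (assemble 2 (fun=> x)) (~` range (@spread R 2 pK)).
  by apply: open_nbhs_nbhs; split => //; apply: closed_openC.
move=> /nbhs_normP[e /= e0 he].
have c0 := qnorm_cst_gt0 al be_gt0.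
have [|_ [u _ <-] hu] := h (e / 2 / qnorm_cst al be); first by (apply: divr_gt0 => //; apply: divr_gt0).
have hu' : qnorm_cst al be * N (x - pK u) <= e / 2.
  by rewrite mulrC -ler_pdivlMr// ltW.
have [h1 h2] := qnorm_coord al be_gt0 (x - pK u).
have [w hw] : exists w, forall i, (i < 2./2)%N -> subword 2 w i = u.
  exact: (@subword_surj 2 isT isT (fun=> u)).
apply: (he (spread 2 pK w)) => /=; last by exists w.
apply: (@le_lt_trans _ _ (e / 2)); last by rewrite ltr_pdivrMr// mulr_natr mulr2n ltrDl.
apply: norm_le_coord => [|i]; first by rewrite divr_ge0// ltW.
rewrite !mxE hw; last by apply: half_lt.
by case: ifP => _; [exact: le_trans h2 hu'|exact: le_trans h1 hu'].
Qed.

(** Each point is within a fixed distance of a lattice translate of the tile. Applying this to the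
    image of the point under C and contracting back multiplies the distance by r. *)
Lemma tile_dense (y : R * R) (e : R) : 0 < e -> exists s u, N (y - pK u - lat s) < e.
Proof.
move=> e0.
have step k : forall y, exists s u, N (y - pK u - lat s) <= (3 + `|al| + Num.sqrt be) * r ^+ k.
  elim: k => [|k IH] z.
    exists (Num.floor z.1, Num.floor z.2), (fun=> true).
    rewrite mulr1 addrAC; apply: le_trans (qnormD _ be_gt0 _ _) _; rewrite qnormN.
    have h1 : N (pK (fun=> true)) <= 2 := address_in pKP _.
    suff h2 : N (z - lat (Num.floor z.1, Num.floor z.2)) <= 1 + `|al| + Num.sqrt be by lra.
    apply: le_trans (qnorm_le _ be_gt0 _) _.
    rewrite -[leRHS]mulr1 ler_wpM2l ?addr_ge0 ?sqrtr_ge0// ge_max /lat /=.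
    have f1 := floor_itv z.1; have f2 := floor_itv z.2.
    rewrite !ler_norml; move: f1 f2; rewrite !intrD => /andP[? ?] /andP[? ?]; lra.
  (* Adding [digit true] turns the digits -1/2, 1/2 into 0, 1, a complete residue system modulo C;
     the parity of the first coordinate of [s'] then selects the letter. *)
  pose z' : R * R := (- 2 * z.2, z.1 + t%:~R * z.2) + digit true.
  have [s' [u hu]] := IH z'.
  pose dg : int := (s'.1 %% 2)%Z.
  have [b bE] : exists b : bool, dg = b%:Z.
    have : 0 <= dg < 2 by rewrite modz_ge0//= ltz_pmod.
    by case: dg => [[|[|]]|] //; [exists false|exists true].
  pose s : int * int := (s'.2 - t * ((dg - s'.1) %/ 2)%Z, ((dg - s'.1) %/ 2)%Z).
  have e2 : 2 * s.2 = dg - s'.1.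
    rewrite /s /=; have := divz_eq (dg - s'.1) 2.
    have -> : ((dg - s'.1) %% 2)%Z = 0 by rewrite /dg; lia.
    by rewrite addr0 mulrC => <-.
  exists s, (consw b u).
  rewrite (addressS pKP) /= (_ : wtail _ = u)//.
  have -> : z - gtile t n b (pK u) - lat s = cinv t n (z' - pK u - lat s').
    have s1E : (s'.1%:~R : R) = b%:~R - 2 * s.2%:~R.
      by rewrite -[2]/(2%:~R) -rmorphM e2 -rmorphB /= bE; congr intr; ring.
    have s2E : (s'.2%:~R : R) = s.1%:~R + t%:~R * s.2%:~R.
      by rewrite -rmorphM -rmorphD; congr intr; rewrite /s /=; ring.
    rewrite /gtile /cinv /z' /lat /digit /= s1E s2E.
    by case: (b); congr pair; rewrite /=; field.
  by rewrite sc exprS mulrCA ler_wpM2l.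
have [k hk] := geometric_small r_ge0 r_lt1 (3 + `|al| + Num.sqrt be) e0.
by have [s [u h]] := step k y; exists s, u; apply: le_lt_trans hk.
Qed.

Definition tile_bd x := K x /\ near_set (~` K) x.

Definition boxM (M : nat) : seq (int * int) :=
  [seq (a%:Z - M%:Z, b%:Z - M%:Z) | a <- iota 0 M.*2.+1, b <- iota 0 M.*2.+1].

Lemma mem_boxM (M : nat) s : `|s.1%:~R : R| <= M%:R -> `|s.2%:~R : R| <= M%:R -> s \in boxM M.
Proof.
have E (a : int) : `|a%:~R : R| <= M%:R -> (`|a| <= M%:Z)%R.
  by rewrite -intr_norm -[M%:R]/((M%:Z)%:~R) ler_int.
case: s => a b /= /E ha /E hb; apply/allpairsP; exists (absz (a + M%:Z), absz (b + M%:Z)).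
by split; [rewrite mem_iota /=; lia|rewrite mem_iota /=; lia|congr pair; rewrite /=; lia].
Qed.

Lemma bounded_lattice (B : R) : exists M, forall s, N (lat s) <= B -> s \in boxM M.
Proof.
pose M := Num.bound `|qnorm_cst al be * B|.
exists M => s hs; have [h1 h2] := qnorm_coord al be_gt0 (lat s).
have c0 := qnorm_cst_gt0 al be_gt0.
have hM : qnorm_cst al be * N (lat s) <= M%:R.
  apply: (@le_trans _ _ (qnorm_cst al be * B)); first by rewrite ler_pM2l.
  by apply: le_trans (ler_norm _) _; apply: ltW; exact: archi_boundP.
by apply: mem_boxM; [apply: le_trans h1 hM|apply: le_trans h2 hM].
Qed.

(** Points outside the tile and close to [x] are close to translates by nonzero vectors, of which
    only finitely many come near [x]. If none contained [x], they would all stay at a positive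
    distance, since the tile is closed. *)
Lemma tile_bd_nbr x : tile_bd x -> exists s u v, [/\ s \in S, s != 0, x = pK u & pK u = pK v + lat s].
Proof.
move=> [[u _ ux] hx].
have [M hM] := bounded_lattice (N x + 3).
suff [s [s0 [v _ hv]]] : exists s, s != 0 /\ K (x - lat s).
  have e : pK u = pK v + lat s by rewrite hv ux subrK.
  by exists s, u, v; split => //; exact: coding_nbrs cd _ _ _ e.
apply: contrapT => no.
have /choice[f hf] : forall s, exists e : R, 0 < e /\
    (s != 0 -> forall v, e <= N (x - lat s - pK v)).
  move=> s; have [s0|s0] := eqVneq s 0; first by exists 1.
  have : ~ near_set K (x - lat s) by move=> /tile_closed h; apply: no; exists s.
  move=> /existsNP[e /not_implyP[e0 he]]; exists e; split => // _ v.
  rewrite leNgt; apply/negP => h; apply: he; exists (pK v) => //.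
have [e [e0 e1 ef]] : exists e : R, [/\ 0 < e, e <= 1 & forall s, s \in boxM M -> e <= f s].
  elim: (boxM M) => [|a L [e [e0 e1 h]]]; first by exists 1.
  exists (Num.min e (f a)); split; first by rewrite lt_min e0 (hf a).1.
    by rewrite ge_min e1.
  move=> s; rewrite inE => /predU1P[->|/h h']; first by rewrite ge_min lexx orbT.
  by rewrite ge_min h'.
have [|y nKy hxy] := hx (e / 4); first by rewrite divr_gt0.
have : ~ near_set K y by move=> /tile_closed.
move=> /existsNP[e' /not_implyP[e'0 he']].
have [s [v hsv]] := @tile_dense y (Num.min e' (e / 4)) ltac:(by rewrite lt_min e'0 divr_gt0).
move: hsv; rewrite lt_min => /andP[hsv1 hsv2].
have s0 : s != 0.
  apply/eqP => s0; apply: he'; exists (pK v); first by exists v.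
  by move: hsv1; rewrite s0 lat0 subr0.
have hd : N (x - lat s - pK v) < e / 2.
  have -> : x - lat s - pK v = (x - y) + (y - pK v - lat s) by ring.
  by apply: le_lt_trans (qnormD _ be_gt0 _ _) _; lra.
have sM : s \in boxM M.
  apply: hM.
  have -> : lat s = x - (x - lat s - pK v) - pK v by ring.
  have hv : N (pK v) <= 2 := address_in pKP _.
  apply: le_trans (qnormD _ be_gt0 _ _) _; rewrite qnormN.
  have := qnormD al be_gt0 x (- (x - lat s - pK v)); rewrite qnormN; lra.
have := ef s sM; have := (hf s).2 s0 v; lra.
Qed.

Lemma nbr_tile_bd s u v : s != 0 -> pK u = pK v + lat s -> tile_bd (pK u).
Proof.
move=> s0 e; split; first by exists u.
move=> eps eps0; have [w0 hw0] := coding_private cd.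
have [k hk] := geometric_small r_ge0 r_lt1 8 eps0.
(* The tail [w0] codes a point lying in no other translate, so the point of word [v'] in the
   neighbouring tile is outside [K]; it agrees with [v] up to level k. *)
pose v' := catw (mkseq v k) w0.
exists (pK v' + lat s).
  move=> [u' _ hu'].
  have := tile_stateE be_gt0 n0 sc pKP hu' k.
  have -> : (fun i => v' (k + i)%N) = w0.
    rewrite /v'; apply/funext => i; elim: (k) (v) => // m IH z.
    by rewrite mkseq_cons; exact: IH (wtail z).
  move=> /eqP; rewrite -subr_eq -latN => /eqP /esym/hw0/eqP; rewrite oppr_eq0.
  by apply/negP; apply: state_neq0.
apply: le_lt_trans hk; rewrite e opprD addrACA subrr addr0.
have h := address_modulus be_gt0 pKP (n := k) (u := v) (v := v').
have -> : 8 = 2 * 4 :> R by ring.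
by apply: h; apply: eq_mkseq_lt; rewrite /v' catw_mkseq.
Qed.

End Boundary.

(** * Counting walks in the neighbour graph *)

Section Walks.
Variables (t : int) (S : seq (int * int)).
Local Notation n := (2 : int).
Implicit Types (s : int * int) (u v : nat -> bool).

(* Pairs of words whose pieces stay neighbours; the first words code the pieces of the common
   boundary of the tile and its translate by [s]. *)
Definition moves s : seq (bool * bool) :=
  [seq ij <- [:: (true, true); (true, false); (false, true); (false, false)] |
    (nxt t n s ij.1 ij.2 \in S) && (nxt t n s ij.1 ij.2 != 0)].

Fixpoint walks k s : seq (seq bool * seq bool) :=
  if k is k'.+1 then
    [seq (ij.1 :: a.1, ij.2 :: a.2) | ij <- moves s, a <- walks k' (nxt t n s ij.1 ij.2)]
  else [:: ([::], [::])].

Lemma mem_moves s i j : ((i, j) \in moves s) =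
  (nxt t n s i j \in S) && (nxt t n s i j != 0).
Proof. by rewrite mem_filter /=; case: i j => [] []; rewrite ?andbT. Qed.

Lemma mem_walks k s u v : (forall i, (0 < i <= k)%N -> state t n s u v i \in S) ->
  (forall i, (0 < i <= k)%N -> state t n s u v i != 0) ->
  (mkseq u k, mkseq v k) \in walks k s.
Proof.
elim: k s u v => // k IH s u v hS h0; rewrite !mkseq_cons.
apply/allpairsPdep; exists (u 0%N, v 0%N), (mkseq (wtail u) k, mkseq (wtail v) k).
split.
- by rewrite mem_moves; apply/andP; split; [exact: (hS 1%N isT)|exact: (h0 1%N isT)].
- by apply: IH => i /andP[i0 ik]; [apply: (hS i.+1)|apply: (h0 i.+1)].
- by [].
Qed.

Lemma uniq_walks k s : uniq (walks k s).
Proof.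
elim: k s => //= k IH s; apply: allpairs_uniq_dep => //; first exact: filter_uniq.
by move=> [[i j] [a1 a2]] [[i' j'] [b1 b2]] _ _ /= [-> -> -> ->].
Qed.

Lemma size_walksS k s : size (walks k.+1 s) =
  (\sum_(ij <- moves s) size (walks k (nxt t n s ij.1 ij.2)))%N.
Proof. by rewrite /= size_allpairs_dep sumnE big_map. Qed.

Section Growth.
Context {R : realType}.
Variables (w : int * int -> R) (b : R).
Hypothesis b_ge0 : 0 <= b.

(** A weight that the adjacency matrix multiplies by at most [b] is a super-eigenvector; iterating
    it dominates the number of walks. *)
Lemma walks_upper : (forall s, s \in S -> s != 0 -> 1 <= w s) ->
  (forall s, s \in S -> s != 0 -> \sum_(ij <- moves s) w (nxt t n s ij.1 ij.2) <= b * w s) ->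
  forall k s, s \in S -> s != 0 -> (size (walks k s))%:R <= w s * b ^+ k.
Proof.
move=> w1 hw; elim=> [|k IH] s sS s0; first by rewrite mulr1 w1.
rewrite size_walksS natr_sum exprS mulrCA mulrA.
apply: (@le_trans _ _ ((\sum_(ij <- moves s) w (nxt t n s ij.1 ij.2)) * b ^+ k)).
  rewrite mulr_suml big_seq [leRHS]big_seq; apply: ler_sum => -[i j].
  by rewrite mem_moves => /andP[hS h0]; apply: IH.
by rewrite ler_wpM2r ?exprn_ge0// hw.
Qed.

Lemma walks_lower : (forall s, s \in S -> s != 0 -> w s <= 1) ->
  (forall s, s \in S -> s != 0 -> b * w s <= \sum_(ij <- moves s) w (nxt t n s ij.1 ij.2)) ->
  forall k s, s \in S -> s != 0 -> w s * b ^+ k <= (size (walks k s))%:R.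
Proof.
move=> w1 hw; elim=> [|k IH] s sS s0; first by rewrite mulr1 w1.
rewrite size_walksS natr_sum exprS mulrCA mulrA.
apply: (@le_trans _ _ ((\sum_(ij <- moves s) w (nxt t n s ij.1 ij.2)) * b ^+ k)).
  by rewrite ler_wpM2r ?exprn_ge0// hw.
rewrite mulr_suml big_seq [leRHS]big_seq; apply: ler_sum => -[i j].
by rewrite mem_moves => /andP[hS h0]; apply: IH.
Qed.

End Growth.

Lemma nxt_injl s s' i i' j : nxt t n s i j = nxt t n s' i' j -> i = i' /\ s = s'.
Proof.
case: s s' => [a b] [a' b']; rewrite /nxt /= => -[e1 e2].
have [ei eb] : i = i' /\ b = b' by case: i i' j e1 => [] [] [] /=; lia.
by split=> //; rewrite eb in e2 *; congr pair; lia.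
Qed.

Lemma nxt_injr s s' i j j' : nxt t n s i j = nxt t n s' i j' -> j = j' /\ s = s'.
Proof.
case: s s' => [a b] [a' b']; rewrite /nxt /= => -[e1 e2].
have [ei eb] : j = j' /\ b = b' by case: j j' i e1 => [] [] [] /=; lia.
by split=> //; rewrite eb in e2 *; congr pair; lia.
Qed.

(** A parity argument at each step: once the second word is fixed, the final state determines the
    first word. Bounds on states thus become bounds on numbers of words. *)
Lemma state_injl s u u' v k : state t n s u v k = state t n s u' v k -> mkseq u k = mkseq u' k.
Proof.
elim: k => // k IH; rewrite !stateS => /nxt_injl[e /IH h].
by rewrite /mkseq -addn1 iotaD !map_cat /= -!/(mkseq _ _) h e.
Qed.

Lemma state_injr s u v v' k : state t n s u v k = state t n s u v' k -> mkseq v k = mkseq v' k.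
Proof.
elim: k => // k IH; rewrite !stateS => /nxt_injr[e /IH h].
by rewrite /mkseq -addn1 iotaD !map_cat /= -!/(mkseq _ _) h e.
Qed.

Lemma eq_state s u u' v v' k : mkseq u k = mkseq u' k -> mkseq v k = mkseq v' k ->
  state t n s u v k = state t n s u' v' k.
Proof.
elim: k s u u' v v' => // k IH s u u' v v'; rewrite !mkseq_cons => -[e1 h1] [e2 h2].
by rewrite /= e1 e2; apply: IH.
Qed.

End Walks.

(** * Number of pieces meeting a small set *)

Section Multiplicity.
Context {R : realType}.
Variables (t : int) (al be : R) (S : seq (int * int)) (Q : set (R * R)).
Variables (pK pQ : (nat -> bool) -> R * R).
Local Notation n := (2 : int).
Local Notation N := (qnorm al be).
Local Notation r := (Num.sqrt (2^-1 : R)).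
Hypotheses (be_gt0 : 0 < be).
Hypothesis sc : forall x, N (cinv t n x) = r * N x.
Hypothesis cd : tile_coding t n al be S Q pK pQ.
Implicit Types (s : int * int) (x y : R * R) (u v w : nat -> bool).

Let pKP : address al be r 4 (gtile t n) (ball2 al be) pK := coding_address cd.
Let n0 : (n : int) != 0. Proof. by []. Qed.
Let r_gt0 : 0 < r. Proof. by rewrite sqrtr_gt0 invr_gt0. Qed.

(** Fix one word [u0] whose point is in [E]. Every other word is determined by its state relative to
    [u0], a lattice vector of norm at most c + 4 because the distance of the two points is magnified
    by exactly r^-k. *)
Lemma pieces_multiplicity (c : R) : exists M, forall k (E : set (R * R)) (L : seq (seq bool)),
  (forall x y, E x -> E y -> N (x - y) <= c * r ^+ k) -> uniq L ->
  (forall l, l \in L -> exists2 u, mkseq u k = l & E (pK u)) -> (size L <= M)%N.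
Proof.
have [M hM] := bounded_lattice al be_gt0 (c + 4).
exists (size (boxM M)) => k E L hE uL hL.
case: L uL hL => // l0 L' uL hL; set L := l0 :: L' in uL hL *.
have [u0 u0l Eu0] := hL l0 (mem_head _ _).
pose f l := state t n 0 (catw l u0) u0 k.
rewrite -(size_map f); apply: uniq_leq_size.
  rewrite map_inj_in_uniq// => l l' /hL[u <- _] /hL[u' <- _] /state_injl.
  by rewrite !catw_mkseq.
move=> _ /mapP[l /hL[u ul Eu] ->]; apply: hM.
have -> : f l = state t n 0 u u0 k by apply: eq_state; rewrite // -ul catw_mkseq.
have := hE _ _ Eu Eu0.
have := tile_state_norm n0 sc pKP 0 u u0 k; rewrite lat0 subr0 => ->.
rewrite mulrC ler_pM2r ?exprn_gt0// => h.
set X := pK (fun i => u (k + i)%N) in h; set Y := pK (fun i => u0 (k + i)%N) in h.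
set Z := lat _ in h *.
have hX : N X <= 2 := address_in pKP _.
have hY : N Y <= 2 := address_in pKP _.
have -> : Z = (X - Y) - (X - Y - Z) by ring.
apply: le_trans (qnormD _ be_gt0 _ _) _; rewrite qnormN.
have := qnormD al be_gt0 X (- Y); rewrite qnormN; lra.
Qed.

Lemma walk_point k s a : s \in S -> a \in walks t S k s ->
  exists u v, [/\ mkseq u k = a.1, mkseq v k = a.2 & pK u = pK v + lat s].
Proof.
elim: k s a => [|k IH] s a sS /=.
  by rewrite inE => /eqP ->; have [u [v e]] := coding_meet cd sS; exists u, v.
move=> /allpairsPdep[[i j] [b [/=]]]; rewrite mem_moves => /andP[nS _] /(IH _ _ nS)[u [v [h1 h2 h3]]] ->.
exists (consw i u), (consw j v); rewrite !mkseq_cons /=; split; [by congr (_ :: _)|by congr (_ :: _)|].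
by apply/(tile_step be_gt0 n0 sc pKP).
Qed.

(** A walk from [s] is determined by its first word and its final state, which lies in [S]. *)
Lemma walks_multiplicity (c : R) : exists M, forall k s (E : set (R * R)) (L : seq (seq bool * seq bool)),
  (forall x y, E x -> E y -> N (x - y) <= c * r ^+ k) -> uniq L ->
  (forall a, a \in L -> exists u v, [/\ mkseq u k = a.1, mkseq v k = a.2, pK u = pK v + lat s & E (pK u)]) ->
  (size L <= M)%N.
Proof.
have [M hM] := pieces_multiplicity c.
exists (M * size S)%N => k s E L hE uL hL.
pose f (a : seq bool * seq bool) := (a.1, state t n s (catw a.1 (fun=> true)) (catw a.2 (fun=> true)) k).
have fS a : a \in L -> (f a).2 \in S.
  move=> /hL[u [v [h1 h2 h3 _]]]; rewrite /f /=.
  have -> : state t n s (catw a.1 (fun=> true)) (catw a.2 (fun=> true)) k = state t n s u v k.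
    by apply: eq_state; rewrite -?h1 -?h2 catw_mkseq.
  exact: coding_nbrs cd _ _ _ (tile_stateE be_gt0 n0 sc pKP h3 k).
have finj : {in L &, injective f}.
  move=> a b /hL[u [v [a1 a2 _ _]]] /hL[u' [v' [b1 b2 _ _]]] [e].
  case: a b a1 a2 b1 b2 e => [p q] [p' q'] /= <- <- <- <- e; rewrite e.
  by move=> /state_injr; rewrite !catw_mkseq => ->.
rewrite -(size_map f).
apply: (@leq_trans (size [seq (l, s') | l <- undup (map fst L), s' <- S])).
  apply: uniq_leq_size; first by rewrite map_inj_in_uniq.
  move=> _ /mapP[a aL ->]; apply/allpairsP; exists (f a); split; last by rewrite -surjective_pairing.
    by rewrite mem_undup; apply/mapP; exists a.
  exact: fS.
rewrite size_allpairs leq_mul2r; apply/orP; right.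
apply: (hM k E) => //; first exact: undup_uniq.
move=> l; rewrite mem_undup => /mapP[a /hL[u [v [h1 _ _ h]]] ->].
by exists u.
Qed.

End Multiplicity.

(** * Growth of covers under Lipschitz homeomorphisms *)

Section Growth.
Context {R : realType} (d : nat).
Implicit Types (A B : set 'cV[R]_d) (f g : 'cV[R]_d -> 'cV[R]_d).

Definition bdry A := A `\` A°.

Lemma homeomorphism_bdry f A B : homeomorphism f -> f @` A = B -> f @` bdry A = bdry B.
Proof.
move=> [cf [g [fg gf cg]]] fAB.
have intE x : A° x <-> B° (f x).
  rewrite /interior /=; split => h.
    have : nbhs (f x) (g @^-1` A) by apply: cg; rewrite fg.
    by apply: filterS => y /= gA; rewrite -fAB; exists (g y).
  have : nbhs x (f @^-1` B) by apply: cf.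
  by apply: filterS => y /=; rewrite -fAB => -[a Aa] /(can_inj fg) <-.
apply/seteqP; split => [_ [x [Ax nAx] <-]|y [By nBy]].
  by split; [rewrite -fAB; exists x|move/intE].
move: By nBy; rewrite -{1}fAB => -[x Ax <-] nB; exists x => //.
by split => // /intE.
Qed.

Definition covers A (I : finType) (F : I -> set 'cV[R]_d) (e : R) :=
  (forall x, A x -> exists i, F i x) /\ forall i x y, F i x -> F i y -> `|x - y| <= e.

Definition upper_growth A (b : R) := exists c C : R, forall m,
  exists (I : finType) (F : I -> set 'cV[R]_d),
    covers (bdry A) F (c * 2^-1 ^+ m) /\ #|I|%:R <= C * b ^+ m.

(** The constant [c] is arbitrary here, whereas [upper_growth] asks for one: a Lipschitz map
    multiplies the diameters by an unknown factor. *)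
Definition lower_growth A (b : R) := forall c : R, 0 < c -> exists2 delta : R, 0 < delta &
  forall m (I : finType) (F : I -> set 'cV[R]_d),
    covers (bdry A) F (c * 2^-1 ^+ m) -> delta * b ^+ m <= #|I|%:R.

(** A Lipschitz bound in one direction is what carries covers of the boundary of [A] to covers of
    that of [B]. *)
Definition lip_homeomorphic A B := exists f,
  [/\ homeomorphism f, exists L : R, forall x y, `|f x - f y| <= L * `|x - y| & f @` A = B].

Lemma lip_homeomorphic_trans A B C :
  lip_homeomorphic A B -> lip_homeomorphic B C -> lip_homeomorphic A C.
Proof.
move=> [f [[cf [f' [ff' f'f cf']]] [L hL] fAB]] [g [[cg [g' [gg' g'g cg']]] [M hM] gBC]].
exists (g \o f); split.
- split; first by move=> x; apply: continuous_comp; [exact: cf|exact: cg].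
  exists (f' \o g'); split; [exact: can_comp|exact: can_comp|].
  by move=> x; apply: continuous_comp; [exact: cg'|exact: cf'].
- exists (`|M| * L) => x y /=; apply: le_trans (hM _ _) _.
  apply: (@le_trans _ _ (`|M| * `|f x - f y|)); first by rewrite ler_wpM2r// ler_norm.
  by rewrite -mulrA ler_wpM2l.
- by rewrite -image_comp fAB.
Qed.

Lemma affine_homeomorphism (L : 'M[R]_d) (b : 'cV[R]_d) : L \in unitmx ->
  homeomorphism (fun x => L *m x + b).
Proof.
move=> Lu; have [fg gf] := affine_inv b Lu; split; first exact: affine_continuous.
by exists (fun x => invmx L *m x + (- (invmx L *m b))); split => //; apply: affine_continuous.
Qed.

Lemma affinely_similar_lip A B : affinely_similar A B -> lip_homeomorphic A B.
Proof.
move=> [L [b [Lu ->]]]; exists (fun x => L *m x + b); split => //.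
  exact: affine_homeomorphism.
have [c _ hc] := mulmx_lip L; exists c => x y.
by rewrite opprD addrACA subrr addr0 -mulmxBr.
Qed.

Lemma bilipschitz_equivalent_lip A B : bilipschitz_equivalent A B ->
  lip_homeomorphic A B /\ lip_homeomorphic B A.
Proof.
move=> [f [hf [C C0 hC] fAB]].
have upC x y : `|f x - f y| <= C * d%:R * `|x - y|.
  have /andP[_ h] := hC x y.
  apply: le_trans (norm_le_euclid _) _; apply: le_trans h _.
  by rewrite -mulrA ler_pM2l// euclid_le_norm.
have loC x y : `|x - y| <= C * d%:R * `|f x - f y|.
  have /andP[h _] := hC x y.
  apply: le_trans (norm_le_euclid _) _.
  move: h; rewrite mulrC ler_pdivrMr// => h; apply: le_trans h _.
  by rewrite -mulrA [leLHS]mulrC ler_pM2l// euclid_le_norm.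
split; first by exists f; split => //; exists (C * d%:R).
have [cf [g [fg gf cg]]] := hf; exists g; split.
- by split => //; exists f.
- by exists (C * d%:R) => x y; have := loC (g x) (g y); rewrite !gf.
- rewrite -fAB image_comp; apply/seteqP; split => [_ [x Ax <-]|x Ax]; first by rewrite /= fg.
  by exists x => //=; rewrite fg.
Qed.

(** The images of economical covers of the boundary of [A] would give delta * b'^m <= C * b^m for
    all m. *)
Lemma growth_obstruction A B (b b' : R) : 0 < b -> b < b' ->
  upper_growth A b -> lower_growth B b' -> ~ lip_homeomorphic A B.
Proof.
move=> b0 bb' [c [C hC]] hB [f [hf [L hL] fAB]].
have b'0 : 0 < b' by apply: lt_trans bb'.
pose c' := `|L| * `|c| + 1.
have c'0 : 0 < c' by rewrite ltr_wpDl// mulr_ge0.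
have [delta d0 hd] := hB c' c'0.
suff : delta <= 0 by rewrite leNgt d0.
apply: (@le_geometric R (b / b') _ _ _ C).
- by rewrite divr_ge0// ltW.
- by rewrite ltr_pdivrMr// mul1r.
move=> m; rewrite expr_div_n mulrA ler_pdivlMr ?exprn_gt0//.
have [I [F [[cov diam] sI]]] := hC m.
apply: le_trans sI; apply: (hd m I (fun i => f @` F i)); split.
  move=> y; rewrite -(homeomorphism_bdry hf fAB) => -[x Ax <-].
  by have [i Fx] := cov x Ax; exists i; exists x.
move=> i _ _ [x Fx <-] [y Fy <-]; apply: le_trans (hL _ _) _.
apply: (@le_trans _ _ (`|L| * (`|c| * 2^-1 ^+ m))).
  apply: (@le_trans _ _ (`|L| * `|x - y|)); first by rewrite ler_wpM2r// ler_norm.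
  rewrite ler_wpM2l//; apply: le_trans (diam i x y Fx Fy) _.
  by rewrite ler_wpM2r ?exprn_ge0 ?invr_ge0// ler_norm.
by rewrite mulrA ler_wpM2r ?exprn_ge0 ?invr_ge0// /c' lerDl.
Qed.

End Growth.

Section Cardinals.
Variables (I J : finType).

Lemma card_family_prod (F : I -> pred J) :
  #|[pred W : {ffun I -> J} | [forall i, W i \in F i]]| = (\prod_i #|F i|)%N.
Proof.
have -> : #|[pred W : {ffun I -> J} | [forall i, W i \in F i]]| = #|family F|.
  by apply: eq_card => W; rewrite !inE.
by rewrite card_family foldrE big_map big_enum; apply: eq_bigl.
Qed.

Lemma card_ffun_le (F : I -> pred J) (i : I) (a b : nat) :
  (#|F i| <= a)%N -> (forall j, j != i -> #|F j| <= b)%N ->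
  (#|[pred W : {ffun I -> J} | [forall i, W i \in F i]]| <= a * b ^ #|I|.-1)%N.
Proof.
move=> ha hb; rewrite card_family_prod (bigD1 i)//= leq_mul//.
apply: (@leq_trans (\prod_(j | j != i) b)%N); first exact: leq_prod.
by rewrite prod_nat_const (cardC1 i).
Qed.

Lemma card_le_fibres (f : I -> J) (M : nat) :
  (forall j, #|[pred i | f i == j]| <= M)%N -> (#|I| <= #|J| * M)%N.
Proof.
move=> h; rewrite -sum1_card (partition_big f predT)//=.
rewrite -sum_nat_const; apply: leq_sum => j _.
by rewrite sum1_card; apply: leq_trans (h j); rewrite subset_leq_card//; apply/subsetP => i; rewrite !inE.
Qed.

End Cardinals.

Lemma finite_lower_bound (R : realType) (I : finType) (f : I -> R) : (forall i, 0 < f i) ->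
  exists2 e, 0 < e & forall i, e <= f i.
Proof.
move=> f0.
have [e e0 he] : exists2 e, 0 < e & forall i, i \in enum I -> e <= f i.
  elim: (enum I) => [|a L [e e0 h]]; first by exists 1.
  exists (Num.min e (f a)); first by rewrite lt_min e0 f0.
  move=> i; rewrite inE => /predU1P[->|/h h']; first by rewrite ge_min lexx orbT.
  by rewrite ge_min h'.
by exists e => // i; apply: he; rewrite mem_enum.
Qed.

Lemma interior_normP (R : realType) (V : normedModType R) (A : set V) (x : V) :
  A° x <-> exists2 e : R, 0 < e & forall y, `|x - y| < e -> A y.
Proof.
split=> [/nbhs_normP[e /= e0 h]|[e e0 h]]; first by exists e.
by apply/nbhs_normP; exists e.
Qed.

Section Blocks.
Context {R : realType} (d : nat).
Implicit Types v w : 'cV[R]_d.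

Definition bpt v (i : 'I_d./2) : R * R := (block v i 0 0, block v i 1 0).

Lemma col2_bpt v i : col2 (bpt v i) = block v i.
Proof. by apply/colP => -[[|[|//]] hj]; rewrite mxE /=; congr (block v i _ _); apply: val_inj. Qed.

Lemma bpt_col2 v i x : block v i = col2 x -> bpt v i = x.
Proof. by move=> h; apply: col2_inj; rewrite col2_bpt. Qed.

Lemma bptB v w i : bpt v i - bpt w i = bpt (v - w) i.
Proof. by rewrite /bpt; congr pair; rewrite /= !mxE. Qed.

Lemma bpt_norm (al be : R) v i : 0 < be -> qnorm al be (bpt v i) <= (1 + `|al| + Num.sqrt be) * `|v|.
Proof.
move=> be0; apply: le_trans (qnorm_le _ be0 _) _.
by rewrite ler_wpM2l ?addr_ge0 ?sqrtr_ge0// ge_max /= !mxE !coord_le_norm.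
Qed.

Lemma product_bptE (K : set (R * R)) v :
  planar_product (fun _ : 'I_d./2 => col2 @` K) v <-> forall i, K (bpt v i).
Proof.
split=> h i; last by exists (bpt v i); [exact: h|exact: col2_bpt].
by have [x Kx /esym/bpt_col2 ->] := h i.
Qed.

Hypotheses (d_gt0 : (0 < d)%N) (d_even : ~~ odd d).

Lemma norm_le_bpt v (c : R) : 0 <= c ->
  (forall i, `|(bpt v i).1| <= c /\ `|(bpt v i).2| <= c) -> `|v| <= c.
Proof.
move=> c0 h.
have -> : v = assemble d (fun i => if insub i is Some i' then bpt v i' else 0).
  by apply: assemble_block => // i; rewrite valK -col2_bpt.
apply: norm_le_coord => // l; rewrite mxE.
by case: insubP => [i _ _|_]; [have [] := h i; case: ifP|case: ifP => _ /=; rewrite normr0].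
Qed.

Lemma bpt_assemble (x : nat -> R * R) i : bpt (assemble d x) i = x i.
Proof. by apply: bpt_col2; rewrite block_assemble. Qed.

End Blocks.

(** * Growth of the boundary of a power of a tile *)

Section ProductGrowth.
Context {R : realType} (d : nat).
Hypotheses (d_gt0 : (0 < d)%N) (d_even : ~~ odd d).
Variables (t : int) (al be : R) (S : seq (int * int)) (Q : set (R * R)).
Variables (pK pQ : (nat -> bool) -> R * R).
Local Notation n := (2 : int).
Local Notation N := (qnorm al be).
Local Notation r := (Num.sqrt (2^-1 : R)).
Hypotheses (be_gt0 : 0 < be).
Hypothesis sc : forall x, N (cinv t n x) = r * N x.
Hypothesis cd : tile_coding t n al be S Q pK pQ.
Local Notation K := (range pK).
Local Notation T := (planar_product (fun _ : 'I_d./2 => col2 @` K)).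
Local Notation tile_bd := (@tile_bd R al be pK).

Let pKP : address al be r 4 (gtile t n) (ball2 al be) pK := coding_address cd.
Let n0 : (n : int) != 0. Proof. by []. Qed.
Let q := 1 + `|al| + Num.sqrt be.
Let q_gt0 : 0 < q. Proof. by rewrite /q ltr_wpDr ?sqrtr_ge0// ltr_wpDr. Qed.
Let c_gt0 := qnorm_cst_gt0 al be_gt0.

Lemma product_bdry (v : 'cV[R]_d) : bdry T v -> exists i, tile_bd (bpt v i).
Proof.
move=> [Tv nTv]; apply: contrapT => no; apply: nTv.
have Kv := (product_bptE K v).1 Tv.
have /choice[f hf] : forall i, exists e : R, 0 < e /\ forall y, N (bpt v i - y) < e -> K y.
  move=> i; have : ~ near_set al be (~` K) (bpt v i).
    by move=> h; apply: no; exists i; split => //; exact: Kv.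
  move=> /existsNP[e /not_implyP[e0 he]]; exists e; split => // y hy.
  by apply: contrapT => nKy; apply: he; exists y.
have [e e0 he] := finite_lower_bound (fun i => (hf i).1).
apply/interior_normP; exists (e / q); first by rewrite divr_gt0.
move=> w hw; apply/product_bptE => i; apply: (hf i).2.
rewrite bptB; apply: le_lt_trans (bpt_norm _ _ _ be_gt0) _; rewrite -/q.
by apply: lt_le_trans (he i); rewrite mulrC -ltr_pdivlMr.
Qed.

Lemma bdry_product (x : nat -> R * R) i0 : (i0 < d./2)%N -> (forall i, K (x i)) ->
  tile_bd (x i0) -> bdry T (assemble d x).
Proof.
move=> i0d Kx [_ hx]; split.
  by apply/product_bptE => i; rewrite bpt_assemble.
move=> /interior_normP[e e0 he].
have [|y nKy hxy] := hx (e / 2 / qnorm_cst al be); first by (apply: divr_gt0 => //; apply: divr_gt0).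
have hxy' : qnorm_cst al be * N (x i0 - y) <= e / 2 by rewrite mulrC -ler_pdivlMr// ltW.
pose x' i := if i == i0 then y else x i.
have : T (assemble d x').
  apply: he => /=; apply: (@le_lt_trans _ _ (e / 2)); last first.
    by rewrite ltr_pdivrMr// mulr_natr mulr2n ltrDl.
  apply: norm_le_bpt => // [|i]; first by rewrite divr_ge0// ltW.
  rewrite -bptB !bpt_assemble /x'.
  case: eqP => [->|_]; last by rewrite subrr normr0; split; rewrite divr_ge0// ltW.
  have [h1 h2] := qnorm_coord al be_gt0 (x i0 - y).
  by split; [apply: le_trans h1 hxy'|apply: le_trans h2 hxy'].
move=> /product_bptE/(_ (Ordinal i0d)); rewrite bpt_assemble /x' eqxx.
exact: nKy.
Qed.

Definition codes k : seq (seq bool) :=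
  flatten [seq map fst (walks t S k s) | s <- [seq s <- S | s != 0]].

Lemma mem_codes k s u v : s \in S -> s != 0 -> pK u = pK v + lat s -> mkseq u k \in codes k.
Proof.
move=> sS s0 e; apply/flattenP; exists (map fst (walks t S k s)).
  by apply/mapP; exists s => //; rewrite mem_filter s0.
apply/mapP; exists (mkseq u k, mkseq v k) => //; apply: mem_walks => i _.
  exact: (coding_nbrs cd (tile_stateE be_gt0 n0 sc pKP e i)).
exact: state_neq0.
Qed.

Lemma sqrt_half_double m : r ^+ m.*2 = 2^-1 ^+ m.
Proof. by rewrite -mul2n exprM sqr_sqrtr// invr_ge0. Qed.

(** A boundary point has a block on the boundary of the tile, coded by a walk; each of the other
    blocks ranges over all words of length 2m, which gives 4^m pieces. *)
Lemma product_upper_growth (C b : R) : 0 <= C -> 0 <= b ->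
  (forall k s, s \in S -> s != 0 -> (size (walks t S k s))%:R <= C * b ^+ k) ->
  upper_growth T (b ^+ 2 * 4 ^+ (d./2).-1).
Proof.
move=> C0 b0 hw.
exists (qnorm_cst al be * (2 * 4)), ((d./2)%:R * ((size S)%:R * C)) => m.
(* Each letter contracts by r with r^2 = 1/2, so scale 2^-m takes 2m letters. *)
pose k := m.*2.
pose I : finType := {x : 'I_d./2 * {ffun 'I_d./2 -> k.-tuple bool} | val (x.2 x.1) \in codes k}.
pose F (x : I) : set 'cV[R]_d := [set v | forall j, exists u, mkseq u k = (val x).2 j /\ bpt v j = pK u].
exists I, F; split; [split|].
- move=> v bv; have [i hi] := product_bdry bv.
  have [s [u [w [sS s0 vu uw]]]] := tile_bd_nbr be_gt0 sc cd hi.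
  have /choice[f hf] : forall j, exists u', pK u' = bpt v j.
    by move=> j; have [u' _ e] := (product_bptE K v).1 bv.1 j; exists u'.
  pose g j := if j == i then u else f j.
  pose W := [ffun j => [tuple of mkseq (g j) k]].
  have hW : val (W i) \in codes k by rewrite ffunE /g eqxx; exact: mem_codes uw.
  exists (exist _ (i, W) hW) => j /=; exists (g j); split; first by rewrite ffunE.
  by rewrite /g; case: eqP => [->|_].
- move=> x v w Fv Fw; apply: norm_le_bpt => // [|i].
    by rewrite mulr_ge0 ?exprn_ge0 ?invr_ge0// mulr_ge0// ltW.
  rewrite -bptB; have [u [hu ->]] := Fv i; have [u' [hu' ->]] := Fw i.
  have h : qnorm_cst al be * N (pK u - pK u') <= qnorm_cst al be * (2 * 4) * 2^-1 ^+ m.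
    rewrite -mulrA ler_pM2l// -sqrt_half_double.
    by apply: (address_modulus be_gt0 pKP); apply: eq_mkseq_lt; rewrite hu hu'.
  have [h1 h2] := qnorm_coord al be_gt0 (pK u - pK u').
  by split; [apply: le_trans h1 h|apply: le_trans h2 h].
have sc_codes : (size (codes k))%:R <= (size S)%:R * C * b ^+ k.
  rewrite size_flatten /shape -map_comp sumnE big_map natr_sum.
  apply: (@le_trans _ _ (\sum_(s <- [seq s <- S | s != 0]) C * b ^+ k)).
    rewrite big_seq [leRHS]big_seq; apply: ler_sum => s.
    by rewrite mem_filter /= size_map => /andP[s0 sS]; apply: hw.
  rewrite big_const_seq iter_addr_0 -[_ *+ _]mulr_natl mulrA ler_wpM2r ?exprn_ge0//.
  by rewrite ler_wpM2r// ler_nat count_predT size_filter count_size.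
have cI : (#|I| <= d./2 * (size (codes k) * (2 ^ k) ^ (d./2).-1))%N.
  rewrite card_sig -sum1_card.
  rewrite (eq_bigl (fun x : 'I_d./2 * {ffun 'I_d./2 -> k.-tuple bool} => predT x.1 && (val (x.2 x.1) \in codes k))); last by move=> x; rewrite inE.
  rewrite -(pair_big_dep predT (fun i (W : {ffun 'I_d./2 -> k.-tuple bool}) => val (W i) \in codes k) (fun _ _ => 1%N)) /=.
  rewrite -[X in (_ <= X * _)%N]card_ord -sum_nat_const; apply: leq_sum => i _.
  rewrite sum1_card -[X in (_ <= _ * _ ^ X.-1)%N](card_ord d./2).
  pose A (j : 'I_d./2) : pred (k.-tuple bool) := [pred w | (j == i) ==> (val w \in codes k)].
  rewrite (_ : #|_| = #|[pred W : {ffun 'I_d./2 -> k.-tuple bool} | [forall j, W j \in A j]]|); last first.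
    apply: eq_card => W; rewrite !inE; apply/idP/forallP => [h j|/(_ i)]; last by rewrite !inE eqxx.
    by rewrite !inE; apply/implyP => /eqP ->.
  apply: (card_ffun_le (i := i)) => [|j ji].
    rewrite cardE -(size_map val); apply: uniq_leq_size.
      by rewrite map_inj_uniq ?enum_uniq//; exact: val_inj.
    by move=> _ /mapP[w + ->]; rewrite mem_enum !inE eqxx.
  by apply: leq_trans (max_card _) _; rewrite card_tuple card_bool.
apply: (@le_trans _ _ (d./2 * (size (codes k) * (2 ^ k) ^ (d./2).-1))%N%:R); first by rewrite ler_nat.
rewrite !natrM !natrX -mulrA ler_wpM2l// exprMn -!exprM.
have -> : (2 : R) ^+ (k * (d./2).-1) = 4 ^+ ((d./2).-1 * m).
  by rewrite -[4]/(2 * 2)%:R natrM -expr2 -exprM /k -mul2n; congr (_ ^+ _); lia.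
rewrite mulrA ler_wpM2r ?exprn_ge0//.
by rewrite (_ : (2 * m)%N = k) // /k mul2n.
Qed.

(** Boundary points are built from a walk in block 0 and arbitrary words in the other blocks; a set
    of diameter of order 2^-m contains boundedly many of them by the multiplicity bounds. *)
Lemma product_lower_growth (s0 : int * int) (C b : R) : s0 \in S -> s0 != 0 -> 0 < C -> 0 <= b ->
  (forall k, C * b ^+ k <= (size (walks t S k s0))%:R) ->
  lower_growth T (b ^+ 2 * 4 ^+ (d./2).-1).
Proof.
move=> s0S s00 C0 b0 hw c c0.
have [M hM] := pieces_multiplicity be_gt0 sc cd (q * c).
have [M' hM'] := walks_multiplicity be_gt0 sc cd (q * c).
pose Mt := (M'.+1 * M.+1 ^ (d./2).-1)%N.
have Mt0 : (0 < Mt)%N by rewrite muln_gt0 expn_gt0.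
exists (C / Mt%:R); first by rewrite divr_gt0// ltr0n.
move=> m J F [cov diam].
pose k := m.*2.
pose L := walks t S k s0.
have k2 : (0 < d./2)%N by have := odd_double_half d; rewrite (negPf d_even); lia.
pose i0 : 'I_d./2 := Ordinal k2.
have /choice[g hg] : forall a : 'I_(size L), exists uv : (nat -> bool) * (nat -> bool),
    [/\ mkseq uv.1 k = (nth ([::], [::]) L a).1, mkseq uv.2 k = (nth ([::], [::]) L a).2 &
        pK uv.1 = pK uv.2 + lat s0].
  move=> a; have [u [v h]] := walk_point be_gt0 sc cd s0S (mem_nth ([::], [::]) (ltn_ord a)).
  by exists (u, v).
pose word (x : 'I_(size L) * {ffun 'I_d./2 -> k.-tuple bool}) (j : nat) : nat -> bool :=
  if j == 0%N then (g x.1).1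
  else if insub j is Some j' then catw (x.2 j') (fun=> true) else (fun=> true).
pose pt (x : 'I_(size L) * {ffun 'I_d./2 -> k.-tuple bool}) : 'cV[R]_d := assemble d (fun j => pK (word x j)).
have bpt_pt x : bdry T (pt x).
  apply: (@bdry_product (fun j => pK (word x j)) 0%N k2) => [i|]; first by exists (word x i).
  by have [_ _ h] := hg x.1; exact: (nbr_tile_bd be_gt0 sc cd s00 h).
have /choice[phi hphi] : forall x, exists j, F j (pt x) by move=> x; apply: cov.
(* [x.2] also carries a word for block 0, which [pt] ignores; the factor 2^k accounts for it. *)
have fib j : (#|[pred x | phi x == j]| <= Mt * 2 ^ k)%N.
  pose E (i : 'I_d./2) : set (R * R) := [set y | exists2 v, F j v & bpt v i = y].
  have Ediam i y y' : E i y -> E i y' -> N (y - y') <= q * c * r ^+ k.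
    move=> [v Fv <-] [w Fw <-]; rewrite bptB.
    apply: le_trans (bpt_norm _ _ _ be_gt0) _; rewrite -/q -mulrA ler_pM2l//.
    by rewrite /k sqrt_half_double; apply: diam Fv Fw.
  pose A : pred 'I_(size L) := [pred a | `[< E i0 (pK (g a).1) >]].
  pose B (i : 'I_d./2) : pred (k.-tuple bool) :=
    [pred w | (i != i0) ==> `[< exists2 u : nat -> bool, mkseq u k = val w & E i (pK u) >]].
  have cA : (#|A| <= M'.+1)%N.
    apply: leqW; rewrite cardE -(size_map (fun a : 'I_(size L) => nth ([::], [::]) L a)).
    apply: (hM' k s0 (E i0)); first exact: Ediam.
      rewrite map_inj_in_uniq ?enum_uniq// => a a' _ _ /eqP.
      by rewrite nth_uniq ?uniq_walks// => /eqP/val_inj.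
    move=> _ /mapP[a + ->]; rewrite mem_enum inE => /asboolP Ea.
    by have [h1 h2 h3] := hg a; exists (g a).1, (g a).2; split; [exact: h1|exact: h2|exact: h3|exact: (asboolW Ea)].
  have cB i : i != i0 -> (#|B i| <= M.+1)%N.
    move=> ii0; apply: leqW; rewrite cardE -(size_map val).
    apply: (hM k (E i)); first exact: Ediam.
      by rewrite map_inj_uniq ?enum_uniq//; exact: val_inj.
    by move=> _ /mapP[w + ->]; rewrite mem_enum inE ii0 => /asboolP.
  apply: (@leq_trans #|[predX A & [pred W : {ffun 'I_d./2 -> k.-tuple bool} | [forall i, W i \in B i]]]|).
    rewrite cardE [leqRHS]cardE; apply: uniq_leq_size (enum_uniq _) _ => -[a W].
    rewrite !mem_enum !inE => /eqP e.
    have Fx := hphi (a, W); rewrite e in Fx.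
    apply/andP; split; first by apply/asboolP; exists (pt (a, W)) => //; rewrite bpt_assemble.
    apply/forallP => i; rewrite !inE; apply/implyP => ii0; apply/asboolP.
    exists (catw (W i) (fun=> true)).
      by have := mkseq_catw (W i) (fun=> true); rewrite size_tuple.
    exists (pt (a, W)) => //; rewrite bpt_assemble /word.
    by rewrite (negPf ii0 : (val i == 0%N) = false) valK.
  rewrite cardX; apply: (@leq_trans (M'.+1 * (2 ^ k * M.+1 ^ (d./2).-1))).
    rewrite leq_mul// -[X in (_ <= _ * _ ^ X.-1)%N](card_ord d./2).
    apply: (card_ffun_le (i := i0)) => //.
    by apply: leq_trans (max_card _) _; rewrite card_tuple card_bool.
  by rewrite /Mt mulnCA mulnC.
have := card_le_fibres fib; rewrite card_prod card_ord card_ffun card_tuple card_bool card_ord => h.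
have hc : (size L * (2 ^ k) ^ (d./2).-1 <= #|J| * Mt)%N.
  have k0 : (0 < 2 ^ k)%N by rewrite expn_gt0.
  by rewrite -(leq_pmul2r k0) -!mulnA -expnSr prednK// [(M'.+1 * _)%N]mulnA; exact: h.
have hw' := hw k; rewrite -/L in hw'.
rewrite mulrAC ler_pdivrMr ?ltr0n// -natrM.
apply: le_trans (_ : _ <= (size L * (2 ^ k) ^ (d./2).-1)%N%:R) _; last by rewrite ler_nat.
rewrite natrM !natrX exprMn mulrA; apply: ler_pM.
- by rewrite mulr_ge0 ?exprn_ge0// ltW.
- by rewrite exprn_ge0// exprn_ge0.
- by move: hw'; rewrite -exprM /k -mul2n.
rewrite -!exprM -[4]/(2 * 2)%:R natrM -expr2 -exprM le_eqVlt; apply/orP; left; apply/eqP.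
by congr (_ ^+ _); rewrite /k -mul2n; clear; lia.
Qed.

End ProductGrowth.

(** * Growth of the boundary of the cube *)

Section CubeGrowth.
Context {R : realType} (d : nat).
Hypotheses (d_gt0 : (0 < d)%N) (d_even : ~~ odd d).
Local Notation T := (planar_product (fun _ : 'I_d./2 => col2 @` (@square R))).

Lemma cubeE (v : 'cV[R]_d) : T v <-> forall l, `|v l 0| <= 1/2.
Proof.
split => [/product_bptE h l|h].
  have -> : v = assemble d (fun i => if insub i is Some i' then bpt v i' else 0).
    by apply: assemble_block => // i; rewrite valK -col2_bpt.
  rewrite mxE; case: insubP => [i _ _|_].
    by have [] := h i; case: ifP.
  by case: ifP => _ /=; rewrite normr0; lra.
by apply/product_bptE => i; split; rewrite /bpt !mxE; apply: h.
Qed.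

Lemma dyadic_cell (x : R) m : 0 <= x <= 1 ->
  exists2 w : nat, (w < 2 ^ m)%N & w%:R * 2^-1 ^+ m <= x <= (w%:R + 1) * 2^-1 ^+ m.
Proof.
move=> x01; elim: m => [|m [w wm /andP[h1 h2]]].
  by exists 0%N => //; rewrite mul0r mulr1 add0r.
rewrite !exprS; have p0 : 0 < 2^-1 ^+ m :> R by rewrite exprn_gt0// invr_gt0.
move: p0 h1 h2; set p := 2^-1 ^+ m => p0 h1 h2.
have [h|h] := leP x ((w.*2.+1)%:R * (2^-1 * p)).
  exists w.*2; first by rewrite expnS mul2n ltn_double.
  move: h; rewrite -addn1 natrD -muln2 natrM => h.
  by apply/andP; split; lra.
exists w.*2.+1; first by rewrite expnS; lia.
move: h; rewrite -addn1 natrD -muln2 natrM => h.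
by apply/andP; split; lra.
Qed.

Lemma cube_upper_growth : upper_growth T (2 ^+ d.-1).
Proof.
exists 1, (d%:R * 2) => m.
(* A face and a dyadic cell of it; the cell index in the direction normal to the face is set to 0 so
   as not to be counted. *)
pose I : finType := {x : 'I_d * bool * {ffun 'I_d -> 'I_(2 ^ m)} | val (x.2 x.1.1) == 0%N}.
pose side (b : bool) : R := if b then 1/2 else - (1/2).
pose F (x : I) : set 'cV[R]_d := [set v | v (val x).1.1 0 = side (val x).1.2 /\
  forall j, j != (val x).1.1 -> ((val x).2 j)%:R * 2^-1 ^+ m <= v j 0 + 1/2 <= (((val x).2 j)%:R + 1) * 2^-1 ^+ m].
have p0 : 0 < 2^-1 ^+ m :> R by rewrite exprn_gt0// invr_gt0.
have N0 : (0 < 2 ^ m)%N by rewrite expn_gt0.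
exists I, F; split; [split|].
- move=> v [Tv nTv]; have hv := (cubeE v).1 Tv.
  have [l hl] : exists l, `|v l 0| = 1/2.
    apply: contrapT => no; apply: nTv.
    have pos0 l : 0 < 1/2 - `|v l 0|.
      by rewrite subr_gt0 lt_neqAle hv andbT; apply/eqP => e; apply: no; exists l.
    have [e e0 he] := finite_lower_bound pos0.
    apply/interior_normP; exists e => // w hw; apply/cubeE => l.
    have h1 := coord_le_norm (v - w) l; rewrite !mxE in h1.
    have -> : w l 0 = v l 0 - (v l 0 - w l 0) by ring.
    by apply: le_trans (ler_normB _ _) _; have := he l; lra.
  have [b hb] : exists b, v l 0 = side b.
    by move: hl; case: (ger0P (v l 0)) => _ e; [exists true|exists false]; rewrite /side; lra.
  have /choice[f hf] : forall j : 'I_d, exists w : 'I_(2 ^ m),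
      w%:R * 2^-1 ^+ m <= v j 0 + 1/2 <= (w%:R + 1) * 2^-1 ^+ m.
    move=> j; have [|w wm h] := @dyadic_cell (v j 0 + 1/2) m.
      by have := hv j; rewrite ler_norml => /andP[? ?]; apply/andP; split; lra.
    by exists (Ordinal wm).
  pose W := [ffun j => if j == l then Ordinal N0 else f j].
  have hW : val (W l) == 0%N by rewrite ffunE eqxx.
  exists (exist _ ((l, b), W) hW); split => //= j jl.
  by rewrite ffunE (negPf jl).
- move=> x v w [v1 v2] [w1 w2]; apply: norm_le_coord => [|j]; first by rewrite mul1r ltW.
  rewrite !mxE mul1r; have [->|jl] := eqVneq j (val x).1.1.
    by rewrite v1 w1 subrr normr0 ltW.
  have /andP[a1 a2] := v2 j jl; have /andP[b1 b2] := w2 j jl.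
  by clear -a1 a2 b1 b2; rewrite ler_norml; apply/andP; split; lra.
have cI : (#|I| <= d * 2 * (1 * (2 ^ m) ^ d.-1))%N.
  rewrite card_sig -sum1_card.
  rewrite (eq_bigl (fun x : 'I_d * bool * {ffun 'I_d -> 'I_(2 ^ m)} =>
    predT x.1 && (val (x.2 x.1.1) == 0%N))); last by move=> x; rewrite inE.
  rewrite -(pair_big_dep predT (fun i (W : {ffun 'I_d -> 'I_(2 ^ m)}) => val (W i.1) == 0%N) (fun _ _ => 1%N)) /=.
  have -> : (d * 2)%N = #|{: 'I_d * bool}| by rewrite card_prod card_ord card_bool.
  rewrite -sum_nat_const; apply: leq_sum => -[i b] _.
  rewrite sum1_card -[X in (_ <= _ * _ ^ X.-1)%N](card_ord d).
  pose A (j : 'I_d) : pred 'I_(2 ^ m) := [pred w | (j == i) ==> (val w == 0%N)].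
  rewrite (_ : #|_| = #|[pred W : {ffun 'I_d -> 'I_(2 ^ m)} | [forall j, W j \in A j]]|); last first.
    apply: eq_card => W; rewrite !inE; apply/idP/forallP => [h j|/(_ i)]; last by rewrite !inE eqxx.
    by rewrite !inE; apply/implyP => /eqP ->.
  apply: (card_ffun_le (i := i)) => [|j ji]; last first.
    by apply: leq_trans (max_card _) _; rewrite card_ord.
  rewrite cardE -(size_map val); apply: (@uniq_leq_size _ _ [:: 0%N]).
    by rewrite map_inj_uniq ?enum_uniq//; exact: val_inj.
  by move=> _ /mapP[w + ->]; rewrite mem_enum !inE eqxx.
apply: (@le_trans _ _ (d * 2 * (1 * (2 ^ m) ^ d.-1))%N%:R); first by rewrite ler_nat.
by rewrite mul1n !natrM !natrX -!exprM mulnC.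
Qed.

End CubeGrowth.

(** * Growth rates of the neighbour graphs *)

Section Weights.
Context {R : realType}.

Definition succs (t : int) (S : seq (int * int)) s :=
  [seq nxt t 2 s ij.1 ij.2 | ij <- moves t S s].

Lemma sum_moves t S s (w : int * int -> R) :
  \sum_(ij <- moves t S s) w (nxt t 2 s ij.1 ij.2) = \sum_(s' <- succs t S s) w s'.
Proof. by rewrite big_map. Qed.

(* (l^2, 1, l), with l = 1.521... the root of l^3 = l + 2, is the Perron vector of the neighbour graph;
   rational approximations of it bound the numbers of walks. *)
Definition bear_weight (a b c : R) (s : int * int) : R :=
  if (s == (1, 0)) || (s == (-1, 0)) then a
  else if (s == (0, 1)) || (s == (0, -1)) then b else c.

Lemma bear_sum a b c s : s \in bear_nbrs -> s != 0 ->
  \sum_(ij <- moves 1 bear_nbrs s) bear_weight a b c (nxt 1 2 s ij.1 ij.2) =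
  bear_weight (b + b + c) c a s.
Proof.
have E : all (fun s => (s == 0) || (perm_eq (succs 1 bear_nbrs s)
    (if (s == (1, 0)) then [:: (0, 1); (0, 1); (-1, 1)]
     else if s == (-1, 0) then [:: (0, -1); (0, -1); (1, -1)]
     else if s == (0, 1) then [:: (-1, 1)] else if s == (0, -1) then [:: (1, -1)]
     else if s == (-1, 1) then [:: (-1, 0)] else [:: (1, 0)]))) bear_nbrs by vm_compute.
move=> sS s0; have := allP E s sS; rewrite (negPf s0) /= => h.
rewrite sum_moves (perm_big _ h) /= {h E}; move: sS s0.
rewrite !inE => /or4P[/eqP->|/eqP->|/eqP->|/or4P[/eqP->|/eqP->|/eqP->|/eqP->]] //= _;
by rewrite !big_cons big_nil /bear_weight /= ?addr0 ?addrA.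
Qed.

(* Here the Perron vector is (1/l, 1, 1/l^2) with l = 1.695... the root of l^3 = l^2 + 2. *)
Definition dragon_weight (a b c : R) (s : int * int) : R :=
  if (s == (1, 0)) || (s == (-1, 0)) then a
  else if (s == (-1, 1)) || (s == (1, -1)) then b else c.

Lemma dragon_sum a b c s : s \in dragon_nbrs -> s != 0 ->
  \sum_(ij <- moves 2 dragon_nbrs s) dragon_weight a b c (nxt 2 2 s ij.1 ij.2) =
  dragon_weight b (b + c + c) a s.
Proof.
have E : all (fun s => (s == 0) || (perm_eq (succs 2 dragon_nbrs s)
    (if (s == (1, 0)) then [:: (-1, 1)]
     else if s == (-1, 0) then [:: (1, -1)]
     else if s == (-1, 1) then [:: (-1, 1); (-2, 1); (-2, 1)]
     else if s == (1, -1) then [:: (1, -1); (2, -1); (2, -1)]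
     else if s == (-2, 1) then [:: (-1, 0)] else [:: (1, 0)]))) dragon_nbrs by vm_compute.
move=> sS s0; have := allP E s sS; rewrite (negPf s0) /= => h.
rewrite sum_moves (perm_big _ h) /= {h E}; move: sS s0.
rewrite !inE => /or4P[/eqP->|/eqP->|/eqP->|/or4P[/eqP->|/eqP->|/eqP->|/eqP->]] //= _;
by rewrite !big_cons big_nil /dragon_weight /= ?addr0 ?addrA.
Qed.

(** 153/100 is above the root of l^3 = l + 2, which makes the approximate Perron vector a
    super-eigenvector. *)
Lemma bear_walks_upper k s : s \in bear_nbrs -> s != 0 ->
  (size (walks 1 bear_nbrs k s))%:R <= (153/100) ^+ 2 * (153/100) ^+ k :> R.
Proof.
move=> sS s0.
pose w := bear_weight ((153/100) ^+ 2) 1 (153/100).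
have b0 : 0 <= 153/100 :> R by lra.
apply: le_trans (@walks_upper 1 bear_nbrs R w _ b0 _ _ k s sS s0) _.
- by move=> s' _ _; rewrite /w /bear_weight; do !case: ifP => _; lra.
- move=> s' s'S s'0; rewrite bear_sum// /w /bear_weight.
  by do !case: ifP => _; lra.
- rewrite ler_wpM2r ?exprn_ge0// /w /bear_weight.
  by do !case: ifP => _; lra.
Qed.

(** 152/100 is below the root; the vector is rescaled by its square so that all weights are at most
    1. *)
Lemma bear_walks_lower k :
  (100/152) ^+ 2 * (152/100) ^+ k <= (size (walks 1 bear_nbrs k (1, 0)))%:R :> R.
Proof.
pose w := bear_weight 1 ((100/152) ^+ 2) (100/152).
have b0 : 0 <= 152/100 :> R by lra.
apply: le_trans _ (@walks_lower 1 bear_nbrs R w _ b0 _ _ k (1, 0) isT isT).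
- by rewrite ler_wpM2r ?exprn_ge0// /w /bear_weight /=; lra.
- by move=> s' _ _; rewrite /w /bear_weight; do !case: ifP => _; lra.
- move=> s' s'S s'0; rewrite bear_sum// /w /bear_weight.
  by do !case: ifP => _; lra.
Qed.

(** 169/100 is below the root of l^3 = l^2 + 2. *)
Lemma dragon_walks_lower k :
  (100/169) * (169/100) ^+ k <= (size (walks 2 dragon_nbrs k (1, 0)))%:R :> R.
Proof.
pose w := dragon_weight (100/169) 1 ((100/169) ^+ 2).
have b0 : 0 <= 169/100 :> R by lra.
apply: le_trans _ (@walks_lower 2 dragon_nbrs R w _ b0 _ _ k (1, 0) isT isT).
- by rewrite ler_wpM2r ?exprn_ge0// /w /dragon_weight /=; lra.
- by move=> s' _ _; rewrite /w /dragon_weight; do !case: ifP => _; lra.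
- move=> s' s'S s'0; rewrite dragon_sum// /w /dragon_weight.
  by do !case: ifP => _; lra.
Qed.

End Weights.

Section StandardSets.
Context {R : realType} (d : nat).
Hypotheses (d_gt0 : (0 < d)%N) (d_even : ~~ odd d).
Local Notation power K := (planar_product (fun _ : 'I_d./2 => col2 @` K)).
Variables (pB pQB pD pQD : (nat -> bool) -> R * R).
Hypothesis cB : tile_coding 1 2 (1/2) (7/4) bear_nbrs (@bear_hex R) pB pQB.
Hypothesis cD : tile_coding 2 2 1 1 dragon_nbrs (@dragon_hex R) pD pQD.

Let beB : 0 < 7/4 :> R. Proof. by lra. Qed.

Lemma bear_upper : upper_growth (power (range pB)) ((153/100) ^+ 2 * 4 ^+ (d./2).-1).
Proof.
apply: (product_upper_growth d_gt0 d_even beB bear_scale cB (C := (153/100) ^+ 2)).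
- by lra.
- by lra.
- by move=> k s; apply: bear_walks_upper.
Qed.

Lemma bear_lower : lower_growth (power (range pB)) ((152/100) ^+ 2 * 4 ^+ (d./2).-1).
Proof.
apply: (product_lower_growth d_gt0 d_even beB bear_scale cB (s0 := (1, 0)) (C := (100/152) ^+ 2)).
all: try by lra.
all: first [exact: bear_walks_lower | by []].
Qed.

Lemma dragon_lower : lower_growth (power (range pD)) ((169/100) ^+ 2 * 4 ^+ (d./2).-1).
Proof.
apply: (product_lower_growth d_gt0 d_even ltr01 dragon_scale cD (s0 := (1, 0)) (C := 100/169)).
all: try by lra.
all: first [exact: dragon_walks_lower | by []].
Qed.

Lemma cube_upper : upper_growth (power (@square R)) (2 * 4 ^+ (d./2).-1).
Proof.
have := cube_upper_growth (R := R) d_gt0 d_even; congr (upper_growth _ _).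
have k2 : (0 < d./2)%N by have := odd_double_half d; rewrite (negPf d_even); lia.
rewrite -[4]/(2 * 2)%:R natrM -expr2 -exprM -exprS; congr (_ ^+ _).
by have := odd_double_half d; rewrite (negPf d_even); lia.
Qed.

Let p4 : 0 < 4 ^+ (d./2).-1 :> R. Proof. exact: exprn_gt0. Qed.

Lemma cube_not_dragon : ~ lip_homeomorphic (power (@square R)) (power (range pD)).
Proof.
by apply: growth_obstruction cube_upper dragon_lower; [rewrite mulr_gt0|rewrite ltr_pM2r//; lra].
Qed.

Lemma cube_not_bear : ~ lip_homeomorphic (power (@square R)) (power (range pB)).
Proof.
by apply: growth_obstruction cube_upper bear_lower; [rewrite mulr_gt0|rewrite ltr_pM2r//; lra].
Qed.

Lemma bear_not_dragon : ~ lip_homeomorphic (power (range pB)) (power (range pD)).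
Proof.
by apply: growth_obstruction bear_upper dragon_lower;
  [rewrite mulr_gt0//; lra|rewrite ltr_pM2r//; lra].
Qed.

Lemma square_bear_homeomorphic : homeomorphic (power (@square R)) (power (range pB)).
Proof.
apply: (coding_square_homeomorphic d_gt0 d_even cB bear_slice_image).
- exact: bear_slice_inj.
- exact: bear_slice_lip.
- exact: coding_modulusK beB cB.
Qed.

Lemma square_dragon_homeomorphic : homeomorphic (power (@square R)) (power (range pD)).
Proof.
apply: (coding_square_homeomorphic d_gt0 d_even cD dragon_slice_image).
- exact: dragon_slice_inj.
- exact: dragon_slice_lip.
- exact: coding_modulusK ltr01 cD.
Qed.

End StandardSets.

(** * Attractors of integer matrices *)

Section Attractor.
Context {R : realType}.

(** By the functional equation, the N-th partial sum of the series is p(u) minus A^-N applied to the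
    point of the shifted word, and this remainder tends to 0. *)
Lemma attractor_range d (M : 'M[int]_d) (d0 d1 : 'cV[int]_d) (p : (nat -> bool) -> 'cV[R]_d) :
  int_to_real R M \in unitmx ->
  (forall u, int_to_real R M *m p u = int_to_real R (if u 0%N then d1 else d0) + p (wtail u)) ->
  (forall e, 0 < e -> exists N0, forall N v, (N0 <= N)%N ->
     `|invmx (int_to_real R M) ^+ N *m p v| <= e) ->
  attractor R M [set d0; d1] = range p.
Proof.
set A := int_to_real R M => Au pS dec.
pose sh N (u : nat -> bool) : nat -> bool := fun i => u (N + i)%N.
pose f (u : nat -> bool) j := invmx A ^+ j.+1 *m int_to_real R (if u j then d1 else d0).
have sumE u N : series (f u) N = p u - invmx A ^+ N *m p (sh N u).
  elim: N => [|N IH].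
    by rewrite /series /= big_geq// expr0 mul1mx (_ : sh 0%N u = u) ?subrr.
  rewrite /series /= big_nat_recr//= -[\sum_(0 <= k < N) f u k]/(series (f u) N) IH.
  have -> : p (sh N u) = invmx A *m (int_to_real R (if u N then d1 else d0) + p (sh N.+1 u)).
    have := pS (sh N u); rewrite /sh addn0 => e.
    rewrite (_ : (fun i => u (N.+1 + i)%N) = wtail (sh N u)); last first.
      by apply/funext => i; rewrite /wtail /sh addSnnS.
    by rewrite /sh -e mulmxA mulVmx// mul1mx.
  rewrite mulmxA /f (_ : invmx A ^+ N *m invmx A = invmx A ^+ N.+1) ?exprSr//.
  by rewrite mulmxDr opprD addrA addrAC subrK.
have lim u : series (f u) @ \oo --> p u.
  apply/cvgrPdist_le => e e0; have [N0 hN] := dec e e0.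
  exists N0 => // N /= NN0; rewrite sumE opprB addrCA subrr addr0; exact: hN.
apply/seteqP; split => [x [a [Da ax]]|_ [u _ <-]].
  exists (fun j => a j == d1) => //.
  apply: cvg_unique (lim _) _ => //.
  rewrite (_ : f _ = fun j => invmx A ^+ j.+1 *m int_to_real R (a j))//.
  apply/funext => j; rewrite /f; case: eqP => [<-//|n]; by case: (Da j) => // ->.
exists (fun j => if u j then d1 else d0); split; last exact: lim.
by move=> j; case: (u j); [right|left].
Qed.

Lemma power_decay d (A : 'M[R]_d) k (t n : int) (al be : R) : 0 < be -> n != 0 ->
  (forall x, qnorm al be (cinv t n x) = Num.sqrt 2^-1 * qnorm al be x) ->
  A \in unitmx -> (0 < k)%N ->
  A ^+ k *m A ^+ k = t%:~R *: A ^+ k - n%:~R *: 1%:M ->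
  forall B e, 0 < e -> exists N0, forall N (x : 'cV[R]_d), (N0 <= N)%N -> `|x| <= B ->
    `|invmx A ^+ N *m x| <= e.
Proof.
move=> be0 n0 sc Au k0 AE B e e0.
pose I := invmx A; pose J := I ^+ k.
have IA i : I ^+ i *m A ^+ i = 1%:M.
  elim: i => [|i IH]; first by rewrite !expr0 mulmx1.
  rewrite exprSr exprS -[I ^+ i * I]/(I ^+ i *m I) -[A * _]/(A *m _).
  by rewrite -mulmxA (mulmxA I) mulVmx// mul1mx.
have nR : n%:~R != 0 :> R by rewrite intr_eq0.
have JE : J *m J = n%:~R^-1 *: (t%:~R *: J - 1%:M).
  have : J *m J *m (A ^+ k *m A ^+ k) = t%:~R *: J - n%:~R *: (J *m J).
    rewrite AE mulmxBr -!scalemxAr mulmx1 -mulmxA IA mulmx1 //.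
  rewrite -mulmxA (mulmxA J (A ^+ k)) IA mul1mx IA => h.
  have -> : t%:~R *: J - 1%:M = n%:~R *: (J *m J) by rewrite h opprB addrCA subrr addr0.
  by rewrite scalerA mulVf// scale1r.
(* The powers of J = A^-k lie in the span of J and 1, and multiplication by J acts on the
   coordinates as [cinv], a contraction for [qnorm]. *)
pose x j := iter j (cinv t n) (0, 1) : R * R.
have Jp j : J ^+ j = (x j).1 *: J + (x j).2 *: 1%:M.
  elim: j => [|j IH]; first by rewrite expr0 scale0r add0r scale1r.
  rewrite exprSr -[_ * J]/(J ^+ j *m J) IH mulmxDl -!scalemxAl mul1mx JE /=.
  move: (x j) => [y z] /=; rewrite scalerA scalerBr scalerA mulNr scaleNr addrAC -scalerDl.
  by congr (_ *: _ - _ *: _); field.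
have xn j : qnorm al be (x j) = Num.sqrt 2^-1 ^+ j * qnorm al be (0, 1).
  by elim: j => [|j IH]; [rewrite mul1r|rewrite /= sc IH exprS mulrA].
have [cJ cJ0 hJ] := mulmx_lip J.
have : exists2 c, 0 < c & forall i (v : 'cV[R]_d), (i < k)%N -> `|I ^+ i *m v| <= c * `|v|.
  elim: k {k0 AE J JE Jp cJ0 hJ} => [|k [c c0 hc]]; first by exists 1.
  have [c' c'0 hc'] := mulmx_lip (I ^+ k).
  exists (c + c'); first exact: addr_gt0.
  move=> i v; rewrite ltnS leq_eqVlt mulrDl => /orP[/eqP->|ik].
    by rewrite ler_wpDl// mulr_ge0// ltW.
  by rewrite ler_wpDr ?hc// mulr_ge0// ltW.
move=> [c c0 hc].
have [q q0 hq] : exists2 q, 0 < q & forall x, `|x.1| <= q * qnorm al be x /\ `|x.2| <= q * qnorm al be x.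
  by exists (qnorm_cst al be); [exact: qnorm_cst_gt0|exact: qnorm_coord].
pose X := c * (q * qnorm al be (0, 1) * (cJ + 1) * `|B|).
have r1 : Num.sqrt 2^-1 < 1 :> R by apply: le_lt_trans (@sqrt_half_lt R) _; lra.
have [m hm] := geometric_small (@sqrt_half_ge0 R) r1 X e0.
exists (m * k)%N => N v NN vB.
have dec j (w : 'cV[R]_d) : `|J ^+ j *m w| <= q * qnorm al be (0, 1) * (cJ + 1) * `|w| * Num.sqrt 2^-1 ^+ j.
  rewrite Jp mulmxDl -!scalemxAl mul1mx.
  have [h1 h2] := hq (x j); rewrite xn in h1 h2.
  apply: le_trans (ler_normD _ _) _; rewrite !normrZ.
  apply: (@le_trans _ _ ((q * (Num.sqrt 2^-1 ^+ j * qnorm al be (0, 1))) * (cJ * `|w| + `|w|))).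
    by rewrite mulrDr; apply: lerD; apply: ler_pM; rewrite ?hJ.
  by rewrite le_eqVlt; apply/orP; left; apply/eqP; ring.
have -> : I ^+ N = I ^+ (N %% k) *m J ^+ (N %/ k).
  by rewrite -[_ *m _]/(_ * _) /J -exprM -exprD; congr (_ ^+ _); rewrite addnC mulnC -divn_eq.
rewrite -mulmxA; apply: le_trans (hc _ _ _) _; first exact: ltn_pmod.
apply: le_trans (ltW hm); rewrite /X -!mulrA ler_pM2l//.
apply: le_trans (dec _ _) _; rewrite -!mulrA ler_pM2l//.
apply: ler_wpM2l; first exact: qnorm_ge0.
apply: ler_wpM2l; first by rewrite addr_ge0// ltW.
apply: ler_pM; rewrite ?normr_ge0 ?exprn_ge0 ?sqrtr_ge0//.
  exact: le_trans vB (ler_norm _).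
apply: ler_wiXn2l; rewrite ?sqrt_half_ge0//.
  exact: ltW.
by rewrite leq_divRL.
Qed.

End Attractor.

(** * Affine uniqueness of dragons and bears *)

Section PlanarAttractor.
Context {R : realType}.

Lemma address_opp (t n : int) (al be rho D : R) pi u : 0 < be -> 0 <= rho -> rho < 1 ->
  address al be rho D (gtile t n) (ball2 al be) pi -> pi (fun j => ~~ u j) = - pi u.
Proof.
move=> be0 r0 r1 [_ _ pa].
have B0 : ball2 al be 0 by rewrite /ball2 /= qnorm0.
have actN m w x : act (gtile t n) m (fun j => ~~ w j) (- x) = - act (gtile t n) m w x.
  elim: m w => //= m IH w.
  rewrite (_ : wtail (fun j => ~~ w j) = fun j => ~~ wtail w j)// IH.
  by case: (w 0%N); rewrite /gtile /cinv /digit; congr pair; rewrite /=; ring.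
apply/subr0_eq/(qnorm_eq0 (al := al) be0)/eqP; rewrite opprK eq_le qnorm_ge0 andbT.
apply: (@le_geometric _ rho r0 r1 _ (D + D)) => m.
have h1 := pa m (fun j => ~~ u j) 0 B0; have h2 := pa m u 0 B0.
rewrite -oppr0 actN opprK in h1.
rewrite mulrDl; apply: le_trans (lerD h1 h2).
by have := qnormD al be0 (pi (fun j => ~~ u j) + act (gtile t n) m u 0)
  (pi u - act (gtile t n) m u 0); rewrite addrACA subrr addr0.
Qed.

Lemma qnorm_flip (al be : R) x : qnorm (- al) be x = qnorm al be (- x.1, x.2).
Proof. by rewrite /qnorm /=; congr Num.sqrt; ring. Qed.

Lemma cinv_scale_opp (t n : int) (al be : R) :
  (forall x, qnorm al be (cinv t n x) = Num.sqrt 2^-1 * qnorm al be x) ->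
  forall x, qnorm (- al) be (cinv (- t) n x) = Num.sqrt 2^-1 * qnorm (- al) be x.
Proof.
move=> h x; rewrite !qnorm_flip -h -(qnormN _ _ (cinv _ _ _)); congr qnorm.
by rewrite /cinv; congr pair; rewrite /= ?rmorphN /=; ring.
Qed.

(* Replacing the matrix by its opposite amounts to negating every second digit. *)
Definition alternate (b : bool) (u : nat -> bool) : nat -> bool :=
  fun j => u j (+) (b && ~~ odd j).

Lemma alternateK b u : alternate b (alternate b u) = u.
Proof. by apply/funext => j; rewrite /alternate -addbA addbb addbF. Qed.

(** The difference [v] of the digits and its image under the matrix form a basis in which, up to the
    sign (-1)^b, the matrix is the companion matrix and the digits are -1/2 and 1/2 after
    centring. *)
Lemma planar_attractor (t n : int) (al be : R) S Q pK pQ (b : bool) (M : 'M[int]_2) d0 d1 :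
  0 < be -> 4 * n - t ^+ 2 > 0 ->
  (forall x, qnorm al be (cinv t n x) = Num.sqrt 2^-1 * qnorm al be x) ->
  tile_coding t n al be S Q pK pQ ->
  generates R M d0 d1 -> M *m M = ((-1) ^+ b * t) *: M - n *: 1%:M ->
  affinely_similar (col2 @` range pK) (attractor R M [set d0; d1]).
Proof.
move=> be0 disc sc cd [_ detM nE] ME.
have n0 : n != 0 by apply: contraTneq disc => ->; rewrite mulr0 sub0r -leNgt oppr_le0 sqr_ge0.
have nR : n%:~R != 0 :> R by rewrite intr_eq0.
pose s : int := (-1) ^+ b * t.
pose A := int_to_real R M.
have Au : A \in unitmx.
  by rewrite unitmxE det_map_mx unitfE intr_eq0; apply: contra_eq_neq detM => ->; rewrite normr0.
have AE : A *m A = s%:~R *: A - n%:~R *: 1%:M.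
  by rewrite -map_mxM ME map_mxB !map_mxZ map_mx1.
pose a0 := int_to_real R d0; pose a1 := int_to_real R d1.
pose v := a1 - a0.
have v0 : v != 0.
  rewrite subr_eq0; apply/eqP => e; apply: nE; exists 0; rewrite mulmx0; apply/eqP.
  rewrite subr_eq0; apply/eqP/colP => i; apply: (@intr_inj R).
  by have /colP/(_ i) := e; rewrite !mxE.
pose sg : R := (-1) ^+ b.
pose m := 2^-1 *: (a0 + a1).
(* 1 is not an eigenvalue of [A]: s = 1 + n would give 4n - t^2 = -(n - 1)^2. *)
have D0 : s%:~R - 1 - n%:~R != 0 :> R.
  rewrite -(rmorph1 intr) -!rmorphB /= intr_eq0; apply: contraTneq disc => e.
  have sE : s = 1 + n by apply/eqP; rewrite -subr_eq0 opprD addrA e.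
  have : s ^+ 2 = t ^+ 2 by rewrite exprMn sqrr_sign mul1r.
  by move=> <-; rewrite sE -leNgt (_ : _ - _ = - (n - 1) ^+ 2) ?oppr_le0 ?sqr_ge0//; ring.
(* This is (A - 1)^-1 m, because (A - 1) (A + 1 - s) = s - 1 - n by the quadratic relation. *)
pose c := (s%:~R - 1 - n%:~R)^-1 *: (A *m m + (1 - s%:~R) *: m).
have cE : A *m c = c + m.
  rewrite /c; move: (m) => w.
  rewrite -scalemxAr mulmxDr mulmxA AE mulmxBl -!scalemxAl mul1mx -scalemxAr.
  by move: (A *m w) => Aw; apply/colP => i; rewrite !mxE; field.
pose P (x : R * R) := x.1 *: v + x.2 *: (sg *: (A *m v)).
have PA x : sg *: (A *m P x) = P (- n%:~R * x.2, x.1 + t%:~R * x.2).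
  rewrite /P mulmxDr -!scalemxAr mulmxA AE mulmxBl -!scalemxAl mul1mx.
  rewrite /s rmorphM rmorphXn /= rmorphN1.
  move: (v) (A *m v) => w Aw; apply/colP => i; rewrite !mxE /sg.
  by case: (b); rewrite ?expr0 ?expr1; ring.
have pKS w : (- n%:~R * (pK w).2, (pK w).1 + t%:~R * (pK w).2) = pK (wtail w) + digit (w 0%N).
  rewrite (addressS (coding_address cd) w) /gtile /cinv.
  by move: (_ + digit _) => [y z] /=; congr pair; field.
have PD x y : P (x + y) = P x + P y by rewrite /P /= !scalerDl addrACA.
have PN x : P (- x) = - P x by rewrite /P /= !scaleNr opprD.
have Psg x : sg *: P x = P (if b then - x else x).
  by rewrite /sg; case: (b); rewrite ?expr0 ?expr1 ?scale1r// scaleN1r PN.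
have pKN w : pK (fun j => ~~ w j) = - pK w.
  apply: address_opp be0 _ _ (coding_address cd); first exact: sqrt_half_ge0.
  by apply: le_lt_trans (@sqrt_half_lt R) _; lra.
(* For the sign -1 each step of the recursion negates the planar point; flipping every second letter
   compensates for this. *)
pose p u := P (pK (alternate b u)) + c.
have pS u : A *m p u = int_to_real R (if u 0%N then d1 else d0) + p (wtail u).
  rewrite /p mulmxDr cE -[A *m P _]scale1r (_ : 1 = sg * sg); last first.
    by rewrite /sg -expr2 sqrr_sign.
  rewrite -scalerA PA pKS PD scalerDr !Psg.
  have -> : P (if b then - pK (wtail (alternate b u)) else pK (wtail (alternate b u))) =
      P (pK (alternate b (wtail u))).
    case: (b); last by rewrite (_ : wtail (alternate false u) = alternate false (wtail u)).
    rewrite -pKN; congr (P (pK _)); apply/funext => j.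
    by rewrite /alternate /wtail /= negbK; case: (u _) (odd j) => [] [].
  have -> : P (if b then - digit (alternate b u 0%N) else digit (alternate b u 0%N)) = P (digit (u 0%N)).
    congr P; rewrite /alternate /= /digit; case: (b) => /=; last by rewrite addbF.
    by rewrite addbT; case: (u 0%N); congr pair; rewrite /=; ring.
  rewrite addrACA addrC; congr (_ + _).
  rewrite /P /digit /= scale0r addr0 /m /v.
  by case: (u 0%N); rewrite -/a0 -/a1; apply/colP => i; rewrite !mxE; field.
pose L : 'M[R]_2 := \matrix_(i, j) (if j == 0 then v i 0 else (sg *: (A *m v)) i 0).
have LE x : L *m col2 x = P x.
  apply/colP => i; rewrite [LHS]mxE big_ord_recl big_ord1 !mxE /=.
  by rewrite mulrC [X in _ + X]mulrC.
have rp : range p = (fun x => L *m x + c) @` (col2 @` range pK).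
  apply/seteqP; split => [_ [u _ <-]|_ [_ [_ [u _ <-] <-] <-]].
    by exists (col2 (pK (alternate b u))); [exists (pK (alternate b u))|rewrite LE].
  by exists (alternate b u) => //; rewrite /p alternateK LE.
exists L, c; split.
  rewrite unitmxE unitfE; apply/negP => /eqP.
  rewrite -det_tr => /eqP/det0P[w w0 wL].
  (* A relation between the two columns would be a zero of x1^2 + t x1 x2 + n x2^2, which is
     definite as 4n > t^2. *)
  pose x : R * R := (w 0 0, w 0 1).
  have Px : P x = 0.
    rewrite -LE (_ : col2 x = w^T); last first.
      by apply/colP => i; rewrite !mxE; case: ifP => [/eqP->//|]; case: i => [[|[|//]] h] //= _; congr (w _ _); apply: val_inj.
    by rewrite -[L]trmxK -trmx_mul wL trmx0.
  have := PA x; rewrite Px mulmx0 scaler0 => /esym PCx.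
  have : (x.1 ^+ 2 + t%:~R * x.1 * x.2 + n%:~R * x.2 ^+ 2) *: v = 0.
    transitivity ((x.1 + t%:~R * x.2) *: P x - x.2 *: P (- n%:~R * x.2, x.1 + t%:~R * x.2)).
      rewrite /P /=; move: (v) (sg *: _) => y z; apply/colP => i; rewrite !mxE; ring.
    by rewrite Px PCx !scaler0 subr0.
  move/eqP; rewrite scaler_eq0 (negPf v0) orbF => /eqP qx.
  have dR : 0 < 4 * n%:~R - t%:~R ^+ 2 :> R.
    by have := disc; rewrite -(ltr0z R) rmorphB rmorphM rmorphXn.
  have x20 : x.2 = 0.
    have := sqr_ge0 (2 * x.1 + t%:~R * x.2).
    rewrite (_ : _ ^+ 2 = 4 * (x.1 ^+ 2 + t%:~R * x.1 * x.2 + n%:~R * x.2 ^+ 2) -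
      (4 * n%:~R - t%:~R ^+ 2) * x.2 ^+ 2); last by ring.
    rewrite qx mulr0 sub0r oppr_ge0 pmulr_rle0// => h.
    by apply/eqP; rewrite -sqrf_eq0 eq_le h sqr_ge0.
  have x10 : x.1 = 0.
    by move: qx; rewrite x20 expr0n /= !mulr0 !addr0 => /eqP; rewrite sqrf_eq0 => /eqP.
  case/eqP: w0; apply/rowP => i; rewrite mxE.
  by case: i => [[|[|//]] h]; [rewrite -{}x10|rewrite -{}x20]; congr (w _ _); apply: val_inj.
rewrite -rp; apply: (attractor_range Au pS) => e e0.
have scs x : qnorm (sg * al) be (cinv s n x) = Num.sqrt 2^-1 * qnorm (sg * al) be x.
  rewrite /sg /s; case: (b); rewrite ?expr0 ?expr1 ?mul1r// !mulN1r; exact: cinv_scale_opp.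
have [x bx] : exists B, forall u, `|p u| <= B.
  exists ((qnorm_cst al be * 2) * `|v| + (qnorm_cst al be * 2) * `|sg *: (A *m v)| + `|c|) => u.
  apply: le_trans (ler_normD _ _) _; rewrite lerD2r.
  apply: le_trans (ler_normD _ _) _; rewrite !normrZ.
  have [h1 h2] := qnorm_coord al be0 (pK (alternate b u)).
  have h := address_in (coding_address cd) (alternate b u).
  have q0 := qnorm_cst_gt0 al be0.
  by apply: lerD; apply: ler_wpM2r => //; [apply: le_trans h1 _|apply: le_trans h2 _]; rewrite ler_pM2l.
have [|N0 h] := power_decay be0 n0 scs Au (ltn0Sn 0) _ x e0; first by rewrite !expr1.
by exists N0 => N u NN; apply: h.
Qed.

End PlanarAttractor.

Section DragonsBears.
Context {R : realType}.

Lemma char_poly_square (M : 'M[int]_2) (a b : int) :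
  char_poly M = 'X^2 - a%:P * 'X + b%:P -> M *m M = a *: M - b *: 1%:M.
Proof.
move=> e; have := Cayley_Hamilton M; rewrite e.
rewrite rmorphD rmorphB rmorphXn rmorphM /= horner_mx_X !horner_mx_C expr2 -[M * M]/(M *m M).
rewrite -[_ * M]/(_ *m M) mul_scalar_mx => h.
by apply/eqP; rewrite -subr_eq0 opprB addrA addrAC scalemx1 h.
Qed.

Variables (pB pQB pD pQD : (nat -> bool) -> R * R).
Hypothesis cB : tile_coding 1 2 (1/2) (7/4) bear_nbrs (@bear_hex R) pB pQB.
Hypothesis cD : tile_coding 2 2 1 1 dragon_nbrs (@dragon_hex R) pD pQD.

Lemma bear_similar K : bear K -> affinely_similar (col2 @` range pB) K.
Proof.
move=> [M [d0 [d1 [g cp /(affinely_similar_trans _)]]]]; apply.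
have [b e] : exists b : bool, M *m M = ((-1) ^+ b * 1) *: M - 2 *: 1%:M.
  case: cp => cp; [exists false|exists true]; apply: char_poly_square; rewrite cp mulr1 ?expr0 ?expr1.
    by rewrite mul1r.
  by rewrite polyCN mulNr opprK mul1r.
apply: (planar_attractor _ _ bear_scale cB g e) => //; lra.
Qed.

Lemma dragon_similar K : dragon K -> affinely_similar (col2 @` range pD) K.
Proof.
move=> [M [d0 [d1 [g cp /(affinely_similar_trans _)]]]]; apply.
have [b e] : exists b : bool, M *m M = ((-1) ^+ b * 2) *: M - 2 *: 1%:M.
  case: cp => cp; [exists false|exists true]; apply: char_poly_square; rewrite cp ?expr0 ?expr1.
    by rewrite mul1r.
  by rewrite mulN1r polyCN mulNr opprK.
by apply: (planar_attractor _ _ dragon_scale cD g e).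
Qed.

End DragonsBears.

Section ProductSimilar.
Context {R : realType} (d : nat).
Hypotheses (d_gt0 : (0 < d)%N) (d_even : ~~ odd d).

Lemma block_eq (x y : 'cV[R]_d) : (forall i, block x i = block y i) -> x = y.
Proof.
move=> h; pose f i := if insub i is Some i' then bpt y i' else 0.
have e z : (forall i, block z i = block y i) -> z = assemble d f.
  by move=> hz; apply: assemble_block => // i; rewrite /f valK hz col2_bpt.
by rewrite (e x h) -(e y).
Qed.

Lemma unitmx_ker n (L : 'M[R]_n) : (forall x : 'cV[R]_n, L *m x = 0 -> x = 0) -> L \in unitmx.
Proof.
move=> h; rewrite unitmxE unitfE -det_tr; apply/det0P => -[w w0 wL].
case/eqP: w0; apply: trmx_inj; rewrite trmx0; apply: h.
by rewrite -[L]trmxK -trmx_mul wL trmx0.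
Qed.

Lemma product_similar (T : set 'cV[R]_2) (K : 'I_d./2 -> set 'cV[R]_2) :
  (forall i, affinely_similar T (K i)) ->
  affinely_similar (planar_product (fun _ => T)) (planar_product K).
Proof.
move=> /choice[L /choice[b hLb]].
pose hf (l : 'I_d) := Ordinal (half_lt d_gt0 d_even l).
pose od (l : 'I_d) : 'I_2 := inord (odd l).
pose G : 'M[R]_d := \matrix_(l, m) (if hf l == hf m then L (hf l) (od l) (od m) else 0).
pose c : 'cV[R]_d := \col_l b (hf l) (od l) 0.
pose ix (i : 'I_d./2) (j : 'I_2) : 'I_d := Ordinal (block_index_subproof i j).
have hfE i j : hf (ix i j) = i.
  by apply: val_inj => /=; case: j => [[|[|//]] h] /=; rewrite ?addn0 ?addn1 /= ?doubleK ?uphalf_double.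
have odE i j : od (ix i j) = j.
  apply: val_inj; rewrite /= inordK oddD odd_double; by case: j => [[|[|//]] h].
have ixE l : l = ix (hf l) (od l).
  apply: val_inj; rewrite /= inordK; last by case: odd.
  by rewrite addnC odd_double_half.
have ix_inj i j i' j' : (ix i j == ix i' j') = (i == i') && (j == j').
  apply/eqP/andP => [h|[/eqP-> /eqP->]//].
  by have := congr1 hf h; have := congr1 od h; rewrite !hfE !odE => -> ->.
have blockG x i : block (G *m x) i = L i *m block x i.
  apply/colP => j; rewrite !mxE -/(ix i j) big_ord_recl big_ord1.
  rewrite (bigD1 (ix i 0))//= (bigD1 (ix i 1)) /= ?ix_inj ?andbF// [X in _ + (_ + X)]big1 ?addr0.
    rewrite !mxE !hfE !odE eqxx -!/(ix _ _).
    by congr (_ + L i j _ * x (ix i _) 0); apply: val_inj.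
  move=> l; rewrite {1 2}[l]ixE !ix_inj mxE hfE eq_sym.
  case: (i == hf l); last by rewrite mul0r.
  by case: (od l) => [[|[|//]] h].
have blockc x i : block (x + c) i = block x i + b i.
  by apply/colP => j; rewrite !mxE -/(ix i j) hfE odE.
have Gu : G \in unitmx.
  apply: unitmx_ker => x Gx; apply: block_eq => i.
  have [Lu _] := hLb i; rewrite -[LHS]mul1mx -(mulVmx Lu) -mulmxA -blockG Gx.
  rewrite (_ : block (0 : 'cV[R]_d) i = 0) ?mulmx0//.
  by apply/colP => j; rewrite !mxE.
exists G, c; split=> //; apply/seteqP; split=> [y hy|_ [x hx <-] i].
  have [fg gf] := affine_inv c Gu.
  exists (invmx G *m y + - (invmx G *m c)); last exact: gf.
  move=> i; have [Lu Ke] := hLb i; have := hy i; rewrite Ke => -[t Tt tE].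
  have := congr1 (fun z => block z i) (gf y); rewrite blockc blockG -tE => /addIr.
  by move=> /(congr1 (mulmx (invmx (L i)))); rewrite !mulmxA mulVmx// !mul1mx => ->.
have [Lu ->] := hLb i; rewrite blockc blockG.
by exists (block x i) => //; apply: hx.
Qed.

Lemma cube_similar : affinely_similar [set x : 'cV[R]_d | forall i, 0 <= x i 0 <= 1]
  (planar_product (fun _ => col2 @` (@square R))).
Proof.
exists 1%:M, (\col_i (- 2^-1)); split; first exact: unitmx1.
apply/seteqP; split=> [y /(cubeE d_gt0 d_even) hy|_ [x hx <-]].
  exists (y + \col_i 2^-1); last by apply/colP => i; rewrite mul1mx !mxE addrK.
  by move=> i; have := hy i; rewrite !mxE ler_norml => /andP[h1 h2]; apply/andP; split; lra.
by apply/(cubeE d_gt0 d_even) => i; have /andP[h1 h2] := hx i; rewrite mul1mx !mxE ler_norml; apply/andP; split; lra.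
Qed.

End ProductSimilar.

(** * Eigenvalues of roots of a quadratic matrix *)

Section BlockRoots.
Context {R : realType}.
Local Notation C := (complex R).

Lemma eigen_power d (M : 'M[C]_d) k (t n z : C) :
  M ^+ k *m M ^+ k = t *: M ^+ k - n *: 1%:M -> eigenvalue M z ->
  z ^+ k ^+ 2 - t * z ^+ k + n = 0.
Proof.
move=> ME /eigenvalueP[v vM v0].
have vk i : v *m M ^+ i = z ^+ i *: v.
  elim: i => [|i IH]; first by rewrite !expr0 mulmx1 scale1r.
  by rewrite exprSr -[_ * M]/(_ *m M) mulmxA IH -scalemxAl vM scalerA -exprSr.
have := congr1 (mulmx v) ME; rewrite mulmxA vk -scalemxAl vk mulmxBr -!scalemxAr vk mulmx1.
rewrite !scalerA -scalerBl => /eqP; rewrite -subr_eq0 -scalerBl scaler_eq0 (negPf v0) orbF.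
by move=> /eqP <-; ring.
Qed.

(** With negative discriminant the roots are complex conjugate and their product is n; for t = 0 the
    square of the root is -n. *)
Lemma quadratic_modulus (t n : int) (w : C) : (t ^+ 2 < 4 * n \/ t = 0) -> `|n| = 2 ->
  w ^+ 2 - t%:~R * w + n%:~R = 0 -> `|w| ^+ 2 = 2.
Proof.
move=> [disc|->] n2; last first.
  rewrite mul0r subr0 => /eqP; rewrite addr_eq0 => /eqP e.
  by rewrite -normrX e normrN -intr_norm n2.
case: w => a b; rewrite sqr_normc => /eqP; rewrite expr2.
have HC (m : int) : m%:~R = (m%:~R)%:C%C :> C by rewrite rmorph_int.
rewrite (HC t) (HC n) eq_complex /= => /andP[/eqP h1 /eqP h2].
have dR : t%:~R ^+ 2 < 4 * n%:~R :> R by have := disc; rewrite -(ltr_int R) rmorphXn rmorphM.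
have n2' : n = 2 by have := sqr_ge0 t; lia.
rewrite n2' in h1 dR.
have tb : b != 0.
  apply/eqP => b0; rewrite b0 in h1; have := sqr_ge0 (2 * a - t%:~R).
  rewrite (_ : _ ^+ 2 = 4 * (a * a - t%:~R * a + 2%:~R) + (t%:~R ^+ 2 - 4 * 2%:~R)); last by ring.
  have -> : a * a - t%:~R * a + 2%:~R = 0 by rewrite -h1; ring.
  by rewrite mulr0 add0r subr_ge0 leNgt dR.
have ta : t%:~R = 2 * a.
  apply: (mulIf tb); apply/eqP; rewrite eq_sym -subr_eq0; apply/eqP; rewrite -[RHS]h2; ring.
rewrite -[2](rmorph_nat (real_complex R)); apply/eqP; rewrite eq_complex /=; apply/andP; split; apply/eqP.
  by move: h1; rewrite ta => h1; lra.
by ring.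
Qed.

(** X^(2k) - t X^k + n annihilates [M] and has simple roots: its derivative k X^(k-1) (2 X^k - t)
    vanishes at a root only if that root is 0, excluded by n != 0, or if t^2 = 4n. *)
Lemma block_diagonalizable d (M : 'M[C]_d.+1) k (t n : C) : (0 < k)%N -> n != 0 -> t ^+ 2 != 4 * n ->
  M ^+ k *m M ^+ k = t *: M ^+ k - n *: 1%:M -> diagonalizable M.
Proof.
move=> k0 n0 disc ME; apply/diagonalizableP.
pose p : {poly C} := 'X^k ^+ 2 - t *: 'X^k + n%:P.
have p0 x : root p x = (x ^+ k ^+ 2 - t * x ^+ k + n == 0).
  by rewrite /root /p !hornerE.
have hp : horner_mx M p = 0.
  rewrite /p rmorphD rmorphB /= linearZ /= !rmorphXn /= horner_mx_X horner_mx_C.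
  by rewrite expr2 -[_ * _]/(_ *m _) ME scalemx1 addrAC subrK subrr.
have [rs prs] := closed_field_poly_normal p.
have sp : separable_poly p.
  rewrite separable_poly.unlock; apply: (@Pdiv.ClosedField.root_coprimep C) => x; rewrite p0 => /eqP px.
  have x0 : x != 0.
    by apply: contra_eq_neq px => ->; rewrite expr0n gtn_eqF//= expr0n mulr0 subr0 add0r.
  have q0 : 2 * x ^+ k - t != 0.
    apply: contraNneq disc => e; rewrite -subr_eq0 (_ : _ - _ = (2 * x ^+ k - t) ^+ 2 -
      4 * (x ^+ k ^+ 2 - t * x ^+ k + n)); last by ring.
    by rewrite px e expr0n mulr0 subrr.
  have -> : p^`() = (2 *: 'X^k - t%:P) * ('X^k)^`().
    by rewrite /p derivD derivB derivC derivZ expr2 derivM -mul_polyC; rewrite -!mul_polyC; ring.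
  rewrite derivXn !hornerE hornerMn -[_ *+ k]mulr_natl hornerXn.
  by apply: mulf_neq0 => //; apply: mulf_neq0; [rewrite pnatr_eq0 -lt0n|exact: expf_neq0].
exists rs.
  by move: sp; rewrite prs -mul_polyC separable_mul => /and3P[_ + _]; rewrite separable_prod_XsubC.
apply/mxminpoly_minP; move: hp; rewrite {1}prs linearZ /= => /eqP.
rewrite scaler_eq0 lead_coef_eq0 => /orP[/eqP pz|/eqP//].
by move: sp; rewrite pz separable_poly.unlock deriv0 coprimep0 -size_poly_eq1 size_poly0.
Qed.

End BlockRoots.

Section BlockCycle.
Variables (t n : int).

(* On [d./2] planar blocks this is (x_0, ..., x_(k-1)) |-> (C x_(k-1), x_0, ..., x_(k-2)), where [C]
   is the companion matrix of X^2 - tX + n. *)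
Definition block_cycle d : 'M[int]_d := \matrix_(l, m)
  (if (l : nat) is l'.+2 then (m == l' :> nat)%:R
   else if (l : nat) == 1%N then (m == d.-2 :> nat)%:R + t * (m == d.-1 :> nat)%:R
   else - n * (m == d.-1 :> nat)%:R).

(** The first row has the single entry -n in the last column, which also holds the entry t; the
    remaining minor is a permutation matrix. *)
Lemma block_cycle_det d : `|\det (block_cycle d.+2)| = `|n|.
Proof.
rewrite (expand_det_row _ ord0) (bigD1 ord_max)//= big1 => [|m hm]; last first.
  rewrite mxE /= (_ : (m == d.+1 :> nat) = false) ?mulr0 ?mul0r//.
  by apply/negbTE; apply: contraNneq hm => e; apply/eqP/val_inj.
have -> : block_cycle d.+2 ord0 ord_max = - n by rewrite mxE /= eqxx; apply: mulr1.
rewrite addr0 normrM normrN -[RHS]mulr1; congr (_ * _).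
rewrite /cofactor normrM normrX normrN1 expr1n mul1r.
have -> : row' ord0 (col' ord_max (block_cycle d.+2)) = perm_mx (perm (@ord_pred_inj d.+1)).
  apply/matrixP => l m; rewrite !mxE permE lift0 lift_max -val_eqE /=.
  case: l => [[|l] hl] /=.
    by rewrite modn_small// (ltn_eqF (ltn_ord m)) mulr0n mulr0 addr0 eq_sym.
  by rewrite modnDr modn_small 1?ltnW// eq_sym.
by rewrite det_perm normrX normrN1 expr1n.
Qed.

Section Action.
Context {R : realType} (d : nat).
Hypotheses (d_gt0 : (0 < d)%N) (d_even : ~~ odd d).
Local Notation k := (d./2).
Local Notation A := (int_to_real R (block_cycle d)).

Definition turn (x : R * R) : R * R := (- n%:~R * x.2, x.1 + t%:~R * x.2).

Lemma block_cycle_act (f : nat -> R * R) :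
  A *m assemble d f = assemble d (fun i => if i is i'.+1 then f i' else turn (f k.-1)).
Proof.
pose X m := if odd m then (f m./2).2 else (f m./2).1.
have sumX c a : (c < d)%N -> \sum_(m < d) (a * (m == c :> nat)%:R) * X m = a * X c :> R.
  move=> cd; rewrite (bigD1 (Ordinal cd))//= eqxx mulr1 big1 ?addr0// => m hm.
  rewrite (_ : (m == c :> nat) = false) ?mulr0 ?mul0r//.
  by apply/negbTE; apply: contraNneq hm => e; apply/eqP/val_inj.
have d2 : d = (k.-1.*2).+2.
  by have := odd_double_half d; rewrite (negPf d_even); lia.
have l1 : (d.-1 < d)%N by lia.
have l2 : (d.-2 < d)%N by lia.
have d1E : d.-1 = (k.-1.*2).+1 by move: (k) d2 => ? ->.
have d2E : d.-2 = k.-1.*2 by move: (k) d2 => ? ->.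
have X1 : X d.-1 = (f k.-1).2 by rewrite /X d1E /= odd_double uphalf_double.
have X2 : X d.-2 = (f k.-1).1 by rewrite /X d2E odd_double doubleK.
clear d2 d1E d2E.
apply/colP => -[l ld]; rewrite [LHS]mxE [RHS]mxE.
under eq_bigr do rewrite !mxE -/(X _).
case: l ld => [|[|l]] ld /=.
- under eq_bigr do rewrite rmorphM rmorphN /= rmorph_nat.
  by rewrite sumX// X1.
- under eq_bigr do rewrite rmorphD rmorphM /= !rmorph_nat mulrDl -[X in X * _ + _]mul1r.
  by rewrite big_split /= !sumX// mul1r X1 X2.
under eq_bigr do rewrite rmorph_nat -[X in X * _]mul1r.
rewrite sumX ?mul1r; last lia.
by rewrite /X negbK.
Qed.

End Action.
End BlockCycle.

Section Isotropic.
Context {R : realType} (d : nat).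
Hypotheses (d_gt0 : (0 < d)%N) (d_even : ~~ odd d).
Variables (t n : int).
Local Notation k := (d./2).
Local Notation M := (block_cycle t n d).
Local Notation A := (int_to_real R M).

Lemma pairs_gt0 : (0 < k)%N.
Proof. by have := odd_double_half d; rewrite (negPf d_even); lia. Qed.

Lemma block_cycle_pow j (f : nat -> R * R) : (j <= k)%N ->
  A ^+ j *m assemble d f =
  assemble d (fun i => if (i < j)%N then turn t n (f (k + i - j)%N) else f (i - j)%N).
Proof.
elim: j => [|j IH] jk.
  by rewrite expr0 mul1mx; apply: assemble_eq => // i _; rewrite ltn0 subn0.
rewrite exprS -[A * _]/(A *m _) -mulmxA IH ?(ltnW jk)// block_cycle_act//.
apply: assemble_eq => // -[|i] ik.
  have -> : (k.-1 < j)%N = false by have := pairs_gt0; lia.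
  by rewrite /= addn0; congr (turn _ _ (f _)); lia.
by rewrite ltnS addnS !subSS.
Qed.

Lemma assemble_ex (x : 'cV[R]_d) : exists f, x = assemble d f.
Proof.
exists (fun i => if insub i is Some i' then bpt x i' else 0).
by apply: assemble_block => // i; rewrite valK col2_bpt.
Qed.

Lemma block_cycle_square_real : A ^+ k *m A ^+ k = t%:~R *: A ^+ k - n%:~R *: 1%:M.
Proof.
suff h (x : 'cV[R]_d) : A ^+ k *m A ^+ k *m x = (t%:~R *: A ^+ k - n%:~R *: 1%:M) *m x.
  apply/matrixP => i j; have := congr1 (fun y : 'cV_d => y i 0) (h (delta_mx j 0)).
  by rewrite -!colE ![col _ _ _ _]mxE.
have [f ->] := assemble_ex x.
rewrite mulmxBl -!scalemxAl mul1mx -mulmxA !block_cycle_pow//.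
apply/colP => l; rewrite !mxE.
have lk : (l./2 < k)%N by apply: half_lt.
by rewrite !addKn !lk /turn /=; case: odd; ring.
Qed.

Lemma block_cycle_square : M ^+ k *m M ^+ k = t *: M ^+ k - n *: 1%:M.
Proof.
apply/matrixP => i j; apply: (@intr_inj R).
have := block_cycle_square_real; rewrite /int_to_real -!rmorphXn /= -map_mxM.
by move=> /matrixP/(_ i j); rewrite !mxE rmorphB !rmorphM /= rmorph_nat.
Qed.

Lemma block_cycle_square_complex (C := complex R) :
  int_to_complex R M ^+ k *m int_to_complex R M ^+ k =
  t%:~R *: int_to_complex R M ^+ k - n%:~R *: 1%:M.
Proof.
rewrite /int_to_complex -!rmorphXn /= -map_mxM block_cycle_square.
by rewrite map_mxB !map_mxZ map_mx1.
Qed.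

End Isotropic.

Section IsotropicType.
Context {R : realType} (d : nat).
Hypotheses (d_gt0 : (0 < d)%N) (d_even : ~~ odd d).
Variables (t n : int).
Local Notation k := (d./2).
Local Notation M := (block_cycle t n d).
Local Notation A := (int_to_real R M).
Hypotheses (n_abs : `|n| = 2) (t_n : t ^+ 2 < 4 * n \/ t = 0).
Hypothesis trace_n : 1 - t + n != 0.

Definition unit_digit : 'cV[int]_d := \col_l (l == 0%N :> nat)%:R.

Let n_neq0 : n != 0. Proof. by apply: contra_eq_neq n_abs => ->; rewrite normr0. Qed.

Lemma cycle_eigen (z : complex R) : eigenvalue (int_to_complex R M) z -> `|z| ^+ k ^+ 2 = 2.
Proof.
move=> /(eigen_power (block_cycle_square_complex (R:=R) d_gt0 d_even t n)).
by rewrite -normrX; apply: quadratic_modulus.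
Qed.

Lemma cycle_expanding : expanding R M.
Proof.
move=> z /cycle_eigen; rewrite -exprM => e; rewrite real_ltNge ?real1 ?normr_real//; apply/negP => z1.
have := exprn_ile1 (k * 2)%N (normr_ge0 z) z1; rewrite e.
by rewrite (ler_nat _ 2 1).
Qed.

Lemma cycle_generates : generates R M 0 unit_digit.
Proof.
split; first exact: cycle_expanding.
  have d2 : d = d.-2.+2 by have := odd_double_half d; rewrite (negPf d_even); lia.
  by rewrite d2 block_cycle_det.
(* The first row of the matrix is divisible by n, so the coordinate 1 of [unit_digit] is not
   attained. *)
move=> [w]; rewrite subr0 => /colP/(_ (Ordinal d_gt0)); rewrite !mxE /=.
under eq_bigr do rewrite mxE /= -mulrA.
rewrite -mulr_sumr; move: (\sum_(_ < _) _) => s e.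
have := n_abs; lia.
Qed.

Lemma cycle_diagonalizable : diagonalizable (int_to_complex R M).
Proof.
have := block_cycle_square_complex (R:=R) d_gt0 d_even t n.
have := pairs_gt0 d_gt0 d_even.
move: (k); rewrite -(prednK d_gt0) => j j0 ME.
apply: (block_diagonalizable j0 _ _ ME); first by rewrite intr_eq0.
rewrite -(rmorphXn intr) -[4]/(4%:~R) -intrM /= eqr_int.
by case: t_n => [h|->]; [rewrite lt_eqF|rewrite expr0n /= eq_sym mulf_neq0].
Qed.

Variables (al be rho D : R) (Q : set (R * R)) (pi : (nat -> bool) -> R * R).
Hypotheses (be_gt0 : 0 < be).
Hypothesis cinv_scale : forall x, qnorm al be (cinv t n x) = Num.sqrt 2^-1 * qnorm al be x.
Hypothesis pi_address : address al be rho D (gtile t n) Q pi.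

Let nR : n%:~R != 0 :> R. Proof. by rewrite intr_eq0. Qed.
Let DR : 1 - t%:~R + n%:~R != 0 :> R.
Proof. by rewrite -(rmorph1 intr) -rmorphB -rmorphD /= intr_eq0. Qed.

(* The digits 0 and e_0 are centred at this point, [digit] being centred at 0. *)
Definition cycle_center : R * R :=
  ((t%:~R - 1) / (2 * (1 - t%:~R + n%:~R)), - 1 / (2 * (1 - t%:~R + n%:~R))).

Definition cycle_pt (w : nat -> bool) : R * R := pi w + cycle_center.

Lemma cycle_ptS w : turn t n (cycle_pt w) = (if w 0%N then (1, 0) else 0) + cycle_pt (wtail w).
Proof.
rewrite /cycle_pt (addressS pi_address w) /gtile /cinv /turn /cycle_center /digit.
by move: (pi (wtail w)) => [y z]; case: (w 0%N); congr pair; rewrite /=; field; rewrite ?nR ?DR.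
Qed.

Lemma cycle_attractor : affinely_similar (planar_product (fun _ : 'I_k => col2 @` range pi))
  (attractor R M [set 0; unit_digit]).
Proof.
(* The matrix moves block i to block i + 1 and the new letter enters in block 0, so the blocks read
   the subwords in reverse order. *)
pose p u := assemble d (fun i => cycle_pt (subword d u (k.-1 - i))).
have k0 := pairs_gt0 d_gt0 d_even.
have pS u : A *m p u = int_to_real R (if u 0%N then unit_digit else 0) + p (wtail u).
  rewrite block_cycle_act// (_ : int_to_real R _ =
    assemble d (fun i => if i is 0 then if u 0%N then (1, 0) else 0 else 0)); last first.
    apply/colP => l; rewrite !mxE; case: (u 0%N); rewrite ?mxE.
      case: l => [[|[|l]] hl]; rewrite ?rmorph1 ?rmorph0//=; by case: odd.
    by case: l => [[|[|l]] hl]; rewrite ?rmorph0//=; case: odd.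
  rewrite (_ : assemble d _ + _ = assemble d (fun i => (if i is 0 then if u 0%N then (1, 0) else 0 else 0)
    + cycle_pt (subword d (wtail u) (k.-1 - i)))); last by apply/colP => l; rewrite !mxE; case: odd.
  apply: assemble_eq => // -[|i] ik.
    rewrite subnn cycle_ptS /subword mul0n; congr (_ + cycle_pt _); apply/funext => j.
    by rewrite /wtail subn0; congr u; have := k0; rewrite mulSn; lia.
  rewrite add0r; congr (cycle_pt _); apply/funext => j; rewrite /subword /wtail; congr u; lia.
have rp : range p = planar_product (fun _ : 'I_k => col2 @` range cycle_pt).
  rewrite -spread_range//; apply/seteqP; split=> _ [u _ <-].
    have [w hw] := subword_surj d_gt0 d_even (fun i => subword d u (k.-1 - i)).
    by exists w => //; apply: assemble_eq => // i ik; rewrite hw.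
  have [w hw] := subword_surj d_gt0 d_even (fun i => subword d u (k.-1 - i)).
  exists w => //; apply: assemble_eq => // i ik; rewrite hw; last lia.
  by congr (cycle_pt (subword _ _ _)); lia.
have Au : A \in unitmx.
  have [_ dM _] := cycle_generates.
  by rewrite unitmxE det_map_mx unitfE intr_eq0; apply: contra_eq_neq dM => ->; rewrite normr0.
pose u0 : nat -> bool := fun=> true.
pose B := qnorm_cst al be * (2 * D + qnorm al be (pi u0)) + `|cycle_center.1| + `|cycle_center.2|.
have pb u : `|p u| <= B.
  have hb w : `|(cycle_pt w).1| <= B /\ `|(cycle_pt w).2| <= B.
    have h : qnorm al be (pi w) <= 2 * D + qnorm al be (pi u0).
      have := qnorm_triangle al be_gt0 (pi u0) (pi w) 0; rewrite !subr0 => /le_trans; apply.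
      rewrite lerD2r; have := address_modulus be_gt0 pi_address (n := 0) (u := w) (v := u0).
      by rewrite mulr1; apply.
    have [h1 h2] := qnorm_coord al be_gt0 (pi w).
    have q0 := qnorm_cst_gt0 al be_gt0.
    have hq : qnorm_cst al be * qnorm al be (pi w) <= qnorm_cst al be * (2 * D + qnorm al be (pi u0)).
      by rewrite ler_pM2l.
    have c1 := normr_ge0 cycle_center.1; have c2 := normr_ge0 cycle_center.2.
    have a1 := ler_normD (pi w).1 cycle_center.1; have a2 := ler_normD (pi w).2 cycle_center.2.
    by rewrite /B /=; split; lra.
  apply: norm_le_coord => [|l]; first exact: le_trans (hb u0).1.
  by rewrite mxE; case: odd; [apply: (hb _).2|apply: (hb _).1].
rewrite (attractor_range (p := p)) ?rp //.
- apply: product_similar => // _; exists 1%:M, (col2 cycle_center); split; first exact: unitmx1.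
  apply/seteqP; split=> [_ [_ [u _ <-] <-]|_ [_ [_ [u _ <-] <-] <-]].
    exists (col2 (pi u)); first by exists (pi u).
    by apply/colP => i; rewrite mul1mx !mxE; case: ifP.
  exists (cycle_pt u); first by exists u.
  by apply/colP => i; rewrite mul1mx !mxE; case: ifP.
- move=> e e0.
  have [N0 h] := power_decay be_gt0 n_neq0 cinv_scale Au k0
    (block_cycle_square_real d_gt0 d_even t n) B e0.
  by exists N0 => N u NN; apply: h.
Qed.

Lemma cycle_isotropic_type G : affinely_similar (planar_product (fun _ : 'I_k => col2 @` range pi)) G ->
  isotropic_type G.
Proof.
move=> /(affinely_similar_trans (affinely_similar_sym cycle_attractor)) GG.
exists (attractor R M [set 0; unit_digit]) => //; exists M, 0, unit_digit; split=> //.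
- exact: cycle_generates.
- exact: cycle_diagonalizable.
move=> z w /cycle_eigen e1 /cycle_eigen e2; have := etrans e1 (esym e2); rewrite -!exprM => /eqP.
have k0 := pairs_gt0 d_gt0 d_even.
by rewrite eqrXn2 ?muln_gt0 ?k0// => /eqP.
Qed.

End IsotropicType.

Theorem theorem5 (R : realType) (d : nat) (d_gt0 : (0 < d)%N)
    (d_even : ~~ odd d) (P D B : set 'cV[R]_d)
    (hP : parallelepiped P) (hD : product_of_dragons D)
    (hB : product_of_bears B) :
  [/\ isotropic_type P, isotropic_type D & isotropic_type B] /\
  [/\ homeomorphic P D, homeomorphic D B & homeomorphic P B] /\
  [/\ ~ bilipschitz_equivalent P D, ~ bilipschitz_equivalent D B &
      ~ bilipschitz_equivalent P B].
Proof.
have [pB [qB cB]] := @bear_coding R; have [pD [qD cD]] := @dragon_coding R.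
have [pS [rho aS] rS] := @square_address R.
have sP := affinely_similar_trans (affinely_similar_sym (cube_similar d_gt0 d_even)) hP.
have {hD}[KD [hKD sD]] := hD; have {hB}[KB [hKB sB]] := hB.
have {hKD}sD := affinely_similar_trans (product_similar d_gt0 d_even (fun i => dragon_similar cD (hKD i))) sD.
have {hKB}sB := affinely_similar_trans (product_similar d_gt0 d_even (fun i => bear_similar cB (hKB i))) sB.
have hP0 := affinely_similar_homeomorphic sP.
have hD0 := affinely_similar_homeomorphic sD.
have hB0 := affinely_similar_homeomorphic sB.
have hSD := square_dragon_homeomorphic d_gt0 d_even cD.
have hSB := square_bear_homeomorphic d_gt0 d_even cB.
have PD : homeomorphic P D.
  exact: homeomorphic_trans (homeomorphic_sym hP0) (homeomorphic_trans hSD hD0).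
have PB : homeomorphic P B.
  exact: homeomorphic_trans (homeomorphic_sym hP0) (homeomorphic_trans hSB hB0).
split; first split.
- have t_n : 0 ^+ 2 < 4 * -2 :> int \/ 0 = 0 :> int by right.
  have be0 : 0 < 2 :> R by [].
  apply: (cycle_isotropic_type d_gt0 d_even _ t_n _ be0 (@square_scale R) aS) => //.
  by rewrite rS.
- have t_n : 2 ^+ 2 < 4 * 2 :> int \/ 2 = 0 :> int by left.
  exact: (cycle_isotropic_type d_gt0 d_even _ t_n _ ltr01 (@dragon_scale R) (coding_address cD)).
- have t_n : 1 ^+ 2 < 4 * 2 :> int \/ 1 = 0 :> int by left.
  have be0 : 0 < 7 / 4 :> R by lra.
  exact: (cycle_isotropic_type d_gt0 d_even _ t_n _ be0 (@bear_scale R) (coding_address cB)).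
split; first split=> //.
  exact: homeomorphic_trans (homeomorphic_sym PD) PB.
have lP := affinely_similar_lip (affinely_similar_sym sP).
have lP' := affinely_similar_lip sP.
have lD := affinely_similar_lip (affinely_similar_sym sD).
have lB := affinely_similar_lip (affinely_similar_sym sB).
have lB' := affinely_similar_lip sB.
split=> /bilipschitz_equivalent_lip[h h'].
- apply: (cube_not_dragon d_gt0 d_even cD).
  exact: lip_homeomorphic_trans lP' (lip_homeomorphic_trans h lD).
(* The inverse map is taken: covers have to go from the bears to the dragons, whose boundary grows
   faster. *)
- apply: (bear_not_dragon d_gt0 d_even cB cD).
  exact: lip_homeomorphic_trans lB' (lip_homeomorphic_trans h' lD).
apply: (cube_not_bear d_gt0 d_even cB).
exact: lip_homeomorphic_trans lP' (lip_homeomorphic_trans h lB).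
Qed.
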